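(* Let $A,B\subset\mathbb{R}^2$ be two Borel sets such that $\dim_H(A)>1$ and $B$ is $(s,C)$-Ahlfors regular for some $s>1$ and some $C>1$. Then $$\dim_H\left(\{x\in A:\ \overline{\dim}_B(\mathrm{dist}(x,B))<1\}\right)\le 1.$$ In particular, this applies to $A=B$.
   Context: A set $E\subset\mathbb{R}^d$ is $(s,C)$-Ahlfors regular if there exists a Borel measure $\mu\neq0$ supported on $E$ (i.e. $\mu(\mathbb{R}^d\setminus E)=0$) such that $C^{-1}r^s\le\mu(B(x,r))\le Cr^s$ for all $x\in\mathrm{supp}(\mu)$ and all $r\in(0,1]$. $\dim_H$ is Hausdorff dimension, and $\mathrm{dist}(x,B)=\{|x-y|:y\in B\}$. For $F\subset\mathbb{R}^d$, $\mathcal{N}(F,\delta)$ is the number of $\delta$-grid cubes that intersect $F$ (with value $+\infty$ if there are infinitely many), and the upper box-counting dimension is $\overline{\dim}_B(F)=\limsup_{\delta\downarrow0}\frac{\log\mathcal{N}(F,\delta)}{-\log\delta}$ (equal to $+\infty$ for unbounded $F$). *)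

(* Defs.v *)
From HB Require Import structures.
From mathcomp Require Import all_boot all_order all_algebra.
From mathcomp Require Import all_classical all_reals all_analysis.

Set Implicit Arguments.
Unset Strict Implicit.
Unset Printing Implicit Defensive.

Import Order.TTheory GRing.Theory Num.Theory.
Import numFieldNormedType.Exports.

Local Open Scope classical_set_scope.
Local Open Scope ring_scope.
Local Open Scope ereal_scope.

(* The library norm on ['rV[R]_d] is the sup norm; metric notions below use the
   Euclidean distance instead.  Both induce the same topology, so [open] and
   the Borel sets are the usual ones. *)
Definition eucl_dist (R : realType) (d : nat) (x y : 'rV[R]_d) : R :=
  Num.sqrt (\sum_(i < d) (x ord0 i - y ord0 i) ^+ 2)%R.

Definition eucl_closed_ball (R : realType) (d : nat) (x : 'rV[R]_d) (r : R) :
    set 'rV[R]_d :=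
  [set y | (eucl_dist x y <= r)%R].

Definition borel_set (R : realType) (d : nat) (A : set 'rV[R]_d) : Prop :=
  <<s @open 'rV[R]_d >> A.

Notation borel_measure R d :=
  {measure set (g_sigma_algebraType (@open 'rV[R]_d)) -> \bar R}.

Definition msupport (R : realType) (d : nat) (mu : borel_measure R d) :
    set 'rV[R]_d :=
  [set x | forall U : set 'rV[R]_d, open U -> U x -> 0 < mu U].

Definition ahlfors_regular (R : realType) (d : nat) (s C : R)
    (E : set 'rV[R]_d) : Prop :=
  exists mu : borel_measure R d,
    [/\ mu setT != 0,
        mu (~` E) = 0 &
        forall (x : 'rV[R]_d) (r : R), msupport mu x -> (0 < r <= 1)%R ->
          (C^-1 * r `^ s)%:E <= mu (eucl_closed_ball x r) <= (C * r `^ s)%:E].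

(* The added point 0 only matters for the empty set, whose diameter is 0. *)
Definition diam (R : realType) (d : nat) (U : set 'rV[R]_d) : \bar R :=
  ereal_sup (0 |` [set (eucl_dist x y)%:E | x in U & y in U]).

(* [diam U] to the power t, with value 0 on the empty set also when t = 0. *)
Definition diam_pow (R : realType) (d : nat) (t : R) (U : set 'rV[R]_d) :
    \bar R :=
  if `[< U = set0 >] then 0 else diam U `^ t.

Definition hausdorff_premeasure (R : realType) (d : nat) (t delta : R)
    (E : set 'rV[R]_d) : \bar R :=
  ereal_inf [set \sum_(0 <= i <oo) diam_pow t (U i) | U in
    [set U : nat -> set 'rV[R]_d |
      E `<=` \bigcup_i U i /\ forall i, diam (U i) <= delta%:E]].

Definition hausdorff_measure (R : realType) (d : nat) (t : R)
    (E : set 'rV[R]_d) : \bar R :=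
  ereal_sup [set hausdorff_premeasure t delta E | delta in
    [set delta : R | (0 < delta)%R]].

Definition hausdorff_dim (R : realType) (d : nat) (E : set 'rV[R]_d) : \bar R :=
  ereal_inf [set t%:E | t in
    [set t : R | (0 <= t)%R /\ hausdorff_measure t E = 0]].

Definition grid_cube (R : realType) (d : nat) (delta : R) (k : 'rV[int]_d) :
    set 'rV[R]_d :=
  [set x | forall i : 'I_d,
    ((k ord0 i)%:~R * delta <= x ord0 i < ((k ord0 i)%:~R + 1) * delta)%R].

Definition grid_count (R : realType) (d : nat) (F : set 'rV[R]_d) (delta : R) :
    \bar R :=
  counting [set k : 'rV[int]_d | F `&` grid_cube delta k !=set0].

Definition upper_box_dim (R : realType) (d : nat) (F : set 'rV[R]_d) : \bar R :=
  limf_esup (fun delta : R => lne (grid_count F delta) * ((- ln delta)^-1)%:E)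
    0^'+%R.

(* The set of distances from x to B, as a subset of the line ['rV[R]_1]. *)
Definition dist_set (R : realType) (d : nat) (x : 'rV[R]_d)
    (B : set 'rV[R]_d) : set 'rV[R]_1 :=
  [set const_mx (eucl_dist x y) | y in B].

(* Main.v *)
(** If the exceptional set had positive t-dimensional Hausdorff measure for some t > 1, then by
    countable subadditivity so would the set of its points x in a small cell, away from and seen
    in a fixed sector from a point y1 of supp mu, with N(dist(x,B), delta) <= delta^-(1-e) for all
    small delta.  At a given scale, a greedy construction puts on finitely many of these points a
    probability nu which is t-Frostman, and mu near y1 becomes an s-Frostman probability on
    finitely many points of B.

    Since s, t > 1, the energies of nu and mu at exponent 1 are bounded.  Comparing the nu-mass of
    a tube with its average over parallel translates in an L2 sense over all tubes, these energies
    control the (nu x mu)-mass of the rich pairs (x, y), for which the r-tube through x and y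
    carries nu-mass more than lam r: it tends to 0 as lam grows and r goes to 0, at a rate
    depending only on the Frostman constants.  Over a fixed y, points x that are not rich and see
    y and y' at almost equal distances lie in a thin strip around a line through y, so their
    nu-mass is O(lam r) (Kaufman's argument).  Integrating, for most pairs (x, y) the mass of the
    cell of size r^k around y seen from x at distance |x - y| + O(r^(k+1)) is at most a = r^(1-e)
    times the mass of the cell.  For some x this holds for most (k, y) with k <= K; then, as
    -ln z >= ln (1/a) + 1 - z/a, adding up the logarithms of the ratios of masses of successive
    annuli gives an average decay, hence about r^-(1-e)K cells of size r^K meeting dist(x, B),
    contradicting the choice of x. *)
Require Import Defs.
From HB Require Import structures.
From mathcomp Require Import all_boot all_order all_algebra.
From mathcomp Require Import ring lra zify.
From mathcomp Require Import all_classical all_reals all_analysis.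

Set Implicit Arguments.
Unset Strict Implicit.
Unset Printing Implicit Defensive.

Import Order.TTheory GRing.Theory Num.Theory.
Import numFieldNormedType.Exports.
Local Open Scope ring_scope.

(** * Energies of Frostman measures *)

(** The L2 comparison rests on disjointness: [N0] parallel translates of a tube have average mass at
    most [1 / N0], so a tube of mass [F >= 2 / N0] satisfies [F <= 2 (F - mean)]. Expanding the
    square gives, for each pair of points, the weighted number of tubes through both, minus the
    number through one point and a translate of the other. Without the subtraction this is of order
    1 / distance; with it, the order is [R0] / distance^2, where [R0] is comparable to the total
    displacement [N0 * r]. Pairs closer than [rho] contribute [rho ^ (t - 1)] by the energy bound,
    the others [R0 / rho ^ 2]; so [rho] is chosen first and [R0] after it.

    The order of quantifiers matters at the end: the ratio [r] depends only on the Frostman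
    constants, the geometry and the exponent to be gained, and is fixed before the number [K] of
    scales. Thus [nu] has to be Frostman only down to [r], while [mu] is needed down to [r ^ K.+1],
    and [K] may depend on the threshold below which the box counts are controlled. *)

Section Layer.
Variable R : realType.

Lemma ler_sum_subset (I : finType) (P Q : pred I) (F : I -> R) :
  (forall i, Q i -> ~~ P i -> 0 <= F i) -> (forall i, P i -> Q i) ->
  \sum_(i | P i) F i <= \sum_(i | Q i) F i.
Proof.
move=> F0 PQ; rewrite [leRHS](bigID P) /=.
rewrite (eq_bigl P); last by move=> i; case: (boolP (P i)) => [/PQ ->|]; rewrite ?andbF.
by rewrite lerDl; apply: sumr_ge0 => i /andP[]; apply: F0.
Qed.

(** Sum of the geometric series of terms [2 * 2 ^ (- k (s - 1))], one for each dyadic layer of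
    distances. *)
Definition layer_const (s : R) : R := 2 / (1 - 2 `^ (1 - s)).

Lemma powR2_lt1 (s : R) : 1 < s -> 2 `^ (1 - s) < 1 :> R.
Proof.
move=> s1; have -> : 1 - s = - (s - 1) by ring.
rewrite powRN invf_lt1 ?powR_gt0//.
have e1 : 1 `^ (s - 1) = 1 :> R by rewrite powR1.
by rewrite -[ltLHS]e1 (@gt0_ltr_powR R (s - 1)) ?nnegrE; lra.
Qed.

Lemma layer_const_gt0 (s : R) : 1 < s -> 0 < layer_const s.
Proof. by move=> s1; rewrite divr_gt0// subr_gt0 powR2_lt1. Qed.

(** Dyadic layers: where the truncated distance exceeds [rho / 2] the integrand is at most [2 / rho]
    times the mass, and the other points fall under the same bound with [rho / 2]. The induction
    counts the halvings that lead from [rho] down to [r]. *)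
Lemma sum_over_max_le (I : finType) (mu d : I -> R) (r s C rho : R) :
  0 < r -> 1 < s -> 0 <= C -> (forall i, 0 <= mu i) ->
  (forall rho', r <= rho' <= rho ->
    \sum_(i | d i <= rho') mu i <= C * rho' `^ s) ->
  r <= rho ->
  \sum_(i | d i <= rho) mu i / Num.max (d i) r
    <= C * layer_const s * rho `^ (s - 1).
Proof.
move=> r0 s1 C0 mu0 Hmu rrho.
have [n] : exists n, rho <= 2 ^+ n * r.
  exists (Num.truncn (rho / r)).+1.
  have := truncnS_gt (rho / r).
  rewrite ltr_pdivrMr// => /ltW/le_trans; apply.
  by rewrite ler_pM2r// -natrX ler_nat ltnW// ltn_expl.
have L0 := layer_const_gt0 s1.
have q1 := powR2_lt1 s1.
have L2 : 2 <= layer_const s.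
  rewrite /layer_const ler_pdivlMr; last by rewrite subr_gt0.
  rewrite mulrBr mulr1 gerBl mulr_ge0// powR_ge0//.
have max0 i : 0 < Num.max (d i) r by rewrite lt_max r0 orbT.
have base x : r <= x -> x <= rho -> \sum_(i | (d i <= x) && (x / 2 < Num.max (d i) r)) mu i / Num.max (d i) r <= 2 * C * x `^ (s - 1).
  move=> rx xr; have x0 : 0 < x by apply: lt_le_trans rx.
  apply: (@le_trans _ _ (\sum_(i | d i <= x) mu i * (2 / x))).
    rewrite -[leRHS]mulr1; apply: (@le_trans _ _ (\sum_(i | (d i <= x) && (x / 2 < Num.max (d i) r)) mu i * (2 / x))).
      apply: ler_sum => i /andP[_ xd]; rewrite ler_wpM2l//.
      rewrite -[2 / x]invrK lef_pV2 ?posrE// ?invr_gt0 ?divr_gt0//.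
      by rewrite invf_div ltW.
    rewrite mulr1; apply: ler_sum_subset => [i _ _|i /andP[]//].
    by rewrite mulr_ge0// divr_ge0// ltW.
  rewrite -mulr_suml.

  have := Hmu x; rewrite rx xr => /(_ isT).
  rewrite -(@mulr_powRB1 _ x s) ?(ltW x0)//; last lra.
  move=> H; rewrite mulrA ler_pdivrMr//.
  nra.
elim: n rho rrho Hmu base => [|n IH] rho rrho Hmu base rn.
  rewrite expr0 mul1r in rn.
  apply: (@le_trans _ _ (2 * C * rho `^ (s - 1))); last first.
    by rewrite ler_wpM2r ?powR_ge0// mulrC ler_wpM2l.
  apply: le_trans (base rho rrho (lexx _)); apply: ler_sum_subset.
    by move=> i _ _; rewrite divr_ge0// ltW.
  move=> i ->/=; apply: lt_le_trans (_ : r <= _); last by rewrite le_max lexx orbT.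
  lra.
have [rho2|rho2] := leP r (rho / 2); last first.
  apply: (@le_trans _ _ (2 * C * rho `^ (s - 1))); last first.
    by rewrite ler_wpM2r ?powR_ge0// mulrC ler_wpM2l.
  apply: le_trans (base rho rrho (lexx _)); apply: ler_sum_subset.
    by move=> i _ _; rewrite divr_ge0// ltW.
  by move=> i ->/=; apply: lt_le_trans rho2 _; rewrite le_max lexx orbT.
have rho0 : 0 < rho by apply: lt_le_trans rrho.
have := IH (rho / 2) rho2.
have h1 x : r <= x <= rho / 2 -> \sum_(i | d i <= x) mu i <= C * x `^ s.
  by move=> /andP[rx xr]; apply: Hmu; rewrite rx; lra.
have h2 x : r <= x -> x <= rho / 2 ->
    \sum_(i | (d i <= x) && (x / 2 < Num.max (d i) r)) mu i / Num.max (d i) r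
      <= 2 * C * x `^ (s - 1).
  by move=> rx xr; apply: base => //; lra.
move=> /(_ h1 h2 _)-H.
have {}/H : rho / 2 <= 2 ^+ n * r by rewrite exprS in rn; lra.
rewrite powRM ?(ltW rho0) ?invr_ge0//.
have -> : 2^-1 `^ (s - 1) = 2 `^ (1 - s) :> R.
  have -> : 1 - s = - (s - 1) by ring.
  by rewrite -powR_inv1// -powRrM mulN1r.
move=> H; rewrite (bigID (fun i => rho / 2 < Num.max (d i) r)) /=.
apply: (@le_trans _ _ (2 * C * rho `^ (s - 1) + C * layer_const s * (rho `^ (s - 1) * 2 `^ (1 - s)))).
  apply: lerD; first exact: base.
  apply: le_trans H; apply: ler_sum_subset => [i _ _|i]; first by rewrite divr_ge0// ltW.
  by case/andP => _; rewrite -leNgt ge_max => /andP[].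
(* [layer_const s] is the solution of [L = 2 + L * 2 ^ (1 - s)]. *)
have -> : 2 * C * rho `^ (s - 1) = C * layer_const s * (rho `^ (s - 1) * (1 - 2 `^ (1 - s))).
  rewrite /layer_const; field; lra.
by rewrite -mulrDr -mulrDr subrK mulr1.
Qed.

End Layer.

(** * Sums over lattice lines *)

Section Lattice.
Variable R : realType.
Implicit Types (M N W q : nat) (a b c d k u v T : int).

Definition win M (f : int -> R) : R :=
  \sum_(j < (M + M).+1) f (j%:Z - M%:Z).

(** Truncated subtraction gives the positive part; this is the autocorrelation of [slab]
    ([win_slab2]). *)
Definition tent W u : R := (W - `|u|)%N%:R.

Definition slab W u : R := ((0 <= u) && (u < W%:Z))%:R.

(** Weight of the slope [a / q]: Lipschitz with constant 1 in [a], and at least [q] for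
    [|a| <= 3 * q], the range reached by the tubes of [rich_capture]. *)
Definition hat q a : R := (6 * q - `|a|)%N%:R.

Lemma eq_win M (f g : int -> R) :
  (forall k, (`|k| <= M)%N -> f k = g k) -> win M f = win M g.
Proof. by move=> fg; apply: eq_bigr => j _; apply: fg; have := ltn_ord j; lia. Qed.

Lemma le_win M (f g : int -> R) :
  (forall k, (`|k| <= M)%N -> f k <= g k) -> win M f <= win M g.
Proof. by move=> fg; apply: ler_sum => j _; apply: fg; have := ltn_ord j; lia. Qed.

Lemma win_ge0 M (f : int -> R) : (forall k, 0 <= f k) -> 0 <= win M f.
Proof. by move=> f0; apply: sumr_ge0 => j _. Qed.

Lemma winD M (f g : int -> R) : win M (fun k => f k + g k) = win M f + win M g.
Proof. exact: big_split. Qed.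

Lemma winZ M x (f : int -> R) : win M (fun k => x * f k) = x * win M f.
Proof. by rewrite /win mulr_sumr. Qed.

Lemma win_sum M (I : Type) (s : seq I) (P : pred I) (f : I -> int -> R) :
  win M (fun k => \sum_(i <- s | P i) f i k) = \sum_(i <- s | P i) win M (f i).
Proof. exact: exchange_big. Qed.

Lemma win_step M (f : int -> R) :
  win M (fun k => f (k + 1)) = win M f + f (M%:Z + 1) - f (- M%:Z).
Proof.
rewrite /win (big_ord_recr (M + M)) /= [X in _ = X + _ - _]big_ord_recl /=.
rewrite (eq_bigr (fun i : 'I_(M + M) => f ((bump 0 i)%:Z - M%:Z))); last first.
  by move=> i _; congr f; rewrite /bump /=; lia.
have -> : (M + M)%:Z - M%:Z + 1 = M%:Z + 1 by lia.
have -> : 0%:Z - M%:Z = - M%:Z by lia.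
ring.
Qed.

(** A unit shift only exchanges two end terms of the window, and these vanish while the support
    stays inside. *)
Lemma win_shift M0 M d (f : int -> R) :
  (forall k, (M0 < `|k|)%N -> f k = 0) -> (M0 + `|d| <= M)%N ->
  win M (fun k => f (k + d)) = win M f.
Proof.
move=> f0; case: d => n.
  elim: n => [|n IH] nM; first by apply: eq_win => k _; congr f; lia.
  rewrite -IH; last by lia.
  have -> : win M (fun k => f (k + n.+1%:Z)) = win M (fun k => f (k + 1 + n%:Z)).
    by apply: eq_win => k _; congr f; lia.
  rewrite (win_step M (fun k => f (k + n%:Z))).
  by rewrite !f0 ?subr0 ?addr0//; lia.
elim: n => [|n IH] nM.
  rewrite (_ : win M f = win M (fun k => f (k + 1 + Negz 0))); last first.
    by apply: eq_win => k _; congr f; lia.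
  rewrite (win_step M (fun k => f (k + Negz 0))).
  by rewrite [f (_ + 1 + _)]f0 ?[f (- _ + _)]f0 ?subr0 ?addr0//; lia.
rewrite -IH; last by lia.
have -> : win M (fun k => f (k + Negz n)) = win M (fun k => f (k + 1 + Negz n.+1)).
  by apply: eq_win => k _; congr f; lia.
rewrite (win_step M (fun k => f (k + Negz n.+1))).
by rewrite [f (_ + 1 + _)]f0 ?[f (- _ + _)]f0 ?subr0 ?addr0//; lia.
Qed.

Lemma sum_interval (J lo hi : nat) : (hi <= J)%N ->
  \sum_(j < J) ((lo <= j) && (j < hi))%N%:R = (hi - lo)%N%:R :> R.
Proof.
move=> hJ; rewrite -natr_sum; congr _%:R.
rewrite -(big_mkord xpredT (fun j => ((lo <= j) && (j < hi))%N : nat)).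
elim: J hi hJ => [|J IH] hi hJ; first by rewrite big_geq//; lia.
rewrite big_nat_recr//=.
have [hi'|hi'] := leqP hi J; first by rewrite IH//; lia.
have -> : hi = J.+1 by lia.
rewrite (_ : \sum_(0 <= i < J) _ = \sum_(0 <= i < J) ((lo <= i) && (i < J)))%N.
  by rewrite IH//; lia.
by rewrite big_nat_cond [RHS]big_nat_cond; apply: eq_bigr => i; lia.
Qed.

Lemma win_slab2 N W u v : (`|u| + W <= N)%N -> (`|v| + W <= N)%N ->
  win N (fun b => slab W (u - b) * slab W (v - b)) = tent W (u - v).
Proof.
move=> uN vN; rewrite /win /tent.
pose lo := maxn (absz (u + N%:Z)) (absz (v + N%:Z)).
pose hi := minn (absz (u + N%:Z)) (absz (v + N%:Z)).
rewrite (eq_bigr (fun j : 'I_(N + N).+1 =>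
    (((lo.+1 - W)%N <= j) && (j < hi.+1))%N%:R)); last first.
  move=> j _; rewrite /slab -natrM mulnb; congr (nat_of_bool _)%:R.
  have := ltn_ord j; rewrite /lo /hi; lia.
by rewrite sum_interval /lo /hi; [congr _%:R|]; lia.
Qed.

Lemma win_bilinear N W (I J : finType) (w : I -> R) (w' : J -> R)
    (u : I -> int) (v : J -> int) :
  (forall i, `|u i| + W <= N)%N -> (forall j, `|v j| + W <= N)%N ->
  win N (fun b => (\sum_i w i * slab W (u i - b)) * (\sum_j w' j * slab W (v j - b)))
  = \sum_i \sum_j w i * w' j * tent W (u i - v j).
Proof.
move=> uN vN.
under eq_win => b _ do rewrite big_distrlr /=.
rewrite win_sum; apply: eq_bigr => i _; rewrite win_sum; apply: eq_bigr => j _.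
rewrite -(@win_slab2 N)// -winZ; apply: eq_win => b _; ring.
Qed.

Lemma win_count_le M L (p : pred int) :
  (forall a b, p a -> p b -> `|a - b| <= L)%N ->
  win M (fun a => (p a)%:R) <= L.+1%:R.
Proof.
move=> pL; rewrite /win.
have [/existsP[j0 pj0]|/existsPn p0] :=
    boolP [exists j : 'I_(M + M).+1, p (j%:Z - M%:Z)]; last first.
  by rewrite big1 ?ler0n// => j _; rewrite (negbTE (p0 j)).
case: (@arg_minnP _ j0 (fun j : 'I_(M + M).+1 => p (j%:Z - M%:Z)) (@nat_of_ord _) pj0) => j1 pj1 min1.
apply: (@le_trans _ _ (\sum_(j < (M + M).+1) ((j1 <= j) && (j < minn (j1 + L).+1 (M + M).+1))%N%:R)).
  apply: ler_sum => j _; rewrite ler_nat.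
  case: (boolP (p _)) => // pj.
  have := min1 j pj; have := pL _ _ pj1 pj; have := ltn_ord j.
  move=> jM jL j1j; rewrite lt0b; apply/andP; split => //; lia.
by rewrite sum_interval ?geq_minr// ler_nat; lia.
Qed.

(** Weighted number of lattice tubes containing two given points with horizontal difference [d] and
    vertical difference [c]; [tent] counts the intercepts for each slope. *)
Definition kern M W q c d : R := win M (fun a => hat q a * tent W (c - a * d)).

Lemma hat_ge0 q a : 0 <= hat q a. Proof. exact: ler0n. Qed.

Lemma kern_ge0 M W q c d : 0 <= kern M W q c d.
Proof. by apply: win_ge0 => k; rewrite mulr_ge0// ler0n. Qed.

Lemma kern_le M W q c d : kern M W q c d <= (6 * q * W * (12 * q).+1)%:R.
Proof.
rewrite natrM; apply: (@le_trans _ _ (win M (fun a => (6 * q * W)%:R * (`|a| < 6 * q)%N%:R))).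
  apply: le_win => a _; rewrite /hat /tent -!natrM ler_nat.
  case: ltnP => aq; last by nia.
  by rewrite muln1 leq_mul//; lia.
rewrite winZ ler_wpM2l// win_count_le// => a b; lia.
Qed.

Lemma win_slope_count_le M W c d : d != 0 ->
  win M (fun a => (absz (c - a * d)%R < W)%N%:R) <= (2 * W)%:R / `|d|%:R + 1.
Proof.
move=> d0; apply: (@le_trans _ _ ((2 * W) %/ `|d|).+1%:R).
  apply: (@win_count_le M _ (fun a => (absz (c - a * d)%R < W)%N)) => a b pa pb.
  rewrite leq_divRL; last by lia.
  by rewrite -abszM; lia.
rewrite -natr1 lerD2r ler_pdivlMr ?ltr0n; last by lia.
by rewrite -natrM ler_nat leq_trunc_div.
Qed.

Lemma kern_le_slope M W q c d : d != 0 ->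
  kern M W q c d <= (6 * q * W)%:R * ((2 * W)%:R / `|d|%:R + 1).
Proof.
move=> d0; apply: (@le_trans _ _ (win M (fun a => (6 * q * W)%:R * (absz (c - a * d)%R < W)%N%:R))).
  apply: le_win => a _; rewrite /hat /tent -!natrM ler_nat.
  by case: ltnP => aq; nia.
by rewrite winZ ler_wpM2l// win_slope_count_le.
Qed.

(** Two points in so steep a position share no tube whose slope has positive weight. *)
Lemma kern_eq0 M W q c d : (6 * q * `|d| + W <= `|c|)%N -> kern M W q c d = 0.
Proof.
move=> cd; rewrite /kern /win big1// => j _; apply/eqP.
rewrite /hat /tent -natrM pnatr_eq0.
set a := _ - _; case: (leqP (6 * q) `|a|) => aq; first by lia.
have : (absz (a * d)%R <= 6 * q * `|d|)%N by rewrite abszM leq_mul//; lia.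
by move=> ad; rewrite (_ : (W - _)%N = 0%N) ?muln0//; lia.
Qed.

(** A vertical displacement by [d * e] can be traded for the shift of the slope by [e]. The weight
    [hat] then changes by at most [|e|], and only the slopes with nonzero [tent] count. *)
Lemma kern_shift_le M W q c d e : d != 0 -> (6 * q + `|e| <= M)%N ->
  kern M W q c d - kern M W q (c + d * e) d
    <= (`|e| * W)%:R * ((2 * W)%:R / `|d|%:R + 1).
Proof.
move=> d0 eM.
have -> : kern M W q (c + d * e) d = win M (fun a => hat q (a + e) * tent W (c - a * d)).
  rewrite /kern -(@win_shift (6 * q) M e) //.
    by apply: eq_win => k _; congr (_ * tent W _); ring.
  by move=> k kq; rewrite /hat (_ : (6 * q - `|k|)%N = 0%N) ?mul0r//; lia.
rewrite -[X in _ - X]mul1r -mulNr -winZ -winD.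
apply: (@le_trans _ _ (win M (fun a => (`|e| * W)%:R * (absz (c - a * d)%R < W)%N%:R))).
  apply: le_win => a _; rewrite mulN1r -mulrBl.
  have he : hat q a - hat q (a + e) <= `|e|%:R.
    by rewrite lerBlDr -natrD ler_nat; lia.
  rewrite /tent natrM -mulrA.
  apply: (@le_trans _ _ (`|e|%:R * (W - absz (c - a * d)%R)%N%:R)); first by rewrite ler_wpM2r.
  by rewrite ler_wpM2l// -natrM ler_nat; case: ltnP; lia.
by rewrite winZ ler_wpM2l// win_slope_count_le.
Qed.

End Lattice.

(** * L2 comparison of tubes with their parallel translates *)

Section LatticeVariance.
Variable R : realType.
Implicit Types (M N W q : nat) (a b c d k u v T : int).

Definition line_mass (I : finType) W (w : I -> R) (n m : I -> int) a b : R :=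
  \sum_i w i * slab R W (m i - a * n i - b).

Definition line_sum M N q (f : int -> int -> R) : R :=
  win M (fun a => hat R q a * win N (f a)).

Lemma le_line_sum M N q (f g : int -> int -> R) :
  (forall a b, (`|a| <= M)%N -> f a b <= g a b) -> line_sum M N q f <= line_sum M N q g.
Proof.
move=> fg; apply: le_win => a aM; rewrite ler_wpM2l ?hat_ge0//.
by apply: le_win => b _; exact: fg.
Qed.

Lemma line_sumD M N q (f g : int -> int -> R) :
  line_sum M N q (fun a b => f a b + g a b) = line_sum M N q f + line_sum M N q g.
Proof. by rewrite -winD; apply: eq_win => a _; rewrite winD mulrDr. Qed.

Lemma line_sumZ M N q x (f : int -> int -> R) :
  line_sum M N q (fun a b => x * f a b) = x * line_sum M N q f.
Proof. by rewrite -winZ; apply: eq_win => a _; rewrite winZ mulrCA. Qed.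

Lemma line_sum_sum M N q (I : Type) (s : seq I) (P : pred I) (f : I -> int -> int -> R) :
  line_sum M N q (fun a b => \sum_(i <- s | P i) f i a b)
  = \sum_(i <- s | P i) line_sum M N q (f i).
Proof.
by rewrite -win_sum; apply: eq_win => a _; rewrite win_sum mulr_sumr.
Qed.

(** Second-moment expansion: for a fixed slope, summing a product of two slabs over the intercepts
    gives a tent, so each pair of points contributes one kernel. The bound on [N] keeps every tube
    that meets a point inside the window. *)
Lemma line_sum_mul M N W q (I : finType) (w : I -> R) (n m : I -> int) (S T : nat) :
  (forall i a, (`|a| <= M)%N -> (absz (m i - a * n i)%R + S + T + W <= N)%N) ->
  line_sum M N q (fun a b => line_mass W w n m a (b + S%:Z) * line_mass W w n m a (b + T%:Z))
  = \sum_i \sum_j w i * w j * kern R M W q (m i - m j + (T%:Z - S%:Z)) (n i - n j).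
Proof.
move=> bound; rewrite /line_sum.
rewrite (@eq_win _ _ _ (fun a => \sum_i \sum_j
   w i * w j * (hat R q a * tent R W (m i - m j + (T%:Z - S%:Z) - a * (n i - n j))))).
  rewrite win_sum; apply: eq_bigr => i _; rewrite win_sum; apply: eq_bigr => j _.
  by rewrite winZ.
move=> a aM; rewrite (@eq_win _ _ _ (fun b =>
   (\sum_i w i * slab R W ((m i - a * n i - S%:Z) - b)) *
   (\sum_j w j * slab R W ((m j - a * n j - T%:Z) - b)))); last first.
  by move=> b _; congr (_ * _); apply: eq_bigr => i _; congr (_ * slab _ _ _); ring.
rewrite win_bilinear; last first.
- by move=> i; have := bound i a aM; lia.
- by move=> i; have := bound i a aM; lia.
rewrite mulr_sumr; apply: eq_bigr => i _; rewrite mulr_sumr; apply: eq_bigr => j _.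
rewrite mulrCA; congr (_ * (_ * tent _ _ _)); ring.
Qed.

Lemma sum_slab_le1 W N0 u : \sum_(i < N0) slab R W (u - (i * W)%N%:Z) <= 1.
Proof.
rewrite /slab -natr_sum -[1]/(1%:R) ler_nat -big_mkcond /=.
rewrite sum1_card; apply/card_le1_eqP => i j; rewrite !unfold_in => /andP[ui ui'] /andP[uj uj'].
apply/val_inj/eqP => /=; rewrite eqn_leq; nia.
Qed.

Definition mean_mass N0 (I : finType) W (w : I -> R) (n m : I -> int) a b : R :=
  N0%:R^-1 * \sum_(i < N0) line_mass W w n m a (b + (i * W)%N%:Z).

(** Translates by multiples of the width [W] are disjoint: a point lies in at most one of them. *)
Lemma mean_mass_le N0 (I : finType) W (w : I -> R) (n m : I -> int) a b :
  (forall i, 0 <= w i) -> \sum_i w i <= 1 ->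
  mean_mass N0 W w n m a b <= N0%:R^-1.
Proof.
move=> w0 w1; rewrite /mean_mass -[leRHS]mulr1 ler_wpM2l ?invr_ge0//.
rewrite exchange_big /=; apply: le_trans w1; apply: ler_sum => i _.
rewrite -mulr_sumr -[leRHS]mulr1 ler_wpM2l//.
rewrite (eq_bigr (fun j : 'I_N0 => slab R W (m i - a * n i - b - (j * W)%N%:Z))).
  exact: sum_slab_le1.
by move=> j _; congr (slab _ _ _); ring.
Qed.

Lemma sqr_mean_le N0 (x : R) (f : 'I_N0 -> R) : (0 < N0)%N ->
  (x - N0%:R^-1 * \sum_i f i) ^+ 2 <= N0%:R^-1 * \sum_i (x - f i) ^+ 2.
Proof.
move=> N00; have n0 : 0 < N0%:R :> R by rewrite ltr0n.
set y := N0%:R^-1 * _.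
have e : \sum_i f i = N0%:R * y by rewrite /y mulVKf// gt_eqF.
rewrite ler_pdivlMl//.
have : 0 <= \sum_i (f i - y) ^+ 2 by apply: sumr_ge0 => i _; rewrite sqr_ge0.
have -> : \sum_i (x - f i) ^+ 2 = \sum_i (f i - y) ^+ 2 +
    (N0%:R * ((x - y) ^+ 2 + 2 * (x - y) * y) + - 2 * (x - y) * \sum_i f i).
  have -> (c : R) : N0%:R * c = \sum_(i < N0) c by rewrite sumr_const card_ord mulr_natl.
  by rewrite mulr_sumr -!big_split; apply: eq_bigr => i _ /=; ring.
rewrite e => H; rewrite -subr_ge0; apply: le_trans H _.
by rewrite le_eqVlt; apply/orP; left; apply/eqP; ring.
Qed.

(* Where [F >= 2 / N0] the average over [N0] disjoint shifts is at most [F / 2]. *)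
Lemma line_sum_rich_le M N W q N0 (I J : finType) (w : I -> R) (w' : J -> R)
    (n m : I -> int) (n' m' : J -> int) (G : I -> I -> R) (G' : J -> J -> R) (th : R) :
  (0 < N0)%N -> 0 < th ->
  (forall i, 0 <= w i) -> \sum_i w i <= 1 -> (forall j, 0 <= w' j) ->
  (forall i a, (`|a| <= M)%N -> (absz (m i - a * n i)%R + 2 * (N0 * W) + W <= N)%N) ->
  (forall i a, (`|a| <= M)%N -> (absz (m' i - a * n' i)%R + W <= N)%N) ->
  (forall i j (k : nat), (k < N0)%N ->
    kern R M W q (m i - m j) (n i - n j)
      - kern R M W q (m i - m j + (k * W)%N%:Z) (n i - n j) <= G i j) ->
  (forall i j, kern R M W q (m' i - m' j) (n' i - n' j) <= G' i j) ->
  line_sum M N q (fun a b =>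
    (2 / N0%:R <= line_mass W w n m a b)%R%:R *
    (line_mass W w n m a b * line_mass W w' n' m' a b))
  <= 2 / th * \sum_i \sum_j w i * w j * G i j + th * \sum_i \sum_j w' i * w' j * G' i j.
Proof.
move=> N00 th0 w0 w1 w'0 bX bY HG HG'.
set F := line_mass W w n m; set F' := line_mass W w' n' m'.
have n0 : 0 < N0%:R :> R by rewrite ltr0n.
have F0 a b : 0 <= F a b.
  by apply: sumr_ge0 => i _; rewrite mulr_ge0//; case: (_ && _).
have F'0 a b : 0 <= F' a b.
  by apply: sumr_ge0 => i _; rewrite mulr_ge0//; case: (_ && _).
apply: (@le_trans _ _ (line_sum M N q (fun a b =>
    th^-1 * (N0%:R^-1 * \sum_(k < N0) (F a b - F a (b + (k * W)%N%:Z)) ^+ 2) + th * (F' a b * F' a b)))).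
  apply: le_line_sum => a b _.
  apply: (@le_trans _ _ (th^-1 * (F a b - mean_mass N0 W w n m a b) ^+ 2 + th * (F' a b * F' a b))); last first.
    by rewrite lerD2r ler_wpM2l ?invr_ge0 ?(ltW th0)// sqr_mean_le.
  (* On a rich tube [F <= 2 (F - y)], and [2 u v <= u ^ 2 / th + th * v ^ 2] splits the product. *)
  have mean := @mean_mass_le N0 _ W w n m a b w0 w1.
  case: (leP (2 / N0%:R) (F a b)) => /= Hr; last first.
    rewrite mulr0n mul0r addr_ge0//.
      by apply: mulr_ge0; rewrite ?sqr_ge0// invr_ge0 ltW.
    by apply: mulr_ge0; rewrite ?mulr_ge0// ltW.
  rewrite mulr1n mul1r; set y := mean_mass _ _ _ _ _ _ _ in mean *.
  have Fy : F a b <= 2 * (F a b - y) by lra.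
  apply: (@le_trans _ _ (2 * (F a b - y) * F' a b)); first by rewrite ler_wpM2r.
  rewrite -(ler_pM2l th0) [leRHS]mulrDr mulVKf ?gt_eqF//.
  have := sqr_ge0 ((F a b - y) - th * F' a b).
  nra.
rewrite line_sumD !line_sumZ; apply: lerD; last first.
  rewrite ler_wpM2l ?(ltW th0)//.
  rewrite (_ : line_sum _ _ _ _ = line_sum M N q (fun a b => F' a (b + 0%N%:Z) * F' a (b + 0%N%:Z))); last first.
    by apply: eq_win => a _; congr (_ * _); apply: eq_win => b _; rewrite !addr0.
  rewrite line_sum_mul; last by move=> i a aM; have := bY i a aM; lia.
  apply: ler_sum => i _; apply: ler_sum => j _; rewrite ler_wpM2l ?mulr_ge0//.
  by rewrite subrr addr0 HG'.
rewrite [2 / th]mulrC -mulrA ler_wpM2l ?invr_ge0 ?(ltW th0)// line_sum_sum.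
rewrite ler_pdivrMl// -[leRHS]mulrC -mulrA.
(* Both squares expand into the same unshifted kernel and the cross term into the shifted one, so
   only the difference bounded by [HG] remains. *)
have key (k : 'I_N0) : line_sum M N q (fun a b => (F a b - F a (b + (k * W)%N%:Z)) ^+ 2)
    <= 2 * \sum_i \sum_j w i * w j * G i j.
  have kN := ltn_ord k.
  have kW : (k * W <= N0 * W)%N by rewrite leq_mul2r ltnW ?orbT.
  rewrite (_ : line_sum _ _ _ _ =
    line_sum M N q (fun a b => F a (b + 0%N%:Z) * F a (b + 0%N%:Z)) +
    (line_sum M N q (fun a b => F a (b + (k * W)%N%:Z) * F a (b + (k * W)%N%:Z)) +
    -2 * line_sum M N q (fun a b => F a (b + 0%N%:Z) * F a (b + (k * W)%N%:Z)))); last first.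
    rewrite -line_sumZ -!line_sumD.
    apply: eq_win => a _; congr (_ * _); apply: eq_win => b _.
    by rewrite /= !addr0; ring.
  rewrite !line_sum_mul; first last.
  - by move=> i a aM; have := bX i a aM; lia.
  - by move=> i a aM; have := bX i a aM; lia.
  - by move=> i a aM; have := bX i a aM; lia.
  rewrite !mulr_sumr -!big_split /=; apply: ler_sum => i _.
  rewrite !mulr_sumr -!big_split /=; apply: ler_sum => j _.
  rewrite !subrr subr0 !addr0.
  have := HG i j k kN; have := mulr_ge0 (w0 i) (w0 j).
  nra.
apply: (@le_trans _ _ (\sum_(k < N0) 2 * \sum_i \sum_j w i * w j * G i j)).
  by apply: ler_sum => k _; exact: key.
by rewrite sumr_const card_ord -[_ *+ N0]mulr_natr -mulrA.
Qed.

Lemma win_ge M L z (f : int -> R) (x : R) :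
  (forall k, 0 <= f k) -> (`|z| + L <= M)%N ->
  (forall j, (j < L)%N -> x <= f (z + j%:Z)) -> L%:R * x <= win M f.
Proof.
move=> f0 zM fx; rewrite /win.
pose lo := absz (z + M%:Z).
apply: (@le_trans _ _ (\sum_(j < (M + M).+1) ((lo <= j) && (j < lo + L))%N%:R * x)).
  by rewrite -mulr_suml sum_interval; [rewrite addKn | rewrite /lo; lia].
apply: ler_sum => j _; case: (boolP (_ && _)) => [/andP[lj jl]|_]; last by rewrite mul0r.
rewrite mul1r; have := fx (j - lo)%N; rewrite (_ : z + _ = j%:Z - M%:Z); last by rewrite /lo in lj *; lia.
apply; lia.
Qed.

End LatticeVariance.

(** * Decay of the pair kernels with the distance *)

Section KernelBounds.
Variable R : realType.
Implicit Types (M N D q : nat) (c d : int).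

(** Up to the tube width [14 * D], the allowed slopes bound the vertical separation by 6 times the
    horizontal one. Once [Z >= 30 * D], this width is less than half of [Z], and the horizontal
    separation must be comparable to [Z]. *)
Lemma slope_of_far D q c d (Z : R) : (0 < D)%N -> (0 < q)%N ->
  (Z <= `|d|%:R + 1 \/ q%:R * Z <= `|c|%:R + 1) ->
  (`|c| < 6 * q * `|d| + 14 * D * q)%N -> (30 * D)%:R <= Z ->
  Z <= 12 * `|d|%:R.
Proof.
move=> D0 q0 HZ cd Z30.
have D1 : 1 <= D%:R :> R by rewrite ler1n.
have q1 : 1 <= q%:R :> R by rewrite ler1n.
have d0 : 0 <= `|d|%:R :> R by [].
rewrite natrM in Z30.
case: HZ => HZ; first by lra.
have : (`|c|.+1)%:R <= (6 * q * `|d| + 14 * D * q)%:R :> R by rewrite ler_nat.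
rewrite -natr1 natrD !natrM => H.
have : q%:R * Z <= q%:R * (6 * `|d|%:R + 14 * D%:R) by lra.
rewrite ler_pM2l; last lra.
lra.
Qed.

(** Equal to [12 * (6 * 14) * (3 * 14)]: the 12 of [slope_of_far], the weight times the width, and
    the number of slopes in [kern_le_slope]. *)
Definition near_const D : R := 12 * 72 * 49 * D%:R ^+ 2.

(** Equal to [12 ^ 2 * 14 * 14 * (3 * 14)]: the 12 of [slope_of_far] squared, the shift of the
    slope, the width, and the number of slopes. *)
Definition far_const D : R := 144 * 168 * 49 * D%:R ^+ 3.

Lemma near_const_gt0 D : (0 < D)%N -> 0 < near_const D.
Proof. by move=> D0; rewrite pmulr_lgt0 ?exprn_gt0 ?ltr0n// !pmulr_rgt0 ?ltr0n. Qed.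

Lemma far_const_gt0 D : (0 < D)%N -> 0 < far_const D.
Proof. by move=> D0; rewrite pmulr_lgt0 ?exprn_gt0 ?ltr0n// !pmulr_rgt0 ?ltr0n. Qed.

(** For [Z < 30 * D] the crude count [kern_le] suffices; beyond, either the pair is too steep and
    the kernel vanishes, or [|d|] is comparable to [Z]. *)
Lemma kern_energy_le M D q c d (Z : R) : (0 < D)%N -> (0 < q)%N -> (`|d| <= q)%N ->
  (Z <= `|d|%:R + 1 \/ q%:R * Z <= `|c|%:R + 1) ->
  kern R M (14 * D * q) q c d <= near_const D * q%:R ^+ 3 / Num.max Z 1.
Proof.
move=> D0 q0 dq HZ.
have D1 : 1 <= D%:R :> R by rewrite ler1n.
have q1 : 1 <= q%:R :> R by rewrite ler1n.
have m1 : 1 <= Num.max Z 1 by rewrite le_max lexx orbT.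
rewrite ler_pdivlMr; last lra.
have [Z30|Z30] := leP (30 * D)%:R Z; last first.
  have mD : Num.max Z 1 <= (30 * D)%:R by rewrite ge_max (ltW Z30) /= natrM; lra.
  apply: le_trans (ler_pM _ _ (kern_le R M _ _ _ _) mD) _ => //.
  - exact: kern_ge0.
  - lra.
  apply: (@le_trans _ _ (6 * q%:R * (14 * D%:R * q%:R) * (13 * q%:R) * (30 * D%:R))).
    rewrite -!natrM ler_nat !leq_mul//; lia.
  rewrite (_ : _ * (30 * D%:R) = 6 * 14 * 13 * 30 * D%:R ^+ 2 * q%:R ^+ 3); last by ring.
  by rewrite /near_const; apply: ler_wpM2r; [exact: exprn_ge0|apply: ler_wpM2r; [exact: exprn_ge0|lra]].
have [cd|cd] := leqP (6 * q * `|d| + 14 * D * q) `|c|.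
  by rewrite kern_eq0// mul0r; apply: mulr_ge0; [exact/ltW/near_const_gt0|exact: exprn_ge0].
have Zd := slope_of_far D0 q0 HZ cd Z30.
have d0 : d != 0.
  by apply/eqP => d0; rewrite d0 /= natrM in Zd Z30; lra.
have d1 : 1 <= `|d|%:R :> R by rewrite ler1n absz_gt0.
have dq' : `|d|%:R <= q%:R :> R by rewrite ler_nat.
have maxZ : Num.max Z 1 <= 12 * `|d|%:R by rewrite ge_max Zd /=; lra.
apply: le_trans (ler_pM _ _ (kern_le_slope R M _ _ _ d0) maxZ) _ => //.
- exact: kern_ge0.
- lra.
have -> : (6 * q * (14 * D * q))%:R * ((2 * (14 * D * q))%:R / `|d|%:R + 1) * (12 * `|d|%:R)
  = 12 * 84 * D%:R * q%:R ^+ 2 * (28 * D%:R * q%:R + `|d|%:R) :> R.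
  by rewrite !natrM; field; lra.
have : 12 * 84 * D%:R * q%:R ^+ 2 * (28 * D%:R * q%:R + `|d|%:R)
   <= 12 * 84 * D%:R * q%:R ^+ 2 * (42 * D%:R * q%:R) :> R.
  rewrite ler_pM2l; first by nra.
  by apply: mulr_gt0; [apply: mulr_gt0; lra|apply: exprn_gt0; lra].
move=> /le_trans; apply; rewrite /near_const.
by rewrite le_eqVlt; apply/orP; left; apply/eqP; ring.
Qed.

Lemma multiple_absz (P : nat) d : exists e : int, (P * `|d|)%N%:Z = d * e /\ `|e|%N = P.
Proof. by exists (if 0 <= d then P%:Z else - P%:Z); case: ifP; split; lia. Qed.

(** Because [|d|] divides [q], a translation by [k] tube widths equals [d * e] for an integer [e] of
    size at most [14 * D * N0 * q / |d|]. The extra factor [1 / |d|] in the slope shift is the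
    gained power of the distance. *)
Lemma kern_far_le M D q N0 k c d (Z Z0 : R) :
  (0 < D)%N -> (0 < q)%N -> (`|d| <= q)%N -> (d != 0 -> (`|d| %| q)%N) ->
  (6 * q + N0 * (14 * D * q) <= M)%N -> (k < N0)%N ->
  (Z <= `|d|%:R + 1 \/ q%:R * Z <= `|c|%:R + 1) -> (30 * D)%:R <= Z0 -> Z0 <= Z ->
  kern R M (14 * D * q) q c d - kern R M (14 * D * q) q (c + (k * (14 * D * q))%N%:Z) d
   <= far_const D * q%:R ^+ 3 * N0%:R / Z0 ^+ 2.
Proof.
move=> D0 q0 dq ddvd HM kN HZ Z030 Z0Z.
have D1 : 1 <= D%:R :> R by rewrite ler1n.
have q1 : 1 <= q%:R :> R by rewrite ler1n.
have Z01 : 1 <= Z0 by rewrite natrM in Z030; lra.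
have [cd|cd] := leqP (6 * q * `|d| + 14 * D * q) `|c|.
  rewrite kern_eq0//; apply: (@le_trans _ _ 0).
    by rewrite sub0r oppr_le0 kern_ge0.
  apply: divr_ge0; last exact: sqr_ge0.
  by apply: mulr_ge0 => //; apply: mulr_ge0; [exact/ltW/far_const_gt0|exact: exprn_ge0].
have Zd := slope_of_far D0 q0 HZ cd (le_trans Z030 Z0Z).
have d0 : d != 0.
  by apply/eqP => d0; rewrite d0 /= natrM in Zd Z030; lra.
have d1 : 1 <= `|d|%:R :> R by rewrite ler1n absz_gt0.
have dq' : `|d|%:R <= q%:R :> R by rewrite ler_nat.
have [p qp] : exists p, q = (p * `|d|)%N by apply/dvdnP; exact: ddvd.
have [e [de ek]] : exists e : int,
    (k * (14 * D * q))%N%:Z = d * e /\ `|e|%N = (k * (14 * D * p))%N.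
  have -> : (k * (14 * D * q))%N = (k * (14 * D * p) * `|d|)%N by rewrite qp !mulnA.
  exact: multiple_absz.
rewrite de.
have pq : (p <= q)%N by rewrite qp leq_pmulr// absz_gt0.
apply: le_trans (@kern_shift_le R M _ q c d e d0 _) _.
  by rewrite ek (leq_trans _ HM)// leq_add2l !leq_mul// ltnW.
rewrite ek.
have pE : p%:R = q%:R / `|d|%:R :> R by rewrite qp natrM mulfK//; lra.
have kN' : k%:R <= N0%:R :> R by rewrite ler_nat ltnW.
set W := (14 * D * q)%N.
have W0 : 0 <= (2 * W)%:R / `|d|%:R + 1 :> R by rewrite addr_ge0// divr_ge0.
have h1 : (k * (14 * D * p) * W)%:R <= (N0 * (14 * D * p) * W)%:R :> R.
  by rewrite ler_nat !leq_mul2r ltnW ?orbT.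
have h2 : (2 * W)%:R / `|d|%:R + 1 <= (2 * W)%:R / `|d|%:R + q%:R / `|d|%:R * (14 * D%:R) :> R.
  rewrite lerD2l -pE; have : 1 <= p%:R :> R.
    by rewrite ler1n lt0n; apply: contraTneq q0 => p0; rewrite qp p0.
  by move=> p1; rewrite mulr_ege1//; lra.
apply: le_trans (ler_pM _ W0 h1 h2) _; first exact: ler0n.
rewrite /W.
rewrite !natrM pE.
have -> : N0%:R * (14 * D%:R * (q%:R / `|d|%:R)) * (14 * D%:R * q%:R) *
  (2 * (14 * D%:R * q%:R) / `|d|%:R + q%:R / `|d|%:R * (14 * D%:R))
  = (168 * 49 * D%:R ^+ 3 * q%:R ^+ 3) * N0%:R / `|d|%:R ^+ 2 :> R.
  by field; lra.
rewrite ler_pdivrMr; last by rewrite exprn_gt0//; lra.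
have -> : far_const D * q%:R ^+ 3 * N0%:R / Z0 ^+ 2 * `|d|%:R ^+ 2
  = (168 * 49 * D%:R ^+ 3 * q%:R ^+ 3 * N0%:R) * ((12 * `|d|%:R / Z0) ^+ 2) :> R.
  by rewrite /far_const; field; lra.
apply: ler_peMr; last by apply: exprn_ege1; rewrite ler_pdivlMr; lra.
by apply: mulr_ge0.
Qed.

End KernelBounds.

(** * Rich pairs *)

Section RichPairs.
Variable R : realType.
Implicit Types (x y p : R * R).

Definition supdist x y : R := Num.max `|x.1 - y.1| `|x.2 - y.2|.

Definition slope x y : R := (x.2 - y.2) / (x.1 - y.1).

(** Growth is required from scale [r] upwards only, since atoms violate it at small scales. *)
Definition frostman (I : finType) (w : I -> R) (p : I -> R * R) (C s r : R) :=
  forall i rho, r <= rho <= 1 -> \sum_(j | supdist (p i) (p j) <= rho) w j <= C * rho `^ s.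

Lemma supdist_ge0 x y : 0 <= supdist x y.
Proof. by rewrite le_max normr_ge0. Qed.

Lemma energy_le (I : finType) (w : I -> R) (p : I -> R * R) (C s r rho : R) :
  0 < r -> 1 < s -> 0 <= C -> (forall i, 0 <= w i) -> \sum_i w i <= 1 ->
  frostman w p C s r -> r <= rho <= 1 ->
  \sum_i \sum_(j | supdist (p i) (p j) <= rho) w i * w j / Num.max (supdist (p i) (p j)) r
   <= C * layer_const s * rho `^ (s - 1).
Proof.
move=> r0 s1 C0 w0 w1 fr /andP[rrho rho1].
set X := leRHS.
have X0 : 0 <= X by rewrite mulr_ge0 ?powR_ge0// mulr_ge0// ltW// layer_const_gt0.
apply: (@le_trans _ _ (\sum_i w i * X)); last by rewrite -mulr_suml ler_piMl.
apply: ler_sum => i _; under eq_bigr do rewrite -mulrA.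
rewrite -mulr_sumr ler_wpM2l// sum_over_max_le// => rho' /andP[rr rr'].
by apply: fr; rewrite rr (le_trans rr').
Qed.

Lemma norm_sub_floor (u v : R) :
  `|u - v| <= `|Num.floor u - Num.floor v|%N%:R + 1.
Proof.
rewrite natr_absz intr_norm rmorphB /=.
have := floor_le u; have := floorD1_gt u; have := floor_le v; have := floorD1_gt v.
rewrite !intrD; move: (Num.floor u)%:~R (Num.floor v)%:~R => fu fv h1 h2 h3 h4.
have : `|fu - fv| <= `|fu - fv| by [].
by rewrite !ler_norml => /andP[h5 h6]; apply/andP; split; lra.
Qed.

Lemma floor_sub_le (u v : R) :
  `|Num.floor u - Num.floor v|%N%:R <= `|u - v| + 1.
Proof.
rewrite natr_absz intr_norm rmorphB /=.
have := floor_le u; have := floorD1_gt u; have := floor_le v; have := floorD1_gt v.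
rewrite !intrD; move: (Num.floor u)%:~R (Num.floor v)%:~R => fu fv h1 h2 h3 h4.
have : `|u - v| <= `|u - v| by [].
by rewrite !ler_norml => /andP[h5 h6]; apply/andP; split; lra.
Qed.

(** Error budget in units of [q]: at most [2 * D] from the distance to the line, [D] from the slope,
    3 from rounding the first coordinate, against an offset between [6 * D] and [7 * D]. The result
    stays between 0 and [13 * D], whence the width [14 * D * q]. *)
Lemma slab_capture (D q : nat) (r al be : R) (a b : int) p :
  (0 < D)%N -> (0 < q)%N -> 0 < r <= 1 -> `|al| <= 2 -> `|p.1| <= D%:R ->
  `|p.2 - al * p.1 - be| <= 2 * D%:R * r ->
  `|a%:~R - q%:R * al| <= q%:R * r ->
  6 * D%:R * q%:R <= q%:R * be / r - b%:~R <= 7 * D%:R * q%:R ->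
  slab R (14 * D * q) (Num.floor (q%:R * p.2 / r) - a * Num.floor (p.1 / r) - b) = 1.
Proof.
move=> D0 q0 /andP[r0 r1] al2 p1D p2 aq /andP[b6 b7].
have D1 : 1 <= D%:R :> R by rewrite ler1n.
have q1 : 1 <= q%:R :> R by rewrite ler1n.
rewrite /slab; set k := a * _.
have -> : Num.floor (q%:R * p.2 / r) - k - b = Num.floor (q%:R * p.2 / r - k%:~R - b%:~R).
  by rewrite -!mulrNz !floorDrz ?intr_int// !intrKfloor.
rewrite floor_ge_int floor_lt_int /=.
pose fr : R := p.1 / r - (Num.floor (p.1 / r))%:~R.
have fr01 : 0 <= fr < 1.
  rewrite /fr; have := floor_le (p.1 / r); have := floorD1_gt (p.1 / r).
  rewrite intrD => h1 h2; apply/andP; split; lra.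
have a3 : `|a%:~R| <= 3 * q%:R :> R.
  have -> : a%:~R = (a%:~R - q%:R * al) + q%:R * al by ring.
  apply: le_trans (ler_normD _ _) _; rewrite normrM (ger0_norm (ler0n _ q)).
  have : q%:R * r <= q%:R * 1 by rewrite ler_wpM2l.
  have : q%:R * `|al| <= q%:R * 2 by rewrite ler_wpM2l.
  lra.
have t3 : `|a%:~R * fr| <= 3 * q%:R.
  have /andP[f0 f1] := fr01; rewrite normrM (ger0_norm f0).
  by apply: le_trans a3; rewrite ler_piMr// ltW.
have t1 : `|q%:R * ((p.2 - al * p.1 - be) / r)| <= 2 * D%:R * q%:R.
  rewrite normrM (ger0_norm (ler0n _ q)) normrM normfV (gtr0_norm r0).
  rewrite mulrC ler_wpM2r// ler_pdivrMr//.
have t2 : `|(q%:R * al - a%:~R) * (p.1 / r)| <= D%:R * q%:R.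
  rewrite normrM distrC normrM normfV (gtr0_norm r0) mulrA ler_pdivrMr//.
  apply: le_trans (ler_pM _ _ aq p1D) _ => //.
  by rewrite le_eqVlt; apply/orP; left; apply/eqP; ring.
have e : q%:R * p.2 / r - k%:~R - b%:~R =
   q%:R * ((p.2 - al * p.1 - be) / r) + (q%:R * al - a%:~R) * (p.1 / r)
   + (q%:R * be / r - b%:~R) + a%:~R * fr.
  by rewrite /k /fr intrM; field; lra.
move: t1 t2 t3; rewrite e !ler_norml => /andP[t1 t1'] /andP[t2 t2'] /andP[t3 t3'].
have Dq : q%:R <= D%:R * q%:R :> R by rewrite ler_peMl.
have -> : (14 * D * q)%N%:~R = 14 * (D%:R * q%:R) :> R by rewrite -mulnA -!natrM.
by case: andP => // -[]; split; lra.
Qed.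

End RichPairs.

(** * Mass of the rich pairs through the lattice model *)

Section ScaledPoints.
Variable R : realType.
Implicit Types (x y p : R * R).

Lemma leq_sum_term (I : finType) (F : I -> nat) i : (F i <= \sum_j F j)%N.
Proof. by rewrite (bigD1 i)//= leq_addr. Qed.

Lemma norm_ceil_le (u v : R) : `|u| <= v -> (`|Num.ceil u|%N%:R : R) <= v + 1.
Proof.
move=> uv; rewrite natr_absz intr_norm.
have := ceil_ge u; have := ceilB1_lt u; move: uv; rewrite intrB.
by rewrite !ler_norml => /andP[? ?] ? ?; apply/andP; split; lra.
Qed.

Let add_le (a b c d : nat) : (0 < c -> a <= 2 * c + 1 -> b <= c -> 4 * c <= d -> a + b <= d)%N.
Proof. lia. Qed.

Let hat_lower (a : int) (j b c : nat) :
  (0 < c -> `|a| <= 2 * c + 1 -> j < b -> b <= c -> c <= 6 * c - absz (a + j%:Z)%R)%N.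
Proof. lia. Qed.

(* Points become integer points [(xi p, eta p)] of an anisotropic grid. Every nonzero difference
   [xi x - xi y] divides [q], hence the tube width [14 * D * q]: for such a pair, shifting the
   intercept of a tube by its width amounts to an exact integer shift of its slope. *)
Variables (D : nat) (r : R).
Hypotheses (D0 : (0 < D)%N) (r01 : 0 < r <= 1).

Let N1 := (Num.truncn (2 * D%:R / r)).+2.
Let q := N1`!.
Let xi p := Num.floor (p.1 / r).
Let eta p := Num.floor (q%:R * p.2 / r).

Let r0 : 0 < r. Proof. by case/andP: r01. Qed.
Let q0 : (0 < q)%N. Proof. exact: fact_gt0. Qed.
Let D1 : 1 <= D%:R :> R. Proof. by rewrite ler1n. Qed.

Let N1r : 2 * D%:R / r + 1 <= N1%:R.
Proof. by rewrite -[N1%:R]natr1 lerD2r ltW// truncnS_gt. Qed.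

(** Guarantees an integer slope in every window of length [q * r], so that [La] in [rich_capture] is
    positive. *)
Let qr1 : 1 <= q%:R * r.
Proof.
apply: (@le_trans _ _ (N1%:R * r)); last by rewrite ler_wpM2r ?ler_nat ?fact_geq// ltW.
apply: (@le_trans _ _ (2 * D%:R / r * r)); last first.
  by rewrite ler_wpM2r ?(ltW r0)//; apply: le_trans N1r; rewrite lerDl.
by rewrite divfK ?gt_eqF//; have := D1; lra.
Qed.

Let bounded p := `|p.1| <= D%:R.

Let xi_sub x y : bounded x -> bounded y -> (`|xi x - xi y| <= N1)%N.
Proof.
rewrite /bounded !ler_norml => /andP[x1 x2] /andP[y1 y2].
rewrite -(ler_nat R); apply: le_trans (floor_sub_le _ _) _.
apply: le_trans N1r; rewrite lerD2r -mulrBl normrM normfV (gtr0_norm r0).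
rewrite ler_wpM2r ?invr_ge0 ?(ltW r0)// ler_norml; apply/andP; split; lra.
Qed.

Let xi_sub_dvd x y : bounded x -> bounded y -> xi x - xi y != 0 -> (`|xi x - xi y| %| q)%N.
Proof.
by move=> bx bY d0; rewrite dvdn_fact// absz_gt0 d0 xi_sub.
Qed.

Let sub_ge x y : supdist x y / r <= `|xi x - xi y|%:R + 1 \/
  q%:R * (supdist x y / r) <= `|eta x - eta y|%:R + 1.
Proof.
have n1 := norm_sub_floor (x.1 / r) (y.1 / r).
have n2 := norm_sub_floor (q%:R * x.2 / r) (q%:R * y.2 / r).
move: n1; rewrite -mulrBl normrM normfV (gtr0_norm r0) => n1.
move: n2; rewrite -mulrBl -mulrBr !normrM normfV (gtr0_norm r0) (ger0_norm (ler0n _ q)) => n2.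
rewrite /supdist; case: (leP `|x.1 - y.1| `|x.2 - y.2|) => _; [right|left] => //.
by rewrite mulrA.
Qed.

Let K1 : R := near_const R D.
Let K2 : R := far_const R D.

Let kern_near M x y : bounded x -> bounded y ->
  kern R M (14 * D * q) q (eta x - eta y) (xi x - xi y)
   <= K1 * q%:R ^+ 3 * r / Num.max (supdist x y) r.
Proof.
move=> bx bY.
have dq : (`|xi x - xi y| <= q)%N by rewrite (leq_trans (xi_sub bx bY))// fact_geq.
apply: le_trans (kern_energy_le M D0 q0 dq (sub_ge x y)) _.
have -> : Num.max (supdist x y / r) 1 = Num.max (supdist x y) r / r.
  by rewrite [RHS]maxr_pMl ?invr_ge0 ?(ltW r0)// divff ?gt_eqF.
by rewrite invf_div mulrA.
Qed.

Let kern_far M N0 k x y rho : bounded x -> bounded y ->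
  (6 * q + N0 * (14 * D * q) <= M)%N -> (k < N0)%N ->
  30 * D%:R * r <= rho -> rho <= supdist x y ->
  kern R M (14 * D * q) q (eta x - eta y) (xi x - xi y)
   - kern R M (14 * D * q) q (eta x - eta y + (k * (14 * D * q))%N%:Z) (xi x - xi y)
   <= K2 * q%:R ^+ 3 * N0%:R * r ^+ 2 / rho ^+ 2.
Proof.
move=> bx bY HM kN Dr far.
have dq : (`|xi x - xi y| <= q)%N by rewrite (leq_trans (xi_sub bx bY))// fact_geq.
have h1 : (30 * D)%:R <= rho / r by rewrite ler_pdivlMr// natrM.
have h2 : rho / r <= supdist x y / r by rewrite ler_wpM2r ?invr_ge0 ?(ltW r0).
apply: le_trans (kern_far_le D0 q0 dq (xi_sub_dvd bx bY) HM kN (sub_ge x y) h1 h2) _.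
have rho0 : 0 < rho by apply: lt_le_trans Dr; rewrite mulr_gt0// mulr_gt0//; have := D1; lra.
rewrite le_eqVlt; apply/orP; left; apply/eqP; rewrite /K2; field.
by rewrite !gt_eqF.
Qed.

(* A rich pair lies in about [q r * q] lattice tubes, each carrying [nu]-mass at least [lam r]. *)
Let rich_capture (X : finType) (nu : X -> R) (pX : X -> R * R) (M N : nat) (lam : R) x0 y0 :
  (forall i, 0 <= nu i) -> (forall i, bounded (pX i)) -> bounded x0 -> bounded y0 ->
  x0.1 != y0.1 -> (forall i, (pX i).1 != y0.1) -> `|slope x0 y0| <= 2 ->
  lam < \sum_(i | `|slope (pX i) y0 - slope x0 y0| <= r) nu i ->
  (4 * q <= M)%N ->
  (`|Num.ceil (q%:R * (y0.2 - slope x0 y0 * y0.1) / r - 7 * D%:R * q%:R)| + q <= N)%N ->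
  (q ^ 2)%:R * (q%:R * r / 2) <=
  line_sum M N q (fun a b =>
    (lam <= line_mass (14 * D * q) nu (xi \o pX) (eta \o pX) a b)%R%:R *
    (slab R (14 * D * q) (eta x0 - a * xi x0 - b) * slab R (14 * D * q) (eta y0 - a * xi y0 - b))).
Proof.
move=> nu0 bX bx0 by0 x0y0 Xy0 sl2 rich Mq Nq.
set al := slope x0 y0 in sl2 rich Nq *; set be := y0.2 - al * y0.1 in Nq *.
pose za := Num.ceil (q%:R * al).
pose La := Num.truncn (q%:R * r).
pose zb := Num.ceil (q%:R * be / r - 7 * D%:R * q%:R).
have q1 : 1 <= q%:R :> R by rewrite ler1n.
have La_le : La%:R <= q%:R * r by rewrite truncn_le mulr_ge0// ltW.
have La_ge : q%:R * r / 2 <= La%:R.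
  have := truncnS_gt (q%:R * r); rewrite -natr1 -/La => h.
  have : 1 <= La%:R :> R.
    by rewrite ler1n -ltnS -(ltr_nat R); apply: le_lt_trans qr1 (truncnS_gt _).
  lra.
have Laq : (La <= q)%N.
  rewrite -(ler_nat R); apply: le_trans La_le _; rewrite ler_piMr//; by case/andP: r01.
have za_le : (`|za| <= 2 * q + 1)%N.
  rewrite -(ler_nat R) natrD; apply: norm_ceil_le.
  by rewrite normrM (ger0_norm (ler0n _ q)) mulrC natrM ler_wpM2r.
have near p : p.1 != y0.1 -> bounded p -> `|slope p y0 - al| <= r ->
    `|p.2 - al * p.1 - be| <= 2 * D%:R * r.
  move=> py bp hs; have -> : p.2 - al * p.1 - be = (slope p y0 - al) * (p.1 - y0.1).
    by rewrite /slope /be; field; rewrite subr_eq0.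
  rewrite normrM mulrC ler_pM//; move: bp by0; rewrite /bounded !ler_norml.
  by move=> /andP[? ?] /andP[? ?]; apply/andP; split; lra.
have cap (j i : nat) p : (j < La)%N -> (i < q)%N -> bounded p ->
    `|p.2 - al * p.1 - be| <= 2 * D%:R * r ->
    slab R (14 * D * q) (eta p - (za + j%:Z) * xi p - (zb + i%:Z)) = 1.
  move=> jL iq bp hp; apply: (@slab_capture R D q r al be) => //.
    have := ceil_ge (q%:R * al); have := ceilB1_lt (q%:R * al).
    rewrite -/za intrB intrD => h1 h2.
    have hj : j%:R + 1 <= La%:R :> R by rewrite natr1 ler_nat.
    have j0 : 0 <= j%:R :> R by [].
    by rewrite -pmulrn ger0_norm; lra.
  have := ceil_ge (q%:R * be / r - 7 * D%:R * q%:R).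
  have := ceilB1_lt (q%:R * be / r - 7 * D%:R * q%:R).
  rewrite -/zb intrB intrD => h1 h2.
  have hi : i%:R + 1 <= q%:R :> R by rewrite natr1 ler_nat.
  have i0 : 0 <= i%:R :> R by [].
  have Dq : q%:R <= D%:R * q%:R :> R by rewrite ler_peMl.
  by rewrite -pmulrn; apply/andP; split; lra.
(* [La] slopes of weight at least [q], with [q] intercepts each; every such tube contains [x0], [y0]
   and all points within slope [r] of [x0] as seen from [y0]. *)
apply: (@le_trans _ _ (La%:R * (q%:R * (q%:R * 1)))).
  rewrite natrX mulr1 mulrC -expr2 ler_wpM2r// exprn_ge0//.
have slab0 W u : 0 <= slab R W u by rewrite ler0n.
have bool0 (b : bool) : 0 <= b%:R :> R by rewrite ler0n.
apply: (@win_ge R M La za) => [k||j jL].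
- rewrite mulr_ge0 ?hat_ge0// win_ge0// => b; by rewrite !mulr_ge0.
- exact: add_le za_le Laq Mq.
apply: (ler_pM _ _ _ _) => //.
- by rewrite /hat ler_nat (hat_lower q0 za_le jL Laq).
apply: (@win_ge R N q zb) => [k||i iq] //; first by rewrite !mulr_ge0.
rewrite !cap//; last 2 first.
- by rewrite /be subrr normr0 mulr_ge0 ?(ltW r0)// mulr_ge0.
- by apply: near => //; rewrite subrr normr0 ltW.
rewrite !mulr1 ler1n lt0b; apply: (le_trans (ltW rich)).
rewrite /line_mass big_mkcond /=; apply: ler_sum => k _.
by case: ifP => hs; [rewrite cap ?mulr1//; apply: near|rewrite mulr_ge0].
Qed.

Lemma absz_sub_mul (m a n : int) (M : nat) : (`|a| <= M)%N ->
  (absz (m - a * n)%R <= `|m| + M * `|n|)%N.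
Proof.
move=> aM; have : (absz (a * n)%R <= M * `|n|)%N by rewrite abszM leq_mul2r aM orbT.
by lia.
Qed.

(** The lower bound [rich_capture], summed over rich pairs, is compared with [line_sum_rich_le], and
    [q ^ 3 * r] cancels. Pairs of [nu] closer than [rho] are controlled by the energy, the others by
    the difference kernel. *)
Lemma rich_mass_le (X Y : finType) (nu : X -> R) (mu : Y -> R)
    (pX : X -> R * R) (pY : Y -> R * R) (C s t R0 rho th : R) :
  (forall i, 0 <= nu i) -> \sum_i nu i <= 1 -> (forall i, 0 <= mu i) -> \sum_i mu i <= 1 ->
  (forall i, bounded (pX i)) -> (forall j, bounded (pY j)) ->
  (forall i j, (pX i).1 != (pY j).1) -> (forall i j, `|slope (pX i) (pY j)| <= 2) ->
  0 <= C -> 1 < s -> 1 < t -> frostman nu pX C t r -> frostman mu pY C s r ->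
  30 * D%:R * r <= rho <= 1 -> r <= R0 -> 0 < th ->
  \sum_i \sum_(j | 2 / R0 * r < \sum_(i' | `|slope (pX i') (pY j) - slope (pX i) (pY j)| <= r) nu i')
     nu i * mu j
  <= 4 / th * (K1 * (C * layer_const t) * rho `^ (t - 1) + 2 * K2 * R0 / rho ^+ 2)
     + 2 * th * (K1 * (C * layer_const s + 1)).
Proof.
move=> nu0 nu1 mu0 mu1 bX bY XY sl2 C0 s1 t1 frX frY /andP[rho30 rho1] rR0 th0.
have R00 : 0 < R0 by apply: lt_le_trans rR0.
have rrho : r <= rho.
  by apply: le_trans rho30; rewrite ler_peMl ?(ltW r0)//; have := D1; lra.
have rho0 : 0 < rho by apply: lt_le_trans rrho.
pose N0 := (Num.truncn (R0 / r)).+1.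
have N0r : R0 <= N0%:R * r by rewrite -ler_pdivrMr// ltW// truncnS_gt.
have N0r2 : N0%:R * r <= 2 * R0.
  have h : (Num.truncn (R0 / r))%:R * r <= R0.
    by rewrite -ler_pdivlMr// truncn_le divr_ge0 ?ltW.
  by rewrite -[N0%:R]natr1 mulrDl mul1r; lra.
have N00 : 0 < N0%:R :> R by rewrite ltr0n.
have lam_le : 2 / N0%:R <= 2 / R0 * r.
  rewrite -mulrA ler_pM2l// -[R0^-1 * r]invrK lef_pV2 ?posrE//; last first.
    by rewrite invr_gt0 mulr_gt0// invr_gt0.
  by rewrite invfM invrK mulrC ler_pdivrMl// mulrC.
set W := (14 * D * q)%N.
pose M := (6 * q + N0 * W)%N.
(* Any window holding all relevant intercepts will do; its size does not enter the estimate. *)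
pose N := ((\sum_i (`|eta (pX i)| + M * `|xi (pX i)|) + \sum_j (`|eta (pY j)| + M * `|xi (pY j)|)
  + \sum_i \sum_j `|Num.ceil (q%:R * ((pY j).2 - slope (pX i) (pY j) * (pY j).1) / r - 7 * D%:R * q%:R)|)
  + q + 2 * (N0 * W) + W)%N.
have bNX i a : (`|a| <= M)%N ->
    (absz ((eta \o pX) i - a * (xi \o pX) i)%R + 2 * (N0 * W) + W <= N)%N.
  move=> /(absz_sub_mul (eta (pX i)) (xi (pX i))) h.
  have := leq_sum_term (fun i => `|eta (pX i)| + M * `|xi (pX i)|)%N i.
  by rewrite /N /= => h'; rewrite !leq_add2r -!addnA (leq_trans h)// (leq_trans h')// leq_addr.
have bNY j a : (`|a| <= M)%N -> (absz ((eta \o pY) j - a * (xi \o pY) j)%R + W <= N)%N.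
  move=> /(absz_sub_mul (eta (pY j)) (xi (pY j))) h.
  have := leq_sum_term (fun i => `|eta (pY i)| + M * `|xi (pY i)|)%N j.
  rewrite /N /= => h'; rewrite leq_add2r (leq_trans h)// (leq_trans h')//.
  by rewrite -!addnA addnCA leq_addr.
have bN i j : (`|Num.ceil (q%:R * ((pY j).2 - slope (pX i) (pY j) * (pY j).1) / r - 7 * D%:R * q%:R)| + q <= N)%N.
  have h1 := leq_sum_term (fun i => \sum_j `|Num.ceil (q%:R * ((pY j).2 - slope (pX i) (pY j) * (pY j).1) / r - 7 * D%:R * q%:R)|)%N i.
  have h2 := leq_sum_term (fun j => `|Num.ceil (q%:R * ((pY j).2 - slope (pX i) (pY j) * (pY j).1) / r - 7 * D%:R * q%:R)|)%N j.
  have {h1 h2}h := leq_trans h2 h1.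
  by rewrite /N -(addnA _ _ W) (leq_trans _ (leq_addr _ _))// leq_add2r (leq_trans h)// leq_addl.
pose G (i j : X) : R := if supdist (pX i) (pX j) <= rho
  then K1 * q%:R ^+ 3 * r / Num.max (supdist (pX i) (pX j)) r
  else K2 * q%:R ^+ 3 * N0%:R * r ^+ 2 / rho ^+ 2.
pose G' (i j : Y) : R := K1 * q%:R ^+ 3 * r / Num.max (supdist (pY i) (pY j)) r.
have K10 : 0 <= K1 by exact/ltW/near_const_gt0.
have K20 : 0 <= K2 by exact/ltW/far_const_gt0.
have q3 : 0 < q%:R ^+ 3 * r :> R by rewrite mulr_gt0// exprn_gt0// ltr0n.
have up : line_sum M N q (fun a b =>
    (2 / N0%:R <= line_mass W nu (xi \o pX) (eta \o pX) a b)%R%:R *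
    (line_mass W nu (xi \o pX) (eta \o pX) a b * line_mass W mu (xi \o pY) (eta \o pY) a b))
   <= 2 / th * \sum_i \sum_j nu i * nu j * G i j + th * \sum_i \sum_j mu i * mu j * G' i j.
  apply: line_sum_rich_le => //.
  - move=> i j k kN; rewrite /G; case: (leP (supdist (pX i) (pX j)) rho) => far /=; last first.
      by apply: kern_far => //; exact: ltW.
    by rewrite lerBlDr (le_trans (kern_near _ _ _))// lerDl kern_ge0.
  - by move=> i j; exact: kern_near.
have eX : \sum_i \sum_j nu i * nu j * G i j <=
    (q%:R ^+ 3 * r) * (K1 * (C * layer_const t) * rho `^ (t - 1) + 2 * K2 * R0 / rho ^+ 2).
  have tail : \sum_i \sum_j nu i * nu j <= 1.
    under eq_bigr do rewrite -mulr_sumr.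
    by rewrite -mulr_suml mulr_ile1// sumr_ge0.
  apply: (@le_trans _ _ (K1 * (q%:R ^+ 3 * r) *
     (\sum_i \sum_(j | supdist (pX i) (pX j) <= rho) nu i * nu j / Num.max (supdist (pX i) (pX j)) r)
     + (K2 * q%:R ^+ 3 * N0%:R * r ^+ 2 / rho ^+ 2) * \sum_i \sum_j nu i * nu j)).
    rewrite !mulr_sumr -big_split /=; apply: ler_sum => i _.
    rewrite !mulr_sumr [X in _ <= X + _]big_mkcond -big_split /=; apply: ler_sum => j _.
    have c0 : 0 <= K2 * q%:R ^+ 3 * N0%:R * r ^+ 2 / rho ^+ 2.
      by rewrite !mulr_ge0 ?invr_ge0 ?exprn_ge0 ?(ltW r0) ?(ltW rho0).
    rewrite /G; case: ifP => _; last by rewrite add0r mulrC.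
    apply: (@le_trans _ _ (K1 * (q%:R ^+ 3 * r) * (nu i * nu j / Num.max (supdist (pX i) (pX j)) r))).
      by rewrite le_eqVlt; apply/orP; left; apply/eqP; ring.
    by rewrite lerDl mulr_ge0// mulr_ge0.
  apply: (@le_trans _ _ (K1 * (q%:R ^+ 3 * r) * (C * layer_const t * rho `^ (t - 1))
     + (K2 * q%:R ^+ 3 * N0%:R * r ^+ 2 / rho ^+ 2) * 1)).
    apply: lerD; rewrite ler_wpM2l//.
    - by rewrite mulr_ge0// ltW.
    - by apply: energy_le => //; rewrite rrho.
    - by rewrite !mulr_ge0 ?invr_ge0 ?exprn_ge0 ?(ltW r0) ?(ltW rho0).
  rewrite mulrDr; apply: lerD; first by rewrite le_eqVlt; apply/orP; left; apply/eqP; ring.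
  rewrite mulr1; have -> : K2 * q%:R ^+ 3 * N0%:R * r ^+ 2 / rho ^+ 2 =
    (q%:R ^+ 3 * r) * (K2 * (N0%:R * r) / rho ^+ 2) by ring.
  rewrite ler_pM2l//; rewrite ler_wpM2r ?invr_ge0 ?exprn_ge0 ?(ltW rho0)//.
  by rewrite [2 * K2]mulrC -[leRHS]mulrA ler_wpM2l.
have eY : \sum_i \sum_j mu i * mu j * G' i j <= (q%:R ^+ 3 * r) * (K1 * (C * layer_const s + 1)).
  have tail : \sum_i \sum_j mu i * mu j <= 1.
    under eq_bigr do rewrite -mulr_sumr.
    by rewrite -mulr_suml mulr_ile1// sumr_ge0.
  apply: (@le_trans _ _ (K1 * (q%:R ^+ 3 * r) *
     (\sum_i \sum_(j | supdist (pY i) (pY j) <= 1) mu i * mu j / Num.max (supdist (pY i) (pY j)) r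
     + \sum_i \sum_j mu i * mu j))).
    rewrite -big_split /= mulr_sumr; apply: ler_sum => i _.
    rewrite [X in _ <= _ * (X + _)]big_mkcond -big_split /= mulr_sumr; apply: ler_sum => j _.
    have c0 : 0 <= K1 * (q%:R ^+ 3 * r) by rewrite mulr_ge0// ltW.
    rewrite (_ : _ * G' i j = K1 * (q%:R ^+ 3 * r) * (mu i * mu j / Num.max (supdist (pY i) (pY j)) r)); last by rewrite /G'; ring.
    rewrite ler_wpM2l//; case: (leP (supdist (pY i) (pY j)) 1) => far; first by rewrite lerDl mulr_ge0.
    rewrite add0r ler_piMr ?mulr_ge0// invf_le1.
      by rewrite le_max (ltW far).
    by rewrite lt_max r0 orbT.
  rewrite [leRHS]mulrCA [leRHS]mulrA ler_wpM2l ?mulr_ge0 ?(ltW r0) ?exprn_ge0//.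
  rewrite lerD//; have := @energy_le R Y mu pY C s r 1 r0 s1 C0 mu0 mu1 frY.
  by rewrite powR1 mulr1; apply; rewrite lexx andbT; case/andP: r01.
set S := \sum_i _.
have low : S * ((q ^ 2)%:R * (q%:R * r / 2)) <= line_sum M N q (fun a b =>
    (2 / N0%:R <= line_mass W nu (xi \o pX) (eta \o pX) a b)%R%:R *
    (line_mass W nu (xi \o pX) (eta \o pX) a b * line_mass W mu (xi \o pY) (eta \o pY) a b)).
  rewrite (_ : line_sum _ _ _ _ = line_sum M N q (fun a b => \sum_i \sum_j nu i * mu j *
    ((2 / N0%:R <= line_mass W nu (xi \o pX) (eta \o pX) a b)%R%:R *
     (slab R W (eta (pX i) - a * xi (pX i) - b) * slab R W (eta (pY j) - a * xi (pY j) - b))))); last first.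
    apply: eq_win => a _; congr (_ * _); apply: eq_win => b _.
    rewrite {2}/line_mass {2}/line_mass big_distrlr /= mulr_sumr; apply: eq_bigr => i _.
    by rewrite mulr_sumr; apply: eq_bigr => j _ /=; ring.
  rewrite line_sum_sum /S mulr_suml; apply: ler_sum => i _.
  rewrite line_sum_sum mulr_suml big_mkcond; apply: ler_sum => j _.
  rewrite line_sumZ; case: ifP => rich; last first.
    rewrite mulr_ge0 ?mulr_ge0// win_ge0// => a; rewrite mulr_ge0 ?hat_ge0// win_ge0// => b.
    by rewrite !mulr_ge0// ler0n.
  rewrite ler_wpM2l ?mulr_ge0//; apply: rich_capture => //.
  - exact: le_lt_trans lam_le rich.
  - by rewrite /M (leq_trans _ (leq_addr _ _))// leq_mul2r orbT.
have := le_trans low up.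
have -> : S * ((q ^ 2)%:R * (q%:R * r / 2)) = (q%:R ^+ 3 * r) * (S / 2).
  by rewrite natrX; field.
move=> H.
have : (q%:R ^+ 3 * r) * (S / 2) <= (q%:R ^+ 3 * r) *
    (2 / th * (K1 * (C * layer_const t) * rho `^ (t - 1) + 2 * K2 * R0 / rho ^+ 2)
     + th * (K1 * (C * layer_const s + 1))).
  apply: le_trans H _; rewrite mulrDr; apply: lerD.
    by rewrite [leRHS]mulrCA ler_wpM2l// divr_ge0// ltW.
  by rewrite [leRHS]mulrCA ler_wpM2l// ltW.
rewrite ler_pM2l// => {}H.
move: (_ + 2 * K2 * R0 / _) (K1 * (_ + 1)) H => A B H.
rewrite -(@ler_pM2r _ 2^-1) ?invr_gt0//; apply: le_trans H _.
by rewrite le_eqVlt; apply/orP; left; apply/eqP; field; rewrite gt_eqF.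
Qed.

End ScaledPoints.

Section SmallRichMass.
Variable R : realType.

Lemma exists_powR_le (c p : R) : 0 < c -> 0 < p -> exists2 rho, 0 < rho <= 1 & rho `^ p <= c.
Proof.
move=> c0 p0; have m0 : 0 < Num.min 1 c by rewrite lt_min ltr01.
exists (Num.min 1 c `^ p^-1); last first.
  by rewrite -powRrM mulVf ?gt_eqF// powRr1 ?(ltW m0)// ge_min lexx orbT.
rewrite powR_gt0//= -[leRHS](powRr0 (Num.min 1 c)) ger_powR ?invr_ge0 ?(ltW p0)//.
by rewrite m0 ge_min lexx.
Qed.

Definition rich_mass (X Y : finType) (nu : X -> R) (mu : Y -> R)
    (pX : X -> R * R) (pY : Y -> R * R) (r m : R) : R :=
  \sum_i \sum_(j | m < \sum_(i' | `|slope (pX i') (pY j) - slope (pX i) (pY j)| <= r) nu i')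
     nu i * mu j.

(** The constants are chosen in the order [th], [rho], [R0]: they make the [mu] term [e / 2], and
    the near and far terms of [nu] at most [e / 4] each. None of them depends on [r] or on the
    finite sets. *)
Lemma rich_mass_small (D : nat) (C s t e : R) :
  (0 < D)%N -> 0 < C -> 1 < s -> 1 < t -> 0 < e ->
  exists2 lam : R, 0 < lam & exists2 r0 : R, 0 < r0 & forall r, 0 < r <= r0 -> r <= 1 ->
  forall (X Y : finType) (nu : X -> R) (mu : Y -> R)
    (pX : X -> R * R) (pY : Y -> R * R),
  (forall i, 0 <= nu i) -> \sum_i nu i <= 1 -> (forall i, 0 <= mu i) -> \sum_i mu i <= 1 ->
  (forall i, `|(pX i).1| <= D%:R) -> (forall j, `|(pY j).1| <= D%:R) ->
  (forall i j, (pX i).1 != (pY j).1) -> (forall i j, `|slope (pX i) (pY j)| <= 2) ->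
  frostman nu pX C t r -> frostman mu pY C s r ->
  rich_mass nu mu pX pY r (lam * r) <= e.
Proof.
move=> D0 C0 s1 t1 e0.
have D1 : 1 <= D%:R :> R by rewrite ler1n.
have D30 : 0 < 30 * D%:R :> R by rewrite mulr_gt0//; lra.
have sixteenth (x y : R) : x <= y / 16 -> x + y / 16 <= y / 8 by move=> ?; lra.
have K10 := near_const_gt0 R D0; have K20 := far_const_gt0 R D0.
set K1 := near_const R D in K10; set K2 := far_const R D in K20.
have Ls := layer_const_gt0 s1; have Lt := layer_const_gt0 t1.
have E0 : 0 < K1 * (C * layer_const s + 1) by rewrite mulr_gt0// addr_gt0// mulr_gt0.
set E := K1 * _ in E0.
pose th := e / (4 * E).
have th0 : 0 < th by rewrite divr_gt0// mulr_gt0.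
have F0 : 0 < K1 * (C * layer_const t) := mulr_gt0 K10 (mulr_gt0 C0 Lt).
set F := K1 * _ in F0.
have [||rho /andP[rho0 rho1] rhoE] := @exists_powR_le (e * th / 16 / F) (t - 1).
- by rewrite divr_gt0// divr_gt0// mulr_gt0.
- by rewrite subr_gt0.
pose R0 := e * th / 32 / K2 * rho ^+ 2.
have R00 : 0 < R0 by rewrite mulr_gt0 ?exprn_gt0// divr_gt0// divr_gt0// mulr_gt0.
exists (2 / R0); first by rewrite divr_gt0.
exists (Num.min R0 (rho / (30 * D%:R))).
  by rewrite lt_min R00 divr_gt0.
move=> r /andP[r0]; rewrite le_min => /andP[rR0 rrho] r1 X Y nu mu pX pY.
move=> nu0 nu1 mu0 mu1 bX bY XY sl2 frX frY.
apply: (le_trans (@rich_mass_le R D r D0 _ X Y nu mu pX pY C s t R0 rho th _ _ _ _ _ _ _ _ _ _ _ _ _ _ _ _)) => //.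
- by rewrite r0.
- exact: ltW.
- by rewrite rho1 andbT mulrC -ler_pdivlMr.
rewrite -/K1 -/K2 -/E -/F.
have h1 : F * rho `^ (t - 1) <= e * th / 16 by rewrite mulrC -ler_pdivlMr.
have h2 : 2 * K2 * R0 / rho ^+ 2 = e * th / 16.
  by rewrite /R0; field; rewrite !gt_eqF.
have h3 : 2 * th * E = e / 2 by rewrite /th; field; rewrite gt_eqF.
rewrite h2 h3.
apply: (@le_trans _ _ (4 / th * (e * th / 8) + e / 2)).
  rewrite lerD2r; apply: ler_wpM2l; last exact: sixteenth.
  by rewrite divr_ge0 ?(ltW th0).
have -> : 4 / th * (e * th / 8) = e / 2 by field; rewrite gt_eqF.
by rewrite -splitr.
Qed.

End SmallRichMass.

(** * Kaufman's argument in thin annuli *)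

Section Strips.
Variable R : realType.
Implicit Types (x y p : R * R).

Definition edist x y : R := Num.sqrt ((x.1 - y.1) ^+ 2 + (x.2 - y.2) ^+ 2).

Lemma edist_ge0 x y : 0 <= edist x y. Proof. exact: sqrtr_ge0. Qed.

Lemma sqr_edist x y : edist x y ^+ 2 = (x.1 - y.1) ^+ 2 + (x.2 - y.2) ^+ 2.
Proof. by rewrite sqr_sqrtr// addr_ge0 ?sqr_ge0. Qed.

Lemma edist_le_sum x y : edist x y <= `|x.1 - y.1| + `|x.2 - y.2|.
Proof.
rewrite -(@ler_pXn2r _ 2) ?nnegrE ?edist_ge0 ?addr_ge0// sqr_edist.
rewrite [leRHS]sqrrD !real_normK ?num_real// -addrA lerD2l.
by rewrite lerDr mulrn_wge0// mulr_ge0.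
Qed.

(* The difference of squared distances from [x] to [y] and [y'] is affine in [x]. *)
Lemma strip_of_edist (D : nat) (c0 be : R) x y y' :
  (0 < D)%N -> 0 < c0 -> `|x.1| <= D%:R -> `|x.2| <= D%:R -> `|y.1| <= D%:R -> `|y.2| <= D%:R ->
  `|y'.1| <= D%:R -> `|y'.2| <= D%:R ->
  c0 <= `|x.1 - y.1| -> `|edist x y' - edist x y| <= be ->
  `|(y.1 - y'.1) + slope x y * (y.2 - y'.2)| <= (4 * D%:R * be + supdist y y' ^+ 2) / c0.
Proof.
move=> D0 c00 x1 x2 y1 y2 y'1 y'2 cxy hbe.
have dist_le p : `|p.1| <= D%:R -> `|p.2| <= D%:R -> edist x p <= 4 * D%:R.
  move=> p1 p2; apply: le_trans (edist_le_sum _ _) _.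
  have := ler_normB x.1 p.1; have := ler_normB x.2 p.2; lra.
have d12 : `|edist x y' ^+ 2 - edist x y ^+ 2| <= 8 * D%:R * be.
  rewrite subr_sqr normrM mulrC ler_pM//.
  rewrite ger0_norm ?addr_ge0 ?edist_ge0//.
  by have := dist_le y y1 y2; have := dist_le y' y'1 y'2; lra.
have xy0 : x.1 - y.1 != 0 by rewrite -normr_gt0 (lt_le_trans c00).
have e : (x.1 - y.1) * ((y.1 - y'.1) + slope x y * (y.2 - y'.2)) =
   2^-1 * ((edist x y' ^+ 2 - edist x y ^+ 2) - ((y.1 - y'.1) ^+ 2 + (y.2 - y'.2) ^+ 2)).
  by rewrite !sqr_edist /slope; field.
have sq u : `|u| <= supdist y y' -> u ^+ 2 <= supdist y y' ^+ 2.
  move=> us; rewrite -[leLHS]real_normK ?num_real//.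
  by rewrite lerXn2r ?nnegrE//; apply: le_trans us.
have s1 : (y.1 - y'.1) ^+ 2 <= supdist y y' ^+ 2 by apply: sq; rewrite le_max lexx.
have s2 : (y.2 - y'.2) ^+ 2 <= supdist y y' ^+ 2 by apply: sq; rewrite le_max lexx orbT.
have t1 := sqr_ge0 (y.1 - y'.1); have t2 := sqr_ge0 (y.2 - y'.2).
rewrite ler_pdivlMr// mulrC.
apply: (@le_trans _ _ (`|x.1 - y.1| * `|(y.1 - y'.1) + slope x y * (y.2 - y'.2)|)).
  by rewrite ler_wpM2r.
rewrite -normrM e; move: d12; rewrite !ler_norml => /andP[h1 h2].
by apply/andP; split; lra.
Qed.

(** Here [(a, b)] is the difference of the two points [y] and [y']. As [|s| <= 2], a small
    [a + s * b] forces [|b| >= V / 4]; then divide the difference of both inequalities by [b]. *)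
Lemma slope_sub_le (w V a b s s' : R) : `|s| <= 2 -> V = Num.max `|a| `|b| ->
  4 * w <= V -> 0 < V -> `|a + s * b| <= w -> `|a + s' * b| <= w ->
  `|s - s'| <= 8 * w / V.
Proof.
move=> s2 VE w4 V0 h1 h2.
have a_le : `|a| <= w + 2 * `|b|.
  have -> : a = (a + s * b) - s * b by ring.
  by apply: le_trans (ler_normB _ _) _; rewrite lerD// normrM ler_wpM2r.
have b_ge : V / 4 <= `|b|.
  have b0 : 0 <= `|b| by [].
  have : V <= Num.max (w + 2 * `|b|) `|b| by rewrite VE ge_max !le_max a_le lexx orbT.
  by rewrite le_max => /orP[]; lra.
have : `|(s - s') * b| <= 2 * w.
  have -> : (s - s') * b = (a + s * b) - (a + s' * b) by ring.
  by apply: le_trans (ler_normB _ _) _; lra.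
rewrite normrM => h3.
rewrite ler_pdivlMr//.
have : `|s - s'| * (V / 4) <= 2 * w by apply: le_trans h3; rewrite ler_wpM2l.
lra.
Qed.

(** Cut the slopes, which span at most [2 * L], into intervals of length [r]: the selected points of
    one interval lie in the [r]-neighbourhood of any one of them, whose mass is at most [m]. *)
Lemma tame_mass_le (X : finType) (nu sig : X -> R) (S : pred X) (r m L : R) :
  0 < r -> 0 <= m -> 0 <= L -> (forall i, 0 <= nu i) ->
  (forall i j, S i -> S j -> `|sig i - sig j| <= L) ->
  \sum_(i | S i && (\sum_(i' | `|sig i' - sig i| <= r) nu i' <= m)) nu i
   <= (2 * L / r + 1) * m.
Proof.
move=> r0 m0 L0 nu0 SL.
pose P i := S i && (\sum_(i' | `|sig i' - sig i| <= r) nu i' <= m).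
rewrite (eq_bigl P)//.
case: (pickP P) => [i0 Pi0|P0]; last first.
  by rewrite big_pred0// mulr_ge0// addr_ge0 ?divr_ge0 ?mulr_ge0// ltW.
have S0 : S i0 by case/andP: Pi0.
pose n := Num.truncn (2 * L / r).
have nE : n%:R <= 2 * L / r by rewrite truncn_le divr_ge0 ?mulr_ge0// ltW.
pose f i := Num.truncn ((sig i - sig i0 + L) / r).
have fn i : P i -> (f i < n.+1)%N.
  case/andP => Si _; rewrite ltnS le_truncn// ler_wpM2r ?invr_ge0 ?(ltW r0)//.
  by have := SL _ _ Si S0; rewrite ler_norml => /andP[]; lra.
rewrite (eq_bigl (fun i => P i && (f i < n.+1)%N)); last first.
  by move=> i; case: (boolP (P i)) => // /fn ->.
rewrite (partition_big (fun i => inord (f i) : 'I_n.+1) xpredT)//=.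
apply: (@le_trans _ _ (\sum_(k < n.+1) m)); last first.
  by rewrite sumr_const card_ord -[_ *+ n.+1]mulr_natl ler_wpM2r// -[n.+1%:R]natr1 lerD2r.
apply: ler_sum => k _.
pose Q i := (P i && (f i < n.+1)%N) && (inord (f i) == k :> 'I_n.+1).
rewrite (eq_bigl Q)//.
case: (pickP Q) => [j Qj|Q0]; last by rewrite big_pred0.
have [[Sj mj] fj] : (S j /\ \sum_(i' | `|sig i' - sig j| <= r) nu i' <= m) /\ f j = k.
  move: Qj => /andP[/andP[Pj jn] /eqP <-]; rewrite inordK//.
  by case/andP: Pj.
apply: le_trans mj; apply: ler_sum_subset => // i.
move=> /andP[/andP[Pi ilt] /eqP ik].
have fi : f i = k by rewrite -ik inordK.
have Si : S i by case/andP: Pi.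
have lo l : S l -> f l = k -> k%:R * r <= sig l - sig i0 + L < (k%:R + 1) * r.
  move=> Sl fl; have p0 : 0 <= (sig l - sig i0 + L) / r.
    rewrite divr_ge0 ?(ltW r0)//; have := SL _ _ Sl S0; rewrite ler_norml => /andP[]; lra.
  rewrite -ler_pdivlMr// -ltr_pdivrMr// -fl /f natr1 truncnS_gt andbT.
  by rewrite truncn_le.
have /andP[i1 i2] := lo i Si fi; have /andP[j1 j2] := lo j Sj fj.
by rewrite ler_norml; apply/andP; split; lra.
Qed.

End Strips.

Section Fibers.
Variable R : realType.

(** Counting through a list allows an infinite [T], such as the integer grid indices. *)
Definition image_count (Y : finType) (T : eqType) (f : Y -> T) : nat :=
  size (undup [seq f y | y <- enum Y]).

(** Each fibre contributes 1, or 0 if its mass vanishes, because division by 0 yields 0. *)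
Lemma sum_div_fiber_le (Y : finType) (T : eqType) (f : Y -> T) (mu : Y -> R) :
  (forall y, 0 <= mu y) ->
  \sum_y mu y / (\sum_(y' | f y' == f y) mu y') <= (image_count f)%:R.
Proof.
move=> mu0; set s := undup [seq f y | y <- enum Y].
have fs y : f y \in s by rewrite mem_undup map_f// mem_enum.
rewrite (eq_bigr (fun y => \sum_(c <- s | c == f y)
    mu y / (\sum_(y' | f y' == c) mu y'))); last first.
  move=> y _; rewrite -[RHS]big_filter.
  by rewrite (@eq_filter _ _ (pred1 (f y)))// filter_pred1_uniq ?undup_uniq// big_seq1.
rewrite (exchange_big_dep xpredT)//=.
apply: (@le_trans _ _ (\sum_(c <- s) 1)); last first.
  by rewrite big_const_seq count_predT iter_addr addr0.
apply: ler_sum => c _.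
have [z|n0] := eqVneq (\sum_(y | f y == c) mu y) 0.
  by rewrite big1// => y _; rewrite z invr0 mulr0.
have e : \sum_(y | c == f y) mu y = \sum_(y | f y == c) mu y.
  by apply: eq_bigl => y; rewrite eq_sym.
by rewrite -mulr_suml e divff.
Qed.

End Fibers.

(** * Mass of thin strips and of badly seen cells *)

Section StripMass.
Variable R : realType.

(** From [2 * L / r + 1] of [tame_mass_le] with [L = 8 * w / V] and
    [w <= (8 * D + 1) * r * rho / c0]. *)
Definition strip_const (D : nat) (c0 : R) : R := 16 * (8 * D%:R + 1) / c0 + 1.

Lemma strip_const_ge1 D c0 : 0 < c0 -> 1 <= strip_const D c0.
Proof. by move=> c00; rewrite /strip_const lerDr divr_ge0 ?(ltW c00)// mulr_ge0// addr_ge0// mulr_ge0. Qed.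

Lemma strip_mass_le (D : nat) (c0 r rho lam : R) (X : finType) (nu : X -> R)
    (pX : X -> R * R) (y y' : R * R) :
  (0 < D)%N -> 0 < c0 -> r <= c0 / 8 -> 0 < rho <= r -> 1 <= lam ->
  (forall i, 0 <= nu i) -> \sum_i nu i <= 1 ->
  (forall i, `|(pX i).1| <= D%:R) -> (forall i, `|(pX i).2| <= D%:R) ->
  `|y.1| <= D%:R -> `|y.2| <= D%:R -> `|y'.1| <= D%:R -> `|y'.2| <= D%:R ->
  (forall i, c0 <= `|(pX i).1 - y.1|) -> (forall i, `|slope (pX i) y| <= 2) ->
  supdist y y' <= rho ->
  \sum_(i | (`|edist (pX i) y' - edist (pX i) y| <= 2 * (r * rho)) &&
      (\sum_(i' | `|slope (pX i') y - slope (pX i) y| <= r) nu i' <= lam * r)) nu i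
   <= strip_const D c0 * lam * (r * rho / Num.max (supdist y y') (r * rho)).
Proof.
move=> D0 c00 rc0 /andP[rho0 rhor] lam1 nu0 nu1 x1 x2 y1 y2 y'1 y'2 cxy sl2.
set V := supdist y y' => Vrho.
have r0 : 0 < r by apply: lt_le_trans rhor.
have D1 : 1 <= D%:R :> R by rewrite ler1n.
have V0 : 0 <= V by apply: supdist_ge0.
have rr0 : 0 < r * rho by rewrite mulr_gt0.
have K1 := @strip_const_ge1 D _ c00.
have K0 : 0 <= strip_const D c0 by lra.
have triv (c : R) : 1 <= c -> \sum_(i | (`|edist (pX i) y' - edist (pX i) y| <= 2 * (r * rho)) &&
      (\sum_(i' | `|slope (pX i') y - slope (pX i) y| <= r) nu i' <= lam * r)) nu i
   <= c.
  by move=> c1; apply: le_trans c1; apply: le_trans nu1; apply: ler_sum_subset.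
have [Vs|Vb] := leP V (r * rho).
  by rewrite divff ?gt_eqF// mulr1; apply: triv; rewrite mulr_ege1.
have V1 : 0 < V by apply: lt_trans Vb.
pose w := (4 * D%:R * (2 * (r * rho)) + V ^+ 2) / c0.
have wE : w * c0 <= (8 * D%:R + 1) * (r * rho).
  rewrite /w divfK ?gt_eqF//.
  have : V ^+ 2 <= r * rho by rewrite expr2 ler_pM// (le_trans Vrho).
  lra.
have wV : w / V <= (8 * D%:R + 1) / c0 * (r * rho / V).
  rewrite mulrA ler_wpM2r ?invr_ge0// mulrAC ler_pdivlMr//.
(* If [V < 4 * w], then [V ^ 2 <= r * V] is absorbed using [r <= c0 / 8]; so [V] is of order
   [r * rho], the claimed bound exceeds 1, and total mass 1 suffices. *)
have [w4|w4] := leP (4 * w) V; last first.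
  apply: triv; have h : V <= 64 * D%:R * (r * rho) / c0.
    have wE' : w * c0 <= 8 * D%:R * (r * rho) + r * V.
      rewrite /w divfK ?gt_eqF//.
      have : V ^+ 2 <= r * V by rewrite expr2 ler_wpM2r// (le_trans Vrho).
      lra.
    rewrite ler_pdivlMr//.
    have h1 : V * c0 <= 4 * (w * c0) by rewrite mulrA ler_wpM2r// ltW.
    have h2 : r * V <= c0 / 8 * V by rewrite ler_wpM2r.
    lra.
  have h3 : 1 <= strip_const D c0 * (r * rho / V).
    rewrite mulrA ler_pdivlMr// mul1r; apply: le_trans h _.
    rewrite mulrAC ler_wpM2r ?(ltW rr0)// /strip_const.
    rewrite -[leLHS]addr0 lerD// ler_wpM2r ?invr_ge0 ?(ltW c00)//; lra.
  by apply: le_trans h3 _; rewrite [leRHS]mulrAC ler_peMr// mulr_ge0// divr_ge0 ?(ltW rr0).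
have w0 : 0 <= w.
  rewrite /w divr_ge0 ?(ltW c00)// addr_ge0 ?exprn_ge0//.
  by rewrite !mulr_ge0// ltW.
have L0 : 0 <= 8 * w / V by rewrite divr_ge0// mulr_ge0.
have m0 : 0 <= lam * r by rewrite mulr_ge0// ?(ltW r0)//; lra.
have SL i j : `|edist (pX i) y' - edist (pX i) y| <= 2 * (r * rho) ->
    `|edist (pX j) y' - edist (pX j) y| <= 2 * (r * rho) ->
    `|slope (pX i) y - slope (pX j) y| <= 8 * w / V.
  move=> hi hj; apply: (@slope_sub_le R w V (y.1 - y'.1) (y.2 - y'.2)) => //.

    by apply: (@strip_of_edist R D).
  by apply: (@strip_of_edist R D).
apply: (le_trans (@tame_mass_le R X nu (fun i => slope (pX i) y)
  (fun i => `|edist (pX i) y' - edist (pX i) y| <= 2 * (r * rho)) r _ _ r0 m0 L0 nu0 SL)).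
have -> : (2 * (8 * w / V) / r + 1) * (lam * r) = lam * (16 * (w / V) + r).
  by field; rewrite !gt_eqF.
have -> : strip_const D c0 * lam * (r * rho / V) =
  lam * (16 * ((8 * D%:R + 1) / c0 * (r * rho / V)) + r * rho / V).
  by rewrite /strip_const; field; rewrite !gt_eqF.
rewrite ler_wpM2l//; first lra.
rewrite lerD ?ler_wpM2l// -[leLHS]mulr1 -mulrA ler_wpM2l ?(ltW r0)//.
by rewrite ler_pdivlMr// mul1r.
Qed.

(* Kaufman's argument: the mass of pairs seeing an abnormally large part of a cell
   inside one thin annulus. *)
Lemma bad_mass_le (D : nat) (c0 r rho lam C s a : R) (X Y : finType) (nu : X -> R)
    (mu : Y -> R) (pX : X -> R * R) (pY : Y -> R * R) (T : eqType) (cell : Y -> T) (rmin : R) :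
  (0 < D)%N -> 0 < c0 -> r <= c0 / 8 -> 0 < rho <= r -> r <= 1 -> 1 <= lam -> 0 <= C -> 1 < s -> 0 < a ->
  (forall i, 0 <= nu i) -> \sum_i nu i <= 1 -> (forall j, 0 < mu j) ->
  (forall i, `|(pX i).1| <= D%:R) -> (forall i, `|(pX i).2| <= D%:R) ->
  (forall j, `|(pY j).1| <= D%:R) -> (forall j, `|(pY j).2| <= D%:R) ->
  (forall i j, c0 <= `|(pX i).1 - (pY j).1|) -> (forall i j, `|slope (pX i) (pY j)| <= 2) ->
  frostman mu pY C s rmin -> rmin <= r * rho ->
  (forall j j', cell j = cell j' -> supdist (pY j) (pY j') <= rho) ->
  \sum_i \sum_(j | (\sum_(i' | `|slope (pX i') (pY j) - slope (pX i) (pY j)| <= r) nu i' <= lam * r) &&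
     (a * (\sum_(j' | cell j' == cell j) mu j') <
      \sum_(j' | (cell j' == cell j) && (`|edist (pX i) (pY j') - edist (pX i) (pY j)| <= 2 * (r * rho))) mu j'))
    nu i * mu j
  <= (image_count cell)%:R * (strip_const D c0 * lam * (C * layer_const s) * (r / a) * rho `^ s).
Proof.
move=> D0 c00 rc0 /andP[rho0 rhor] r1 lam1 C0 s1 a0 nu0 nu1 mu0 X1 X2 Y1 Y2 cXY sl2 frY rmr cellP.
have r0 : 0 < r by apply: lt_le_trans rhor.
have rr0 : 0 < r * rho by rewrite mulr_gt0.
have [Mq MqE] : exists Mq : Y -> R, forall j, Mq j = \sum_(j' | cell j' == cell j) mu j'.
  by exists (fun j => \sum_(j' | cell j' == cell j) mu j').
have Mq0 j : 0 < Mq j.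
  by rewrite MqE (bigD1 j)//= ltr_wpDr// sumr_ge0// => k _; exact: ltW.
pose tame i j := \sum_(i' | `|slope (pX i') (pY j) - slope (pX i) (pY j)| <= r) nu i' <= lam * r.
pose near i j j' := `|edist (pX i) (pY j') - edist (pX i) (pY j)| <= 2 * (r * rho).
set B := strip_const D c0 * lam * (C * layer_const s) * (r / a) * rho `^ s.
have K1 := @strip_const_ge1 D _ c00.
have B0 : 0 <= B.
  rewrite /B; apply: mulr_ge0; last exact: powR_ge0.
  apply: mulr_ge0; last by rewrite divr_ge0 ?(ltW r0) ?(ltW a0).
  by apply: mulr_ge0; apply: mulr_ge0 => //; [lra|lra|rewrite ltW// layer_const_gt0].
(* Markov's inequality replaces the indicator of a bad cell by a ratio of masses. *)
apply: (@le_trans _ _ (\sum_i \sum_(j | tame i j) nu i * mu j *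
    ((a * Mq j)^-1 * \sum_(j' | (cell j' == cell j) && near i j j') mu j'))).
  apply: ler_sum => i _; rewrite big_mkcond [leRHS]big_mkcond; apply: ler_sum => j _.
  rewrite -/(tame i j) -MqE; case: (tame i j) => //=.
  case: ifP => bad.
    rewrite ler_peMr ?mulr_ge0 ?(ltW (mu0 _))// ler_pdivlMl ?mulr_gt0// mulr1.
    exact: ltW.
  apply: mulr_ge0; first by rewrite mulr_ge0// ltW.
  apply: mulr_ge0; first by rewrite invr_ge0 mulr_ge0// ltW.
  by apply: sumr_ge0 => k _; exact: ltW.
(* With the sums exchanged, the inner sum over [i] is a strip mass for fixed [j] and [j'], and
   [mu j / Mq j] will sum to the number of cells. *)
apply: (@le_trans _ _ (\sum_j (mu j / Mq j) * (a^-1 * \sum_(j' | cell j' == cell j) mu j' *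
    \sum_(i | near i j j' && tame i j) nu i))).
  rewrite (exchange_big_dep xpredT)//=; apply: ler_sum => j _.
  under eq_bigr do rewrite mulr_sumr mulr_sumr big_mkcondr /=.
  rewrite (exchange_big_dep (fun j' => cell j' == cell j))//=.
  rewrite !mulr_sumr; apply: ler_sum => j' /eqP cc.
  rewrite !mulr_sumr big_mkcond [leRHS]big_mkcond; apply: ler_sum => i _.
  rewrite andbC cc eqxx /=; case: (tame i j) => //=; case: (near i j j') => //=.
  by rewrite le_eqVlt; apply/orP; left; apply/eqP; field; rewrite !gt_eqF.
apply: (@le_trans _ _ (\sum_j (mu j / Mq j) * B)); last first.
  rewrite -mulr_suml ler_wpM2r//; under eq_bigr do rewrite MqE.
  by apply: sum_div_fiber_le => j; exact: ltW.
apply: ler_sum => j _; rewrite ler_wpM2l ?divr_ge0 ?(ltW (mu0 _)) ?(ltW (Mq0 _))//.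
apply: (@le_trans _ _ (a^-1 * \sum_(j' | cell j' == cell j)
   (strip_const D c0 * lam * (r * rho)) * (mu j' / Num.max (supdist (pY j) (pY j')) (r * rho)))).
  rewrite ler_wpM2l ?invr_ge0 ?(ltW a0)//; apply: ler_sum => j' /eqP cc.
  have := @strip_mass_le D c0 r rho lam X nu pX (pY j) (pY j') D0 c00 rc0.
  rewrite rho0 rhor => /(_ isT lam1 nu0 nu1 X1 X2 (Y1 _) (Y2 _) (Y1 _) (Y2 _)).
  move=> /(_ (fun i => cXY i j) (fun i => sl2 i j) (cellP _ _ (esym cc))) h.
  apply: (le_trans (ler_wpM2l (ltW (mu0 _)) h)).
  by rewrite le_eqVlt; apply/orP; left; apply/eqP; ring.
rewrite -mulr_sumr.
apply: (@le_trans _ _ (a^-1 * (strip_const D c0 * lam * (r * rho) * (C * layer_const s * rho `^ (s - 1))))).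
  rewrite ler_wpM2l ?invr_ge0 ?(ltW a0)// ler_wpM2l//.
    by rewrite mulr_ge0 ?(ltW rr0)// mulr_ge0//; lra.
  apply: (@le_trans _ _ (\sum_(j' | supdist (pY j) (pY j') <= rho) mu j' / Num.max (supdist (pY j) (pY j')) (r * rho))).
    apply: ler_sum_subset => [j' _ _|j' /eqP cc].
      by rewrite divr_ge0 ?(ltW (mu0 _))// le_max supdist_ge0.
    exact: cellP.
  apply: sum_over_max_le => //.
  - by move=> j'; exact: ltW.
  - move=> rho' /andP[h1 h2]; apply: frY; rewrite (le_trans rmr)//= (le_trans h2)//.
    exact: le_trans rhor r1.
  - by rewrite ler_piMl// ltW.
rewrite /B -(@mulr_powRB1 _ rho s) ?(ltW rho0)//; last lra.
by rewrite le_eqVlt; apply/orP; left; apply/eqP; field; rewrite gt_eqF.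
Qed.

End StripMass.

(** * From scale-wise spreading to box counting *)

Section Chain.
Variable R : realType.
Variables (Y : finType) (mu d : Y -> R).
Hypothesis mu0 : forall y, 0 < mu y.

(** With [d] the distance to the pin, the mass of an annulus of half-width [rho]. *)
Definition near_mass (rho : R) (y : Y) : R := \sum_(y' | `|d y' - d y| <= rho) mu y'.

(** The factor 2 allows two points that are both within [rho] of a third one to be compared
    directly. *)
Definition spread (T : eqType) (cell : Y -> T) (a rho : R) (y : Y) : bool :=
  \sum_(y' | (cell y' == cell y) && (`|d y' - d y| <= 2 * rho)) mu y'
    <= a * \sum_(y' | cell y' == cell y) mu y'.

Lemma near_mass_gt0 rho y : 0 <= rho -> 0 < near_mass rho y.
Proof.
move=> rho0; rewrite /near_mass (bigD1 y)/=; last by rewrite subrr normr0.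
by rewrite ltr_wpDr// sumr_ge0// => k _; exact: ltW.
Qed.

(** Expanding the thin annulus over its points [y'] and exchanging sums, it suffices that the spread
    points in the thin annulus of [y'] have mass at most [a] times a thick annulus around [y']. This
    is checked cell by cell: a cell that meets the thin annulus lies inside the thick one, as
    [r <= 1 / 4]. *)
Lemma spread_ratio_le (T : eqType) (cell : Y -> T) (a r rho : R) :
  0 <= a -> 0 < r <= 1 / 4 -> 0 < rho ->
  (forall y y', cell y = cell y' -> `|d y - d y'| <= rho / 2) ->
  \sum_(y | spread cell a (r * rho) y) mu y * (near_mass (r * rho) y / near_mass rho y)
   <= a * \sum_y mu y.
Proof.
move=> a0 /andP[r0 r4] rho0 cellP.
have rr0 : 0 < r * rho by rewrite mulr_gt0.
have rr4 : r * rho <= rho / 4 by rewrite mulrC ler_wpM2l ?(ltW rho0)//; lra.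
have [Mq MqE] : exists Mq : Y -> R, forall j, Mq j = \sum_(j' | cell j' == cell j) mu j'.
  by exists (fun j => \sum_(j' | cell j' == cell j) mu j').
have Mq0 j : 0 < Mq j.
  by rewrite MqE (bigD1 j)//= ltr_wpDr// sumr_ge0// => k _; exact: ltW.
have m0 y : 0 < near_mass rho y by apply: near_mass_gt0; exact: ltW.
apply: (@le_trans _ _ (\sum_y' mu y' *
   \sum_(y | spread cell a (r * rho) y && (`|d y' - d y| <= r * rho)) mu y / near_mass rho y)).
  under eq_bigr do rewrite /(near_mass (r * rho)) mulr_suml mulr_sumr.
  rewrite (exchange_big_dep xpredT)//=; apply: ler_sum => y' _.
  rewrite mulr_sumr; apply: ler_sum => y _.
  by rewrite le_eqVlt; apply/orP; left; apply/eqP; ring.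
rewrite mulr_sumr; apply: ler_sum => y' _; rewrite mulrC ler_wpM2r ?(ltW (mu0 _))//.
(* This annulus lies in the one of half-width [rho] around each [y] within [r * rho] of [y'], so it
   gives one denominator for all these [y]. *)
set A := \sum_(y'' | `|d y'' - d y'| <= rho - r * rho) mu y''.
have A0 : 0 < A.
  rewrite /A (bigD1 y')/=; last by rewrite subrr normr0; lra.
  by rewrite ltr_wpDr// sumr_ge0// => k _; exact: ltW.
pose P y := spread cell a (r * rho) y && (`|d y' - d y| <= r * rho).
apply: (@le_trans _ _ (\sum_(y | P y) mu y / A)).
  apply: ler_sum => y /andP[_ yy]; rewrite ler_wpM2l ?(ltW (mu0 _))//.
  rewrite lef_pV2 ?posrE//; apply: ler_sum_subset => [k _ _|k kA]; first exact: ltW.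
  have -> : d k - d y = (d k - d y') + (d y' - d y) by ring.
  apply: le_trans (ler_normD _ _) _; lra.
rewrite -mulr_suml ler_pdivrMr//.
(* The mass of each [y] is redistributed over its whole cell, in proportion to [mu]. *)
apply: (@le_trans _ _ (\sum_y'' mu y'' * \sum_(y | P y && (cell y'' == cell y)) mu y / Mq y)).
  under [leRHS]eq_bigr do rewrite mulr_sumr.
  rewrite (exchange_big_dep P)/=; last by move=> ? ? _ /andP[].
  apply: ler_sum => y Py.
  rewrite [leRHS](eq_bigr (fun y'' => (mu y / Mq y) * mu y'')); last by move=> *; ring.
  rewrite -mulr_sumr (eq_bigl (fun y'' => cell y'' == cell y)); last by move=> k; rewrite Py.
  by rewrite -MqE divfK ?gt_eqF.
rewrite /A mulr_sumr [leRHS]big_mkcond; apply: ler_sum => y'' _.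
case: (pickP (fun y => P y && (cell y'' == cell y))) => [y0 /andP[Py0 /eqP c0]|P0]; last first.
  rewrite (eq_bigl pred0)// big_pred0// mulr0; case: ifP => // _.
  by rewrite mulr_ge0// ltW.
have -> : (`|d y'' - d y'| <= rho - r * rho) = true.
  have -> : d y'' - d y' = (d y'' - d y0) + (d y0 - d y') by ring.
  apply: le_trans (ler_normD _ _) _; rewrite [`|d y0 - d y'|]distrC.
  by have := cellP _ _ c0; case/andP: Py0 => _; lra.
rewrite mulrC ler_wpM2r ?(ltW (mu0 _))//.
apply: (@le_trans _ _ (\sum_(y | (cell y == cell y0) && (`|d y - d y0| <= 2 * (r * rho))) mu y / Mq y0)).
  rewrite (eq_bigr (fun y => mu y / Mq y0)); last first.
    by move=> y /andP[_ /eqP cy]; rewrite !MqE; congr (_ / _); apply: eq_bigl => k; rewrite -cy c0.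
  apply: ler_sum_subset => [k _ _|y /andP[/andP[_ yy'] /eqP cy]].
    by rewrite divr_ge0// ltW.
  rewrite -cy c0 eqxx /=; have -> : d y - d y0 = (d y' - d y0) - (d y' - d y) by ring.
  apply: le_trans (ler_normB _ _) _; case/andP: Py0 => _; lra.
rewrite -mulr_suml ler_pdivrMr// MqE; by case/andP: Py0.
Qed.

Lemma ln_le_subr1 (x : R) : 0 < x -> ln x <= x - 1.
Proof. by move=> x0; have := expR_ge1Dx (ln x); rewrite lnK ?posrE//; lra. Qed.

(** An entropy bound: the mean of [- ln] of the finest annulus mass is at most the logarithm of the
    number of occupied intervals, and it telescopes over the scales. *)
Lemma ln_image_count_ge (T : eqType) (cell : nat -> Y -> T) (a r : R) (K : nat) :
  0 < a <= 1 -> 0 < r <= 1 / 4 -> \sum_y mu y = 1 ->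
  (forall k y y', (k < K)%N -> cell k y = cell k y' -> `|d y - d y'| <= r ^+ k.+1 / 2) ->
  - ln a * (\sum_(k < K) \sum_(y | spread (cell k) a (r ^+ k.+2) y) mu y) - K%:R
    <= ln (image_count (fun y => Num.floor (d y / r ^+ K.+1)))%:R.
Proof.
move=> /andP[a0 a1] /andP[r0 r4] mu1 cellP.
pose m k y := near_mass (r ^+ k.+1) y.
have rk k : 0 < r ^+ k by rewrite exprn_gt0.
have m0 k y : 0 < m k y by apply: near_mass_gt0; exact: ltW.
have m1 k y : m k y <= 1.
  by rewrite -mu1; apply: ler_sum_subset => // i _ _; exact: ltW.
have mS k y : m k.+1 y <= m k y.
  apply: ler_sum_subset => [i _ _|i]; first exact: ltW.
  move=> /le_trans; apply; rewrite [r ^+ k.+2]exprS ler_piMl ?(ltW (rk _))//; lra.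
set N := image_count _.
have N0 : 0 < N%:R :> R.
  have [y _] : exists2 y : Y, true & true.
    case: (pickP (@predT Y)) => [y _|p0]; first by exists y.
    by move: mu1; rewrite (eq_bigl pred0)// big_pred0// => /eqP; rewrite eq_sym oner_eq0.
  rewrite ltr0n /N /image_count; set s := undup _.
  have : Num.floor (d y / r ^+ K.+1) \in s.
    by rewrite mem_undup; apply: (map_f (fun y => Num.floor (d y / r ^+ K.+1))); rewrite mem_enum.
  by case: s.
(* Jensen's inequality, written with the tangent of [ln]; the annulus contains the fibre of the
   floor, so [sum_div_fiber_le] applies. *)
have step1 : \sum_y mu y * (- ln (m K y)) <= ln N%:R.
  have h y : - ln (m K y) <= ln N%:R + ((m K y)^-1 / N%:R - 1).
    have := @ln_le_subr1 ((m K y)^-1 / N%:R); rewrite divr_gt0 ?invr_gt0// => /(_ isT).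
    by rewrite ln_div ?posrE ?invr_gt0// lnV ?posrE//; lra.
  apply: (@le_trans _ _ (\sum_y mu y * (ln N%:R + ((m K y)^-1 / N%:R - 1)))).
    by apply: ler_sum => y _; rewrite ler_wpM2l// ltW.
  have -> : \sum_y mu y * (ln N%:R + ((m K y)^-1 / N%:R - 1)) =
     (\sum_y mu y) * (ln N%:R - 1) + (\sum_y mu y / m K y) / N%:R.
    by rewrite !mulr_suml -big_split; apply: eq_bigr => y _ /=; ring.
  rewrite mu1 mul1r.
  suff : (\sum_y mu y / m K y) / N%:R <= 1 by lra.
  rewrite ler_pdivrMr// mul1r.
  apply: le_trans (@sum_div_fiber_le R Y _ (fun y => Num.floor (d y / r ^+ K.+1)) mu _); last by move=> y; exact: ltW.
  apply: ler_sum => y _; rewrite ler_wpM2l ?(ltW (mu0 _))// lef_pV2 ?posrE//; last first.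
    by rewrite (bigD1 y)//= ltr_wpDr// sumr_ge0// => k _; exact: ltW.
  apply: ler_sum_subset => [i _ _|i /eqP e]; first exact: ltW.
  have := norm_sub_floor (d i / r ^+ K.+1) (d y / r ^+ K.+1).
  rewrite e subrr absz0 add0r -mulrBl normrM normfV (gtr0_norm (rk _)).
  by rewrite ler_pdivrMr// mul1r.
apply: le_trans step1.
pose G k y := spread (cell k) a (r ^+ k.+2) y.
(* At the scales that are not spread, monotonicity of the masses alone gives a nonnegative
   increment. *)
have step2 y : \sum_(k < K) (if G k y then - ln a + 1 - (m k.+1 y / m k y) / a else 0) <= - ln (m K y).
  have -> : - ln (m K y) = - ln (m 0%N y) + \sum_(k < K) (- ln (m k.+1 y) - (- ln (m k y))).
    rewrite -(big_mkord xpredT (fun k => - ln (m k.+1 y) - (- ln (m k y)))).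
    by rewrite telescope_sumr//; ring.
  rewrite -[leLHS]add0r lerD//.
    have := @ln_le_subr1 (m 0%N y) (m0 _ _); have := m1 0%N y; lra.
  apply: ler_sum => k _; case: ifP => _; last first.
    by rewrite opprK addrC subr_ge0 ler_ln ?posrE.
  have := @ln_le_subr1 ((m k.+1 y / m k y) / a).
  rewrite !divr_gt0// => /(_ isT); rewrite !ln_div ?posrE ?divr_gt0//; lra.
apply: (@le_trans _ _ (\sum_y mu y * \sum_(k < K) (if G k y then - ln a + 1 - (m k.+1 y / m k y) / a else 0))); last first.
  by apply: ler_sum => y _; rewrite ler_wpM2l// ltW.
under [leRHS]eq_bigr do rewrite mulr_sumr.
rewrite [leRHS]exchange_big /=.
have -> : - ln a * (\sum_(k < K) \sum_(y | spread (cell k) a (r ^+ k.+2) y) mu y) - K%:R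
  = \sum_(k < K) (- ln a * (\sum_(y | G k y) mu y) - 1).
  rewrite mulr_sumr big_split /=; congr (_ + _).
  by rewrite sumr_const card_ord mulNrn.
apply: ler_sum => k _.
have h := @spread_ratio_le T (cell k) a r (r ^+ k.+1).
rewrite (ltW a0) r0 r4 rk -exprS in h.
have {h} := h isT isT isT (fun y y' => cellP k y y' (ltn_ord k)).
rewrite mu1 mulr1 => h.
apply: (@le_trans _ _ (\sum_(y | G k y) mu y * (- ln a + 1 - (m k.+1 y / m k y) / a))); last first.
  rewrite big_mkcond; apply: ler_sum => y _.
  by rewrite /=; case: ifP; rewrite ?mulr0.
have -> : \sum_(y | G k y) mu y * (- ln a + 1 - (m k.+1 y / m k y) / a) =
   (- ln a + 1) * \sum_(y | G k y) mu y - (\sum_(y | G k y) mu y * (m k.+1 y / m k y)) / a.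
  rewrite mulr_sumr mulr_suml -sumrB; apply: eq_bigr => y _; ring.
(* The tangent correction costs at most 1 per scale, whence the loss [K] in the conclusion. *)
have h2 : (\sum_(y | G k y) mu y * (m k.+1 y / m k y)) / a <= 1 by rewrite ler_pdivrMr// mul1r.
have h3 : 0 <= \sum_(y | G k y) mu y by apply: sumr_ge0 => y _; exact: ltW.
lra.
Qed.

End Chain.

(** * Many pinned distances for some point of the finite model *)

Section Core.
Variable R : realType.
Implicit Types x y p : R * R.

Lemma edist_triangle x y z : edist x z <= edist x y + edist y z.
Proof.
rewrite -(@ler_pXn2r _ 2) ?nnegrE ?addr_ge0 ?edist_ge0//.
rewrite [leRHS]sqrrD !sqr_edist.
set a := x.1 - y.1; set b := x.2 - y.2; set c := y.1 - z.1; set d := y.2 - z.2.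
have -> : x.1 - z.1 = a + c by rewrite /a /c; ring.
have -> : x.2 - z.2 = b + d by rewrite /b /d; ring.
have : a * c + b * d <= edist x y * edist y z.
  apply: le_trans (ler_norm _) _.
  rewrite -(@ler_pXn2r _ 2) ?nnegrE ?mulr_ge0 ?edist_ge0// exprMn !sqr_edist -/a -/b -/c -/d.
  rewrite real_normK ?num_real//.
  have := sqr_ge0 (a * d - b * c); nra.
nra.
Qed.

Lemma edistC x y : edist x y = edist y x.
Proof. by rewrite /edist; congr (Num.sqrt (_ + _)); ring. Qed.

Lemma edist_sub_le x y z : `|edist x y - edist x z| <= edist y z.
Proof.
have := edist_triangle x y z; have := edist_triangle x z y.
by rewrite (edistC z y) => h1 h2; rewrite ler_norml; apply/andP; split; lra.
Qed.

Definition grid_index (g : R) p : int * int := (Num.floor (p.1 / g), Num.floor (p.2 / g)).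

Lemma grid_index_near (g : R) x y : 0 < g -> grid_index g x = grid_index g y ->
  `|x.1 - y.1| <= g /\ `|x.2 - y.2| <= g.
Proof.
move=> g0 [e1 e2].
have h (u v : R) : Num.floor (u / g) = Num.floor (v / g) -> `|u - v| <= g.
  move=> e; have := norm_sub_floor (u / g) (v / g).
  rewrite e subrr absz0 add0r -mulrBl normrM normfV (gtr0_norm g0).
  by rewrite ler_pdivrMr// mul1r.
by split; apply: h.
Qed.

Lemma exists_ge_average (X : finType) (nu f : X -> R) :
  (forall i, 0 <= nu i) -> \sum_i nu i = 1 -> exists i, \sum_i nu i * f i <= f i.
Proof.
move=> nu0 nu1.
have [i0 _] : exists2 i : X, true & true.
  case: (pickP (@predT X)) => [y _|p0]; first by exists y.
  by move: nu1; rewrite (eq_bigl pred0)// big_pred0// => /eqP; rewrite eq_sym oner_eq0.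
case: (@Order.TotalTheory.arg_maxP _ R X i0 xpredT f isT) => i _ imax.
exists i; rewrite -[leRHS]mul1r -nu1 mulr_suml; apply: ler_sum => j _.
by rewrite ler_wpM2l//; exact: imax.
Qed.

Lemma frostman_weaken (I : finType) (w : I -> R) (p : I -> R * R) (C s r r' : R) :
  r <= r' -> frostman w p C s r -> frostman w p C s r'.
Proof.
move=> rr fr i rho /andP[h1 h2]; apply: fr; rewrite h2 andbT; exact: le_trans h1.
Qed.

Theorem pinned_distance_count (D : nat) (C C2 c0 s t e : R) :
  (0 < D)%N -> 0 < C -> 0 < C2 -> 0 < c0 -> 1 < s -> 1 < t -> 0 < e < 1 ->
  exists2 r : R, 0 < r <= 1 / 4 &
  forall (X : finType) (nu : X -> R) (pX : X -> R * R)
         (K : nat) (Y : finType) (mu : Y -> R) (pY : Y -> R * R),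
  (forall i, 0 <= nu i) -> \sum_i nu i = 1 -> (forall j, 0 < mu j) -> \sum_j mu j = 1 ->
  (forall i, `|(pX i).1| <= D%:R) -> (forall i, `|(pX i).2| <= D%:R) ->
  (forall j, `|(pY j).1| <= D%:R) -> (forall j, `|(pY j).2| <= D%:R) ->
  (forall i j, c0 <= `|(pX i).1 - (pY j).1|) -> (forall i j, `|slope (pX i) (pY j)| <= 2) ->
  frostman nu pX C t r -> frostman mu pY C s (r ^+ K.+1) ->
  (forall k, (k < K)%N ->
    (image_count (fun j => grid_index (r ^+ k.+1 / 4) (pY j)))%:R <= C2 * (r ^+ k.+1) `^ (- s)) ->
  exists i, (1 - e) * K%:R * - ln r <=
    ln (image_count (fun j => Num.floor (edist (pX i) (pY j) / r ^+ K.+1)))%:R.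
Proof.
move=> D0 C0 C20 c00 s1 t1 /andP[e0 e1].
(* Four losses of [ep]: rich pairs, bad cells, the exponent of [a], and the [K] of
   [ln_image_count_ge]. *)
pose ep := e / 4.
have ep0 : 0 < ep by rewrite divr_gt0.
have [lam0 lam00 [r0 r00 rich]] := @rich_mass_small R D C s t ep D0 C0 s1 t1 ep0.
pose lam := Num.max lam0 1.
have lam1 : 1 <= lam by rewrite le_max lexx orbT.
have lam0l : lam0 <= lam by rewrite le_max lexx.
have Ls := layer_const_gt0 s1.
have sc := @strip_const_ge1 R D _ c00.
pose K' := strip_const D c0 * lam * (C * layer_const s) * C2.
have K'0 : 0 < K'.
  apply: mulr_gt0 => //; apply: mulr_gt0; last exact: mulr_gt0.
  by apply: mulr_gt0; [exact: lt_le_trans sc | exact: lt_le_trans lam1].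
have [||rs /andP[rs0 rs1] rsE] := @exists_powR_le R (ep / K') ep => //; first by rewrite divr_gt0.
(* In turn: for [rich_mass_small], for [K' * r ^ ep <= ep], for the annuli, for the strips, and for
   [1 <= ep * - ln r]. *)
pose r := Num.min (Num.min r0 rs) (Num.min (Num.min (1 / 4) (c0 / 8)) (expR (- ep^-1))).
have r_gt0 : 0 < r.
  by rewrite !lt_min r00 rs0 expR_gt0 !divr_gt0.
have [rr0 rrs r4 rc0 rexp] : [/\ r <= r0, r <= rs, r <= 1 / 4, r <= c0 / 8 & r <= expR (- ep^-1)].
  by split; rewrite /r !ge_min lexx ?orbT.
clearbody r.
exists r; first by rewrite r_gt0 r4.
move=> X nu pX K Y mu pY nu0 nu1 mu0 mu1 X1 X2 Y1 Y2 cXY sl2 frX frY count.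
have r1 : r <= 1 by lra.
have mu0' j : 0 <= mu j by exact: ltW.
pose a := r `^ (1 - ep).
have a0 : 0 < a by rewrite powR_gt0.
have lnr : ep^-1 <= - ln r.
  by rewrite lerNr -(@expRK R (- ep^-1)) ler_ln ?posrE ?expR_gt0.
have lna : - ln a = (1 - ep) * - ln r by rewrite /a ln_powR mulrN.
have ep1 : ep < 1 / 4 by rewrite ltr_pdivrMr//; lra.
have a1 : a <= 1.
  have : 0 <= - ln a.
    rewrite lna mulr_ge0//; first lra.
    by apply: le_trans lnr; rewrite invr_ge0 ltW.
  by move=> h; rewrite -(@lnK R a) ?posrE// -expR0 ler_expR; lra.
have ra : K' * (r / a) <= ep.
  have -> : r / a = r `^ ep.
    rewrite /a -{1}(@powRr1 R r) ?(ltW r_gt0)// -powRB.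
      by congr (_ `^ _); ring.
    by rewrite (gt_eqF r_gt0) implybT.
  rewrite mulrC -ler_pdivlMr//; apply: le_trans rsE.
  by rewrite ge0_ler_powR ?nnegrE ?(ltW ep0) ?(ltW r_gt0) ?(ltW rs0).
(* A quarter of the scale makes the Euclidean diameter of a cell at most [r ^+ k.+1 / 2]. *)
pose cell k j := grid_index (r ^+ k.+1 / 4) (pY j).
have rk k : 0 < r ^+ k by rewrite exprn_gt0.
have cellP k j j' : cell k j = cell k j' ->
    supdist (pY j) (pY j') <= r ^+ k.+1 /\ edist (pY j) (pY j') <= r ^+ k.+1 / 2.
  move=> /(grid_index_near (divr_gt0 (rk _) (ltr0n _ 4))) [h1 h2]; split.
    by rewrite ge_max; have := rk k.+1 => h3; apply/andP; split; lra.
  by apply: le_trans (edist_le_sum _ _) _; lra.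
pose sp i k j := spread mu (fun j => edist (pX i) (pY j)) (cell k) a (r ^+ k.+2) j.
have tail (P : pred Y) : \sum_(j | P j) mu j = 1 - \sum_(j | ~~ P j) mu j.
  by move: mu1; rewrite (bigID P)/= => <-; rewrite addrK.
have bad k : (k < K)%N -> \sum_i nu i * \sum_(j | ~~ sp i k j) mu j <= ep + ep.
  move=> kK.
  pose tame i j := \sum_(i' | `|slope (pX i') (pY j) - slope (pX i) (pY j)| <= r) nu i' <= lam * r.
  apply: (@le_trans _ _ (\sum_i \sum_(j | ~~ tame i j) nu i * mu j +
     \sum_i \sum_(j | tame i j && ~~ sp i k j) nu i * mu j)).
    rewrite -big_split /=; apply: ler_sum => i _; rewrite mulr_sumr.
    rewrite big_mkcond [X in _ <= X + _]big_mkcond [X in _ <= _ + X]big_mkcond -big_split.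
    apply: ler_sum => j _ /=; move: (nu i * mu j) (mulr_ge0 (nu0 i) (mu0' j)) => z z0.
    by case: (sp i k j); case: (tame i j); rewrite /= ?addr0 ?add0r.
  apply: lerD.
    have r01 : 0 < r <= r0 by rewrite r_gt0 rr0.
    have rkK : r ^+ K.+1 <= r by rewrite exprS ler_piMr ?exprn_ile1// ltW.
    have := @rich r r01 r1 X Y nu mu pX pY nu0 _ mu0' _ X1 Y1 _ sl2 frX (frostman_weaken rkK frY).
    rewrite nu1 mu1 lexx => /(_ isT isT) h.
    apply: le_trans (h _); last by move=> i j; rewrite -subr_eq0 -normr_gt0 (lt_le_trans c00).
    apply: ler_sum => i _; apply: ler_sum_subset => [j _ _|j]; first by rewrite mulr_ge0.
    by rewrite /tame -ltNge; apply: le_lt_trans; rewrite ler_wpM2r// ltW.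
  have rho1 : 0 < r ^+ k.+1 <= r by rewrite rk exprS ler_piMr ?exprn_ile1// ltW.
  have rmin : r ^+ K.+1 <= r * r ^+ k.+1.
    by rewrite -exprS ler_wiXn2l ?(ltW r_gt0).
  have := @bad_mass_le R D c0 r (r ^+ k.+1) lam C s a X Y nu mu pX pY _ (cell k) (r ^+ K.+1)
    D0 c00 rc0 rho1 r1 lam1 (ltW C0) s1 a0 nu0 _ mu0 X1 X2 Y1 Y2 cXY sl2 frY rmin _.
  rewrite nu1 lexx => /(_ isT (fun j j' e => (cellP k j j' e).1)) h.
  apply: (@le_trans _ _ (K' * (r / a))) => //.
  apply: (@le_trans _ _ ((image_count (cell k))%:R * (strip_const D c0 * lam * (C * layer_const s) * (r / a) * (r ^+ k.+1) `^ s))).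
    apply: le_trans h; apply: ler_sum => i _; rewrite le_eqVlt; apply/orP; left; apply/eqP.
    by apply: eq_bigl => j; rewrite /sp /spread -ltNge -exprS.
  have B0 : 0 <= strip_const D c0 * lam * (C * layer_const s) * (r / a) * (r ^+ k.+1) `^ s.
    apply: mulr_ge0; last exact: powR_ge0.
    apply: mulr_ge0; last by rewrite divr_ge0 ?(ltW r_gt0) ?(ltW a0).
    by apply: mulr_ge0; [apply: mulr_ge0; [exact: le_trans sc|exact: le_trans lam1] | rewrite mulr_ge0 ?(ltW C0) ?(ltW Ls)].
  apply: le_trans (ler_wpM2r B0 (count k kK)) _.
  rewrite powRN /K' le_eqVlt; apply/orP; left; apply/eqP.
  by field; rewrite (gt_eqF a0) gt_eqF// powR_gt0.
have avg : (1 - 2 * ep) * K%:R <= \sum_i nu i * (\sum_(k < K) \sum_(j | sp i k j) mu j).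
  rewrite (eq_bigr (fun i => \sum_(k < K) (nu i - nu i * \sum_(j | ~~ sp i k j) mu j))); last first.
    by move=> i _; rewrite mulr_sumr; apply: eq_bigr => k _; rewrite tail mulrBr mulr1.
  rewrite exchange_big /=; apply: (@le_trans _ _ (\sum_(k < K) (1 - 2 * ep))).
    by rewrite sumr_const card_ord mulr_natr.
  by apply: ler_sum => k _; rewrite sumrB nu1; have := bad k (ltn_ord k); lra.
have [i hi] := exists_ge_average (fun i => \sum_(k < K) \sum_(j | sp i k j) mu j) nu0 nu1.
exists i.
have ar : 0 < a <= 1 by rewrite a0 a1.
have rr : 0 < r <= 1 / 4 by rewrite r_gt0 r4.
have cc k j j' : (k < K)%N -> cell k j = cell k j' ->
    `|edist (pX i) (pY j) - edist (pX i) (pY j')| <= r ^+ k.+1 / 2.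
  by move=> _ /cellP[_ h]; exact: le_trans (edist_sub_le _ _ _) h.
apply: le_trans (@ln_image_count_ge R Y mu (fun j => edist (pX i) (pY j)) mu0 _ cell a r K ar rr mu1 cc).
have S0 := le_trans avg hi.
set S := \sum_(k < K) _ in S0 hi *; rewrite -/S in hi S0 *.
have L1 : 1 <= ep * - ln r by rewrite -ler_pdivrMl// mulr1.
have K0 : 0 <= K%:R :> R by [].
have L0 : 0 <= - ln r by apply: le_trans lnr; rewrite invr_ge0 ltW.
rewrite lna; set L := - ln r in L1 L0 *.
apply: (@le_trans _ _ ((1 - ep) * L * ((1 - 2 * ep) * K%:R) - K%:R)); last first.
  by rewrite lerD2r ler_wpM2l// mulr_ge0//; lra.
have -> : e = 4 * ep by rewrite /ep; field.
have KL : K%:R <= K%:R * (ep * L) by rewrite ler_peMr.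
have : 0 <= ep ^+ 2 * (K%:R * L) by rewrite mulr_ge0 ?sqr_ge0// mulr_ge0.
nra.
Qed.

End Core.

(** * Discrete Frostman measures *)

Section Greedy.
Variable R : realType.

Lemma exists_argmin n (f : nat -> R) : exists2 k, (k <= n)%N & forall j, (j <= n)%N -> f k <= f j.
Proof.
case: (@Order.TotalTheory.arg_minP _ R 'I_n.+1 ord0 xpredT (fun i => f i) isT) => i _ imin.
exists (val i); first by rewrite -ltnS ltn_ord.
by move=> j jn; exact: (imin (Ordinal (jn : (j < n.+1)%N)) isT).
Qed.

(* Points are loaded one at a time, each with the largest mass the capacities allow. *)
Lemma greedy_measure (X : finType) (T : eqType) (c : nat -> X -> T) (w : nat -> R) (n : nat) :
  (forall k, 0 <= w k) ->
  exists nu : X -> R, [/\ forall x, 0 <= nu x,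
    forall k x, (k <= n)%N -> \sum_(y | c k y == c k x) nu y <= w k &
    forall x, exists2 k, (k <= n)%N & \sum_(y | c k y == c k x) nu y = w k].
Proof.
move=> w0.
suff [nu [nu0 nuw nus]] : exists nu : X -> R, [/\ forall x, 0 <= nu x,
    forall k x, (k <= n)%N -> \sum_(y | c k y == c k x) nu y <= w k &
    forall x, x \in enum X -> exists2 k, (k <= n)%N & \sum_(y | c k y == c k x) nu y = w k].
  by exists nu; split => // x; apply: nus; rewrite mem_enum.
elim: (enum X) => [|x s [nu [nu0 nuw nus]]].
  exists (fun=> 0); split => // k x _; by rewrite big1.
have [k0 k0n kmin] := exists_argmin n (fun k => w k - \sum_(y | c k y == c k x) nu y).
set th := w k0 - _ in kmin.
have th0 : 0 <= th by rewrite subr_ge0 nuw.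
pose nu' y := nu y + (if y == x then th else 0).
have S k z : \sum_(y | c k y == c k z) nu' y =
    \sum_(y | c k y == c k z) nu y + (if c k x == c k z then th else 0).
  rewrite big_split /=; congr (_ + _); rewrite -big_mkcondr /=.
  case: ifP => xz; last first.
    by rewrite big1// => y /andP[/eqP h /eqP yx]; move: xz; rewrite -yx h eqxx.
  by rewrite (big_pred1 x)// => y /=; case: (eqVneq y x) => [->|]; rewrite ?andbF ?xz.
have nu'w k z : (k <= n)%N -> \sum_(y | c k y == c k z) nu' y <= w k.
  move=> kn; rewrite S; case: ifP => [/eqP <-|_]; last by rewrite addr0 nuw.
  by have := kmin k kn; lra.
exists nu'; split => //.
  by move=> y; rewrite /nu'; case: ifP => _; rewrite ?addr0// addr_ge0.
move=> z; rewrite inE => /orP[/eqP ->|zs].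
  by exists k0 => //; rewrite S eqxx /th; ring.
have [k kn e] := nus z zs; exists k => //; apply/eqP; rewrite eq_le nu'w//=.
by rewrite -e S lerDl; case: ifP.
Qed.

(** Every point takes its coarsest saturated cell. By nestedness distinct such cells are disjoint,
    so their capacities, which equal their masses, sum to at most the total; [rep] picks one point
    per cell. *)
Lemma greedy_cover (X : finType) (T : eqType) (c : nat -> X -> T) (w : nat -> R) (n : nat)
    (nu : X -> R) :
  (forall k x y, c k.+1 x = c k.+1 y -> c k x = c k y) ->
  (forall x, 0 <= nu x) ->
  (forall x, exists2 k, (k <= n)%N & \sum_(y | c k y == c k x) nu y = w k) ->
  exists (kk : X -> nat) (P : pred X),
    (forall x, exists x', [/\ P x', (kk x' <= n)%N & c (kk x') x = c (kk x') x']) /\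
    \sum_(x | P x) w (kk x) <= \sum_x nu x.
Proof.
move=> nest nu0 sat.
have nest' j k x y : (j <= k)%N -> c k x = c k y -> c j x = c j y.
  elim: k => [|k IH]; first by rewrite leqn0 => /eqP ->.
  by rewrite leq_eqVlt => /orP[/eqP ->//|jk] /nest; exact: IH.
pose sats x k := \sum_(y | c k y == c k x) nu y == w k.
have ex x : exists k, sats x k by have [k _ /eqP e] := sat x; exists k.
pose kk x := ex_minn (ex x).
have kks x : sats x (kk x) by rewrite /kk; case: ex_minnP.
have kkmin x k : sats x k -> (kk x <= k)%N by rewrite /kk; case: ex_minnP => m _; apply.
have satsE x y k : c k x = c k y -> sats x k = sats y k by rewrite /sats => ->.
have same x y : c (kk x) y = c (kk x) x -> kk y = kk x.
  move=> e; apply/eqP; rewrite eqn_leq.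
  have h : (kk y <= kk x)%N by apply: kkmin; rewrite (satsE _ x).
  by rewrite h kkmin// (satsE x y)//; apply: nest' (esym e).
pose ka x := (kk x, c (kk x) x).
have kaE x y : (ka y == ka x) = (c (kk x) y == c (kk x) x).
  apply/eqP/eqP => [[-> //]|e]; by rewrite /ka (same x y)// e.
pose rep x := odflt x [pick y | ka y == ka x].
have repE x : ka (rep x) = ka x by rewrite /rep; case: pickP => // y /eqP.
have rep_eq x y : ka x = ka y -> rep x = rep y.
  move=> e; rewrite /rep e; case: pickP => // /(_ y); by rewrite eqxx.
exists kk, (fun x => rep x == x); split.
  move=> x; exists (rep x); split.
  - by apply/eqP/rep_eq/repE.
  - by have [k kn /eqP e] := sat (rep x); apply: leq_trans kn; exact: kkmin.
  - have /eqP := repE x; rewrite kaE => /eqP h.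
    by have [e1 e2] := repE x; rewrite e2 e1.
rewrite [leRHS](partition_big rep (fun x => rep x == x))/=; last first.
  by move=> x _; apply/eqP/rep_eq/repE.
apply: ler_sum => x /eqP rx.
have /eqP <- := kks x; rewrite le_eqVlt; apply/orP; left; apply/eqP.
apply: eq_bigl => y; rewrite -kaE; apply/eqP/eqP => [/rep_eq ->//|<-].
by rewrite repE.
Qed.

End Greedy.

(** * Frostman measures from a lower bound on dyadic covers *)

Section DyadicFrostman.
Variable R : realType.
Implicit Types p : R * R.

Definition dyadic (k : nat) p : int * int := grid_index (2^-1 ^+ k) p.

Lemma floor_half (u v : R) : Num.floor u = Num.floor v -> Num.floor (u / 2) = Num.floor (v / 2).
Proof.
have h (x : R) : Num.floor (x / 2) = (Num.floor x %/ 2)%Z.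
  apply: floor_def; set z := Num.floor x.
  have zx : z%:~R <= x by exact: floor_le.
  have xz : x < z%:~R + 1 by have := floorD1_gt x; rewrite intrD.
  have two : 2 = 2%:~R :> R by [].
  have one : 1 = 1%:~R :> R by [].
  have h1 : ((z %/ 2)%Z%:~R * 2 : R) <= z%:~R.
    by rewrite two -intrM ler_int; lia.
  have h2 : (z%:~R + 1 : R) <= ((z %/ 2)%Z%:~R + 1) * 2.
    by rewrite two one -!intrD -intrM ler_int; lia.
  by rewrite intrD; apply/andP; split; lra.
by rewrite !h => ->.
Qed.

Lemma dyadic_nested k p p' : dyadic k.+1 p = dyadic k.+1 p' -> dyadic k p = dyadic k p'.
Proof.
have e (u : R) : u / 2^-1 ^+ k = (u / 2^-1 ^+ k.+1) / 2.
  by rewrite exprS invfM invrK; move: (_ ^+ k)^-1 => z; field.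
by case => h1 h2; rewrite /dyadic /grid_index !(e _) (floor_half h1) (floor_half h2).
Qed.

(** Offsets from -2 to 2: indices of points at distance at most the mesh differ by at most 2 by
    [floor_sub_le]. *)
Definition grid_shift (z : int * int) (a : 'I_5 * 'I_5) : int * int :=
  (z.1 + (a.1 : nat)%:Z - 2, z.2 + (a.2 : nat)%:Z - 2).

Lemma grid_index_shift (g : R) p p' : 0 < g -> supdist p p' <= g ->
  exists a, grid_index g p' = grid_shift (grid_index g p) a.
Proof.
move=> g0.
have cl (u v : R) : `|u - v| <= g -> exists a : 'I_5, Num.floor (v / g) = Num.floor (u / g) + (a : nat)%:Z - 2.
  move=> uv; have := floor_sub_le (u / g) (v / g).
  rewrite -mulrBl normrM normfV (gtr0_norm g0) => h.
  have {}h : (`|Num.floor (u / g) - Num.floor (v / g)| <= 2)%N.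
    rewrite -(ler_nat R); apply: le_trans h _; have : `|u - v| / g <= 1 by rewrite ler_pdivrMr// mul1r.
    lra.
  have ha : (absz (Num.floor (v / g) - Num.floor (u / g) + 2)%R < 5)%N by lia.
  by exists (Ordinal ha) => /=; lia.
rewrite ge_max => /andP[/cl [a1 e1] /cl [a2 e2]].
by exists (a1, a2); rewrite /grid_shift /grid_index /= -e1 -e2.
Qed.

Lemma sum_near_le (X : finType) (w : X -> R) (pX : X -> R * R) (g B : R) p :
  0 < g -> (forall i, 0 <= w i) -> 0 <= B ->
  (forall i, \sum_(j | grid_index g (pX j) == grid_index g (pX i)) w j <= B) ->
  \sum_(j | supdist p (pX j) <= g) w j <= 25 * B.
Proof.
move=> g0 w0 B0 wB.
apply: (@le_trans _ _ (\sum_(a : 'I_5 * 'I_5) \sum_(j | grid_index g (pX j) == grid_shift (grid_index g p) a) w j)).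
  rewrite (exchange_big_dep xpredT)//= big_mkcond; apply: ler_sum => j _.
  case: ifP => [near|_]; last by rewrite sumr_ge0.
  have [a ea] := grid_index_shift g0 near.
  by rewrite (bigD1 a)/= ?ea// lerDl sumr_ge0.
apply: (@le_trans _ _ (\sum_(a : 'I_5 * 'I_5) B)); last first.
  by rewrite sumr_const card_prod !card_ord -[B *+ _]mulr_natl.
apply: ler_sum => a _.
case: (pickP (fun j => grid_index g (pX j) == grid_shift (grid_index g p) a)) => [i /eqP ia|P0]; last by rewrite big_pred0.
by rewrite -ia.
Qed.

Lemma dyadic_scale (rho : R) (n : nat) : 2^-1 ^+ n <= rho <= 1 ->
  exists2 k, (k <= n)%N & rho <= 2^-1 ^+ k <= 2 * rho.
Proof.
elim: n => [|n IH] /andP[h1 h2].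
  by exists 0%N => //; rewrite expr0 in h1 *; apply/andP; split; lra.
have [h3|h3] := leP (2^-1 ^+ n) rho.
  by have [|k kn kr] := IH; [rewrite h3|exists k => //; exact: leq_trans kn _].
exists n => //; rewrite (ltW h3)/=; move: h1; rewrite exprS; lra.
Qed.

(** The greedy measure is normalised by its mass, at least [e0] because the saturated cells cover
    [E]. In the constant, 25 counts neighbouring cells and [2 ^ t] pays for rounding [rho] to a
    dyadic scale. *)
Lemma frostman_exists (E : R * R -> Prop) (D n : nat) (e0 t : R) :
  0 < e0 -> 0 <= t -> (exists p, E p) ->
  (forall p, E p -> `|p.1| <= D%:R /\ `|p.2| <= D%:R) ->
  (forall (I : finType) (P : pred I) (k : I -> nat) (z : I -> int * int),
     (forall p, E p -> exists2 i, P i & dyadic (k i) p = z i) ->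
     e0 <= \sum_(i | P i) (2^-1 ^+ k i) `^ t) ->
  exists (X : finType) (nu : X -> R) (pX : X -> R * R),
    [/\ forall i, E (pX i), forall i, 0 <= nu i, \sum_i nu i = 1 &
        frostman nu pX (25 * 2 `^ t / e0) t (2^-1 ^+ n)].
Proof.
move=> e00 t0 [p0 Ep0] ED cov.
have h0 k : 0 < 2^-1 ^+ k :> R by rewrite exprn_gt0// invr_gt0.
pose m := (2 * (D * 2 ^ n + 1)).+1.
pose z (i : 'I_m * 'I_m) : int * int :=
  ((i.1 : nat)%:Z - (D * 2 ^ n + 1)%N%:Z, (i.2 : nat)%:Z - (D * 2 ^ n + 1)%N%:Z).
(* One point of [E] for each level [n] cell meeting [E]; the other indices get some point of [E],
   and repetitions are harmless. *)
have [pX pXP] : exists pX : 'I_m * 'I_m -> R * R, forall i,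
    E (pX i) /\ (forall p, E p -> dyadic n p = z i -> dyadic n (pX i) = z i).
  suff /choice[f fP] : forall i, exists q, E q /\ (forall p, E p -> dyadic n p = z i -> dyadic n q = z i).
    by exists f.
  move=> i.
  have [[p [Ep pz]]|np] := pselect (exists p, E p /\ dyadic n p = z i).
    by exists p; split.
  by exists p0; split => // p Ep pz; exfalso; apply: np; exists p.
have idx p : E p -> exists i, dyadic n p = z i.
  move=> /ED[p1 p2].
  have cl (u : R) : `|u| <= D%:R -> exists a : 'I_m, Num.floor (u / 2^-1 ^+ n) = (a : nat)%:Z - (D * 2 ^ n + 1)%N%:Z.
    move=> uD; have : (`|Num.floor (u / 2^-1 ^+ n)| <= D * 2 ^ n + 1)%N.
      have := floor_sub_le (u / 2^-1 ^+ n) 0; rewrite floor0 !subr0 => h.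
      rewrite -(ler_nat R); apply: le_trans h _.
      rewrite normrM normfV (gtr0_norm (h0 n)) natrD lerD2r natrM natrX exprVn invrK.
      by rewrite ler_wpM2r// exprn_ge0.
    move=> h; have ha : (absz (Num.floor (u / 2^-1 ^+ n) + (D * 2 ^ n + 1)%N%:Z)%R < m)%N.
      by rewrite /m; move: (D * 2 ^ n + 1)%N h => N h; lia.
    by exists (Ordinal ha) => /=; move: (D * 2 ^ n + 1)%N h {ha} => N h; lia.
  have [a1 e1] := cl _ p1; have [a2 e2] := cl _ p2.
  by exists (a1, a2); rewrite /dyadic /grid_index /z /= e1 e2.
pose X : finType := ('I_m * 'I_m)%type.
pose w k : R := (2^-1 ^+ k) `^ t.
have w0 k : 0 <= w k by exact: powR_ge0.
have [nu [nu0 nuw nus]] := @greedy_measure R X _ (fun k i => dyadic k (pX i)) w n w0.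
have [kk [P [kkP kkS]]] := @greedy_cover R X _ (fun k i => dyadic k (pX i)) w n nu
  (fun k i j => @dyadic_nested k _ _) nu0 nus.
have nested j k p p' : (j <= k)%N -> dyadic k p = dyadic k p' -> dyadic j p = dyadic j p'.
  elim: k => [|k IH]; first by rewrite leqn0 => /eqP ->.
  by rewrite leq_eqVlt => /orP[/eqP ->//|jk] /dyadic_nested; exact: IH.
have Se0 : e0 <= \sum_i nu i.
  apply: le_trans kkS; apply: (cov X P kk (fun i => dyadic (kk i) (pX i))) => p Ep.
  have [i pi] := idx p Ep; have [x' [Px' kn e]] := kkP i.
  exists x' => //; rewrite -e; apply: (nested _ n) => //.
  by have [_ h] := pXP i; rewrite pi (h p Ep pi).
have S0 : 0 < \sum_i nu i by exact: lt_le_trans Se0.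
exists X, (fun i => nu i / \sum_i nu i), pX; split.
- by move=> i; exact: (pXP i).1.
- by move=> i; rewrite divr_ge0// ltW.
- by rewrite -mulr_suml divff// gt_eqF.
move=> i rho /dyadic_scale[k kn /andP[k1 k2]].
have rho0 : 0 <= rho by have := h0 k; lra.
rewrite -mulr_suml ler_pdivrMr//.
apply: (@le_trans _ _ (25 * w k)).
  apply: le_trans (_ : \sum_(j | supdist (pX i) (pX j) <= 2^-1 ^+ k) nu j <= _).
    by apply: ler_sum_subset => // j /le_trans; apply.
  by apply: sum_near_le => // j; exact: nuw.
apply: (@le_trans _ _ (25 * (2 `^ t * rho `^ t) / e0 * e0)).
  rewrite divfK ?gt_eqF// ler_wpM2l// -powRM// ge0_ler_powR ?nnegrE ?(ltW (h0 k))//.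
  by rewrite mulr_ge0.
rewrite (_ : 25 * 2 `^ t / e0 * rho `^ t = 25 * (2 `^ t * rho `^ t) / e0); last by ring.
by rewrite ler_wpM2l// divr_ge0 ?(ltW e00)// !mulr_ge0 ?powR_ge0.
Qed.

End DyadicFrostman.

Local Open Scope classical_set_scope.
Local Open Scope ring_scope.

(** * Discretisation of an Ahlfors regular measure *)

Section FiniteUnions.
Context {d : measure_display} {R : realType} {T : measurableType d}.
Variable mu : {measure set T -> \bar R}.

Lemma in_bigsetU (I : eqType) (r : seq I) (P : pred I) (F : I -> set T) x :
  (\big[setU/set0]_(i <- r | P i) F i) x <-> exists i, [/\ i \in r, P i & F i x].
Proof.
elim: r => [|j r IH]; first by rewrite big_nil; split => // -[i []].
rewrite big_cons; split.
  case: ifP => Pj; last by move=> /IH[i [ir Pi Fi]]; exists i; split=> //; rewrite inE ir orbT.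
  case=> [Fj|/IH[i [ir Pi Fi]]]; first by exists j; rewrite inE eqxx.
  by exists i; split=> //; rewrite inE ir orbT.
move=> [i []]; rewrite inE => /orP[/eqP -> -> Fj|ir Pi Fi]; first by left.
by case: ifP => _; [right|]; apply/IH; exists i.
Qed.

Lemma measure_le_sum (I : finType) (P : pred I) (F : I -> set T) (A : set T) :
  (forall i, measurable (F i)) -> measurable A ->
  (forall x, A x -> exists2 i, P i & F i x) ->
  (mu A <= \sum_(i | P i) mu (F i))%E.
Proof.
move=> mF mA AF.
apply: (@le_trans _ _ (mu (\big[setU/set0]_(i <- index_enum I | P i) F i))).
  apply: le_measure; rewrite ?inE//; first exact: bigsetU_measurable.
  by move=> x /AF[i Pi Fi]; apply/in_bigsetU; exists i; rewrite mem_index_enum.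
elim: (index_enum I) => [|j r IH]; first by rewrite !big_nil measure0.
rewrite !big_cons; case: ifP => // Pj.
apply: le_trans (measureU2 _ _ _) _ => //; first exact: bigsetU_measurable.
exact: leeD2l.
Qed.

Lemma sum_measure_le (I : finType) (P : pred I) (F : I -> set T) (A : set T) :
  (forall i, measurable (F i)) -> measurable A ->
  (forall i j x, P i -> P j -> F i x -> F j x -> i = j) ->
  (forall i, P i -> F i `<=` A) ->
  (\sum_(i | P i) mu (F i) <= mu A)%E.
Proof.
move=> mF mA dF FA.
apply: (@le_trans _ _ (mu (\big[setU/set0]_(i <- index_enum I | P i) F i))); last first.
  apply: le_measure; rewrite ?inE//; first exact: bigsetU_measurable.
  by move=> x /in_bigsetU[i [_ Pi Fi]]; exact: (FA i).
elim: (index_enum I) (index_enum_uniq I) => [|j r IH]; first by rewrite !big_nil measure0.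
rewrite /= => /andP[jr ur]; rewrite !big_cons; case: ifP => Pj; last exact: IH.
rewrite measureU//; first by rewrite leeD2l// IH.
- exact: bigsetU_measurable.
- apply/seteqP; split=> // x [Fj /in_bigsetU[i [ir Pi Fi]]].
  by move: jr; rewrite (dF j i x) ?ir.
Qed.

End FiniteUnions.

(** * Borel sets of the plane and the support of a measure *)

Section BorelPlane.
Variable R : realType.
Local Notation plane := 'rV[R]_2.
Local Notation bplane := (g_sigma_algebraType (@open plane)).

Definition coords (x : plane) : R * R := (x ord0 ord0, x ord0 ord_max).

Lemma eucl_distE (x y : plane) : eucl_dist x y = edist (coords x) (coords y).
Proof.
rewrite /eucl_dist /edist !big_ord_recl big_ord0 addr0 /=.
by rewrite (_ : lift ord0 ord0 = ord_max)//; apply: val_inj.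
Qed.

Lemma ord2P (P : 'I_2 -> Prop) : P ord0 -> P ord_max -> forall i, P i.
Proof.
move=> P0 P1 i; case: (unliftP ord0 i) => [j ->|->//].
by rewrite (_ : lift ord0 j = ord_max)//; apply: val_inj; rewrite /= (ord1 j).
Qed.

Lemma open_measurable_plane (U : set plane) : open U -> @measurable _ bplane U.
Proof. by move=> oU; apply: sub_sigma_algebra. Qed.

Lemma measurable_coord_lt (j : 'I_2) (a : R) :
  @measurable _ bplane [set x : plane | x ord0 j < a].
Proof.
apply: open_measurable_plane; apply: (@open_comp _ _ (fun x : plane => x ord0 j) [set y | y < a]).
  by move=> x _; exact: coord_continuous.
exact: open_lt.
Qed.

Lemma measurable_coord_ge (j : 'I_2) (a : R) :
  @measurable _ bplane [set x : plane | a <= x ord0 j].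
Proof.
rewrite (_ : [set _ | _] = ~` [set x : plane | x ord0 j < a]).
  by apply: measurableC; exact: measurable_coord_lt.
by apply/seteqP; split => x /=; rewrite leNgt => /negP.
Qed.

Definition grid_cell (g : R) (z : int * int) : set plane :=
  [set x | grid_index g (coords x) = z].

Lemma measurable_grid_cell (g : R) z : 0 < g -> @measurable _ bplane (grid_cell g z).
Proof.
move=> g0; have fE (u : R) (k : int) : (Num.floor (u / g) == k) = (k%:~R * g <= u) && (u < (k + 1)%:~R * g).
  by rewrite floor_eq ler_pdivlMr// ltr_pdivrMr.
rewrite (_ : grid_cell g z =
  ([set x : plane | z.1%:~R * g <= x ord0 ord0] `&` [set x : plane | x ord0 ord0 < (z.1 + 1)%:~R * g])
  `&` ([set x : plane | z.2%:~R * g <= x ord0 ord_max] `&` [set x : plane | x ord0 ord_max < (z.2 + 1)%:~R * g])).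
  by apply: (@measurableI _ bplane); apply: (@measurableI _ bplane);
    do ?[exact: measurable_coord_ge | exact: measurable_coord_lt].
apply/seteqP; split => x; rewrite /grid_cell /grid_index /coords /=.
  by move=> <- /=; have := fE (x ord0 ord0) (Num.floor (x ord0 ord0 / g));
    have := fE (x ord0 ord_max) (Num.floor (x ord0 ord_max / g));
    rewrite !eqxx => /esym/andP[? ?] /esym/andP[? ?].
move=> [[h1 h2] [h3 h4]]; case: z h1 h2 h3 h4 => z1 z2 /= h1 h2 h3 h4.
by congr (_, _); apply/eqP; rewrite fE ?h1 ?h2 ?h3 ?h4.
Qed.

Lemma measurable_closed_ball (x : plane) (r : R) : @measurable _ bplane (eucl_closed_ball x r).
Proof.
rewrite -[eucl_closed_ball x r]setCK; apply: measurableC; apply: open_measurable_plane.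
have [r0|r0] := ltP r 0.
  rewrite (_ : ~` _ = setT); first exact: openT.
  apply/seteqP; split=> // y _; rewrite /eucl_closed_ball /= => h.
  by have := le_trans (sqrtr_ge0 _) h; rewrite leNgt r0.
pose g j : plane -> R := cst (x ord0 j) - (fun y : plane => y ord0 j).
have gc j y : {for y, continuous (g j)}.
  by apply: continuousB; [exact: cst_continuous|exact: coord_continuous].
pose f : plane -> R := (g ord0 \* g ord0) + (g ord_max \* g ord_max).
rewrite (_ : ~` _ = f @^-1` [set z | r ^+ 2 < z]).
  apply: open_comp; last exact: open_gt.
  by move=> y _; apply: continuousD; apply: continuousM; exact: gc.
have key y : (eucl_dist x y <= r) = (f y <= r ^+ 2).
  by rewrite eucl_distE -(@ler_pXn2r _ 2) ?nnegrE ?edist_ge0// sqr_edist.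
apply/seteqP; split => y; rewrite /eucl_closed_ball /= key ltNge.
  by move/negP.
by move=> /negP.
Qed.

Lemma cell_in_open (U : set plane) x : open U -> U x ->
  exists k : nat, grid_cell (2^-1 ^+ k) (dyadic k (coords x)) `<=` U.
Proof.
rewrite openE => oU Ux; have /nbhs_ballP[e /= e_gt0 eU] := oU _ Ux.
have [k ke] : exists k : nat, 2^-1 ^+ k < e.
  exists (Num.truncn e^-1).+1.
  rewrite exprVn -[ltRHS]invrK ltf_pV2 ?posrE ?invr_gt0 ?exprn_gt0//.
  apply: lt_trans (truncnS_gt e^-1) _.
  by rewrite -natrX ltr_nat ltn_expl.
exists k => y /grid_index_near [|h1 h2]; first by rewrite exprn_gt0// invr_gt0.
apply: eU; split => // i; rewrite (ord1 i); apply: ord2P.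
  by rewrite /ball /= distrC; exact: le_lt_trans ke.
by rewrite /ball /= distrC; exact: le_lt_trans ke.
Qed.

(** The complement of the support is contained in the union of the null dyadic cells, which are
    countably many. So if [Q] missed the part of the support in [B], it would be null. *)
Lemma support_point (mu : borel_measure R 2) (B Q : set plane) :
  borel_set B -> mu (~` B) = 0%E -> @measurable _ bplane Q -> (0 < mu Q)%E ->
  exists x, [/\ Q x, B x & msupport mu x].
Proof.
move=> bB muB mQ Q0; apply: contrapT => nex.
pose F (n : nat) : set bplane := if unpickle n is Some (k, z) then
   if `[< mu (grid_cell (2^-1 ^+ k) z) = 0%E >] then grid_cell (2^-1 ^+ k) z else set0 else set0.
have g0 k : 0 < 2^-1 ^+ k :> R by rewrite exprn_gt0// invr_gt0.
have NF : mu.-negligible (\bigcup_n F n).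
  apply: negligible_bigcup => n; rewrite /F; case: unpickle => [[k z]|]; last exact: negligible_set0.
  case: asboolP => [h|_]; last exact: negligible_set0.
  by apply/negligibleP => //; apply: measurable_grid_cell.
have NB : mu.-negligible (~` B).
  by apply/negligibleP => //; apply: (@measurableC _ bplane).
have : mu.-negligible Q.
  apply: negligibleS (negligibleU NB NF) => x Qx.
  have [Bx|nBx] := pselect (B x); last by left.
  right; have nS : ~ msupport mu x by move=> Sx; apply: nex; exists x.
  have [U [oU Ux muU]] : exists U : set plane, [/\ open U, U x & ~ (0 < mu U)%E].
    apply: contrapT => nU; apply: nS => U oU Ux; apply: contrapT => h; apply: nU; by exists U.
  have [k kU] := cell_in_open oU Ux.
  exists (pickle (k, dyadic k (coords x))) => //; rewrite /F pickleK.
  case: asboolP => // -[]; apply/eqP; rewrite eq_le measure_ge0 andbT.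
  have mU0 : (mu U <= 0)%E by rewrite leNgt; apply/negP.
  apply: le_trans mU0; apply: le_measure; rewrite ?inE//.
    exact: measurable_grid_cell.
  exact: open_measurable_plane.
by move=> /(negligibleP _ mQ) e; move: Q0; rewrite e ltxx.
Qed.

End BorelPlane.

Section RealMeasure.
Context {d : measure_display} {R : realType} {T : measurableType d}.
Variables (mu : {measure set T -> \bar R}) (U : set T).
Hypotheses (mU : measurable U) (finU : (mu U < +oo)%E).

(** [mu] may be infinite; inside a set [U] of finite mass, [fine] loses nothing. *)
Definition rmeas (A : set T) : R := fine (mu A).

Lemma rmeasE A : measurable A -> A `<=` U -> (rmeas A)%:E = mu A.
Proof.
move=> mA AU; rewrite /rmeas fineK// ge0_fin_numE//.
by apply: le_lt_trans finU; apply: le_measure; rewrite ?inE.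
Qed.


Lemma rmeas_le_sum (I : finType) (P : pred I) (F : I -> set T) (A : set T) :
  (forall i, measurable (F i)) -> (forall i, P i -> F i `<=` U) -> measurable A -> A `<=` U ->
  (forall x, A x -> exists2 i, P i & F i x) ->
  rmeas A <= \sum_(i | P i) rmeas (F i).
Proof.
move=> mF FU mA AU AF; rewrite -lee_fin rmeasE// -sumEFin.
rewrite (eq_bigr (fun i => mu (F i))); first exact: measure_le_sum.
by move=> i Pi; rewrite rmeasE//; exact: FU.
Qed.

Lemma sum_rmeas_le (I : finType) (P : pred I) (F : I -> set T) (A : set T) :
  (forall i, measurable (F i)) -> measurable A -> A `<=` U ->
  (forall i j x, P i -> P j -> F i x -> F j x -> i = j) ->
  (forall i, P i -> F i `<=` A) ->
  \sum_(i | P i) rmeas (F i) <= rmeas A.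
Proof.
move=> mF mA AU dF FA; rewrite -lee_fin rmeasE// -sumEFin.
rewrite (eq_bigr (fun i => mu (F i))); first exact: sum_measure_le.
by move=> i Pi; rewrite rmeasE//; apply: subset_trans AU; exact: FA.
Qed.

End RealMeasure.

(** * Finite models of the regular measure near a support point *)

Section Discretise.
Variable R : realType.
Local Notation plane := 'rV[R]_2.
Local Notation bplane := (g_sigma_algebraType (@open plane)).
Implicit Types p q : R * R.

Lemma supdistC p q : supdist p q = supdist q p.
Proof. by rewrite /supdist distrC [in X in Num.max _ X]distrC. Qed.

Lemma supdist_triangle p q p' : supdist p p' <= supdist p q + supdist q p'.
Proof.
have h (f : R * R -> R) : (forall u v : R * R, `|f u - f v| <= supdist u v) ->
    `|f p - f p'| <= supdist p q + supdist q p'.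
  move=> hf; have -> : f p - f p' = (f p - f q) + (f q - f p') by ring.
  by apply: le_trans (ler_normD _ _) _; apply: lerD.
rewrite {1}/supdist ge_max; apply/andP; split.
  by apply: (h fst) => u v; rewrite le_max lexx.
by apply: (h snd) => u v; rewrite le_max lexx orbT.
Qed.

Lemma edist_le_supdist p q : edist p q <= 2 * supdist p q.
Proof.
apply: le_trans (edist_le_sum _ _) _.
have : `|p.1 - q.1| <= supdist p q by rewrite le_max lexx.
have : `|p.2 - q.2| <= supdist p q by rewrite le_max lexx orbT.
lra.
Qed.

Lemma supdist_le_edist p q : supdist p q <= edist p q.
Proof.
have h (u : R) : u ^+ 2 <= edist p q ^+ 2 -> `|u| <= edist p q.
  by move=> hu; rewrite -(@ler_pXn2r _ 2) ?nnegrE ?edist_ge0// real_normK ?num_real.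
rewrite ge_max; apply/andP; split; apply: h; rewrite sqr_edist.
  by rewrite lerDl sqr_ge0.
by rewrite lerDr sqr_ge0.
Qed.

Lemma grid_shift_near z a :
  (`|(grid_shift z a).1 - z.1| <= 2)%N /\ (`|(grid_shift z a).2 - z.2| <= 2)%N.
Proof. by case: z a => z1 z2 [[a1 ?] [a2 ?]]; split => /=; lia. Qed.

Lemma grid_shift_inj a : injective (grid_shift^~ a).
Proof. by move=> [z1 z2] [u1 u2] [? ?]; congr (_, _); lia. Qed.

Lemma window_index (N : nat) (u v : int) : (`|u - v| <= N)%N ->
  exists a : 'I_(2 * N).+1, u = v + (a : nat)%:Z - N%:Z.
Proof.
move=> uv; have ha : (absz (u - v + N%:Z)%R < (2 * N).+1)%N by lia.
by exists (Ordinal ha) => /=; lia.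
Qed.

Lemma window_index_inj (z w : int) (a b : nat) : z + a%:Z - w = z + b%:Z - w -> a = b.
Proof. lia. Qed.

Lemma supdist_grid_le (g : R) p q : 0 < g ->
  (`|(grid_index g p).1 - (grid_index g q).1| <= 2)%N ->
  (`|(grid_index g p).2 - (grid_index g q).2| <= 2)%N -> supdist p q <= 3 * g.
Proof.
move=> g0; rewrite -!(ler_nat R) /= => h1 h2.
have n1 := norm_sub_floor (p.1 / g) (q.1 / g).
have n2 := norm_sub_floor (p.2 / g) (q.2 / g).
move: n1 n2; rewrite -!mulrBl !normrM normfV (gtr0_norm g0) => n1 n2.
rewrite /supdist ge_max; apply/andP; split; rewrite -ler_pdivrMr//; lra.
Qed.

Variables (mu : borel_measure R 2) (B : set plane) (s C c : R) (y1 : plane).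
Hypotheses (bB : borel_set B) (muB : mu (~` B) = 0%E).
Hypothesis reg : forall (x : plane) (r : R), msupport mu x -> 0 < r <= 1 ->
  ((C^-1 * r `^ s)%:E <= mu (eucl_closed_ball x r) <= (C * r `^ s)%:E)%E.
Hypotheses (s0 : 0 < s) (C1 : 1 < C) (y1S : msupport mu y1) (c0 : 0 < c <= 1 / 8).

Let B1 := eucl_closed_ball y1 1.
Let mB1 : @measurable _ bplane B1. Proof. exact: measurable_closed_ball. Qed.
Let one01 : 0 < (1 : R) <= 1. Proof. by rewrite ltr01 lexx. Qed.

Let muB1 : (mu B1 <= C%:E)%E.
Proof. by have /andP[_] := reg y1S one01; rewrite powR1 mulr1. Qed.

Let finB1 : (mu B1 < +oo)%E.
Proof. by apply: le_lt_trans muB1 _; rewrite ltry. Qed.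

Let rm := @rmeas _ R bplane mu.

Let ball_sub (x : plane) (r a : R) : supdist (coords x) (coords y1) <= a -> a + r <= 1 / 2 ->
  [set y : plane | supdist (coords y) (coords x) <= r] `<=` B1.
Proof.
move=> xa ar y /= yr; rewrite /B1 /eucl_closed_ball /= eucl_distE.
apply: le_trans (edist_le_supdist _ _) _.
have := supdist_triangle (coords y1) (coords x) (coords y).
rewrite (supdistC (coords y1) (coords x)) (supdistC (coords x) (coords y)); lra.
Qed.

Let ball_supdist (x y : plane) (r : R) : eucl_closed_ball x r y -> supdist (coords y) (coords x) <= r.
Proof.
by rewrite /eucl_closed_ball /= eucl_distE supdistC; apply: le_trans; exact: supdist_le_edist.
Qed.

Let rm_ball_le (x : plane) (r : R) : msupport mu x -> 0 < r <= 1 ->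
  rm (eucl_closed_ball x r) <= C * r `^ s.
Proof.
move=> Sx r01; have /andP[_ h] := reg Sx r01.
rewrite -lee_fin; apply: le_trans h; rewrite /rm /rmeas fineK//.
rewrite ge0_fin_numE//; have /andP[_ h] := reg Sx r01.
by apply: le_lt_trans h _; rewrite ltry.
Qed.

Let rm_ball_ge (x : plane) (r : R) : msupport mu x -> 0 < r <= 1 ->
  C^-1 * r `^ s <= rm (eucl_closed_ball x r).
Proof.
move=> Sx r01; have /andP[h h'] := reg Sx r01.
rewrite -lee_fin; apply: le_trans h _; rewrite /rm /rmeas fineK//.
rewrite ge0_fin_numE//.
by apply: le_lt_trans h' _; rewrite ltry.
Qed.

Let C0 : 0 < C. Proof. by apply: lt_trans C1. Qed.

(** The 25 neighbours of an occupied cell cover a ball of mass at least [g ^ s / C]. For a fixed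
    offset the neighbours of distinct cells are disjoint inside the unit ball, of mass at most
    [C]. *)
Let grid_count_le (Y : finType) (x : Y -> plane) (g : R) : 0 < g <= 1 / 8 ->
  (forall j, msupport mu (x j)) -> (forall j, supdist (coords (x j)) (coords y1) <= c) ->
  (image_count (fun j => grid_index g (coords (x j))))%:R <= 25 * C ^+ 2 * g `^ (- s).
Proof.
move=> /andP[g0 g8] xS xc; have /andP[c_gt0 c8] := c0.
rewrite /image_count; set f := fun j => _; set ss := undup _.
have us : uniq ss by exact: undup_uniq.
have [jj jjE] : exists jj : 'I_(size ss) -> Y, forall k, f (jj k) = nth (0, 0) ss k.
  suff /choice[h hP] : forall k : 'I_(size ss), exists j, f j = nth (0, 0) ss k by exists h.
  move=> k; have : nth (0, 0) ss k \in ss by rewrite mem_nth.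
  by rewrite mem_undup => /mapP[j _ ->]; exists j.
have inj k k' : f (jj k) = f (jj k') -> k = k'.
  by rewrite !jjE => /eqP; rewrite nth_uniq// => /eqP/val_inj.
pose cell k a := grid_cell g (grid_shift (f (jj k)) a).
have mcell k a : @measurable _ bplane (cell k a) by exact: measurable_grid_cell.
have cellB k a : cell k a `<=` B1.
  move=> y; rewrite /cell /grid_cell /= => e.
  apply: (@ball_sub (x (jj k)) (3 * g) c) => //; first lra.
  by apply: supdist_grid_le => //; rewrite e; have [] := grid_shift_near (f (jj k)) a.
have low k : C^-1 * g `^ s <= \sum_(a : 'I_5 * 'I_5) rm (cell k a).
  have g1 : 0 < g <= 1 by rewrite g0; lra.
  apply: le_trans (rm_ball_ge (xS (jj k)) g1) _.
  apply: (@rmeas_le_sum _ R bplane mu B1) => //.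
  - exact: measurable_closed_ball.
  - move=> y /ball_supdist h; apply: (@ball_sub (x (jj k)) g c) => //; lra.
  - move=> y /ball_supdist; rewrite supdistC => h.
    have [a ea] := grid_index_shift g0 h; by exists a.
have up a : \sum_k rm (cell k a) <= C.
  apply: (@le_trans _ _ (rm B1)); last by have := rm_ball_le y1S one01; rewrite powR1 mulr1.
  apply: (@sum_rmeas_le _ R bplane mu B1) => // k k' y _ _.
  by rewrite /cell /grid_cell /= => -> /grid_shift_inj; exact: inj.
have : \sum_(k < size ss) (C^-1 * g `^ s) <= 25 * C.
  apply: (@le_trans _ _ (\sum_(k < size ss) \sum_(a : 'I_5 * 'I_5) rm (cell k a))).
    by apply: ler_sum => k _.
  rewrite exchange_big /=; apply: (@le_trans _ _ (\sum_(a : 'I_5 * 'I_5) C)).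
    by apply: ler_sum => a _.
  by rewrite sumr_const card_prod !card_ord -[C *+ _]mulr_natl.
rewrite sumr_const card_ord -[_ *+ size _]mulr_natl powRN => h.
rewrite ler_pdivlMr ?powR_gt0// -(@ler_pM2l _ C^-1) ?invr_gt0//.
rewrite mulrCA; apply: le_trans h _; rewrite le_eqVlt; apply/orP; left; apply/eqP.
by field; rewrite gt_eqF.
Qed.

Let m0 : R := C^-1 * (c / 2) `^ s.
Let m00 : 0 < m0.
Proof. by rewrite mulr_gt0 ?invr_gt0// powR_gt0// divr_gt0//; case/andP: c0. Qed.

(** Each cell of positive mass inside the box of radius [c] is replaced by a support point in it,
    with the mass of the cell. Frostman growth follows as the cells of points within [rho] lie in a
    Euclidean ball of radius [4 * rho]. *)
Lemma ahlfors_discretise (l : R) : 0 < l ->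
  exists (Y : finType) (m : Y -> R) (y : Y -> plane),
  [/\ forall j, B (y j) /\ supdist (coords (y j)) (coords y1) <= c,
      (forall j, 0 < m j) /\ \sum_j m j = 1,
      frostman m (fun j => coords (y j)) (4 `^ s * (1 + C / m0)) s l &
      forall g, 0 < g <= 1 / 8 ->
        (image_count (fun j => grid_index g (coords (y j))))%:R <= 25 * C ^+ 2 * g `^ (- s)].
Proof.
move=> l_gt0; have /andP[c_gt0 c8] := c0.
pose g := Num.min l (c / 4).
have g0 : 0 < g by rewrite lt_min l_gt0 divr_gt0.
have gl : g <= l by rewrite ge_min lexx.
have gc : g <= c / 4 by rewrite ge_min lexx orbT.
clearbody g.
have [N Nc] : exists N : nat, c / g + 1 <= N%:R.
  by exists (Num.truncn (c / g)).+2; rewrite -[_.+2%:R]natr1 lerD2r ltW// truncnS_gt.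
pose I : finType := ('I_(2 * N).+1 * 'I_(2 * N).+1)%type.
pose z0 := grid_index g (coords y1).
pose z (i : I) : int * int := (z0.1 + (i.1 : nat)%:Z - N%:Z, z0.2 + (i.2 : nat)%:Z - N%:Z).
have z_inj : injective z.
  move=> [i1 i2] [k1 k2] [/= e1 e2]; congr (_, _); apply: val_inj => /=.
    exact: window_index_inj e1.
  exact: window_index_inj e2.
pose box : set plane := [set x | supdist (coords x) (coords y1) <= c].
have boxB : box `<=` B1.
  by apply: (@ball_sub y1 c 0); [rewrite /supdist !subrr normr0 maxxx | lra].
pose cell (i : I) := grid_cell g (z i).
have mcell i : @measurable _ bplane (cell i) by exact: measurable_grid_cell.
pose A : {pred I} := [pred i | `[< cell i `<=` box >] && `[< (0 < mu (cell i))%E >]].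
pose Y : finType := {i : I | i \in A}.
have cellbox (j : Y) : cell (val j) `<=` box by have /andP[/asboolP] := valP j.
have [y yP] : exists y : Y -> plane, forall j, [/\ cell (val j) (y j), B (y j) & msupport mu (y j)].
  suff /choice[h hP] : forall j : Y, exists x, [/\ cell (val j) x, B x & msupport mu x] by exists h.
  by move=> j; apply: support_point => //; have /andP[_ /asboolP] := valP j.
have yc j : supdist (coords (y j)) (coords y1) <= c by apply: (cellbox j); have [] := yP j.
have rmcell (j : Y) : 0 < rm (cell (val j)).
  have /andP[_ /asboolP h] := valP j; rewrite -lte_fin /rm (@rmeasE _ R bplane mu B1)//.
  by apply: subset_trans boxB; exact: cellbox.
pose M := \sum_(j : Y) rm (cell (val j)).
(* A cell meeting the ball of radius [c / 2] stays in the box since [g <= c / 4]; cells of mass 0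
   are dropped for free. *)
have M0 : m0 <= M.
  have c201 : 0 < c / 2 <= 1 by apply/andP; split; lra.
  apply: le_trans (rm_ball_ge y1S c201) _.
  apply: (@le_trans _ _ (\sum_(i : I | `[< cell i `<=` box >]) rm (cell i))).
    apply: (@rmeas_le_sum _ R bplane mu B1) => //.
    - by move=> i /asboolP h; exact: subset_trans boxB.
    - exact: measurable_closed_ball.
    - by move=> x /ball_supdist h; apply: (@ball_sub y1 (c / 2) 0); rewrite ?h// /supdist ?subrr ?normr0 ?maxxx//; lra.
    - move=> x /ball_supdist h.
      have cl (u v : R) : `|u - v| <= c -> exists a : 'I_(2 * N).+1, Num.floor (u / g) = Num.floor (v / g) + (a : nat)%:Z - N%:Z.
        move=> uv; have hN : (`|Num.floor (u / g) - Num.floor (v / g)| <= N)%N.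
          rewrite -(ler_nat R); apply: le_trans (floor_sub_le _ _) _; apply: le_trans Nc; rewrite lerD2r.
          by rewrite -mulrBl normrM normfV (gtr0_norm g0) ler_wpM2r// invr_ge0 ltW.
        exact: window_index.
      have h' : supdist (coords x) (coords y1) <= c by lra.
      move: h'; rewrite {1}/supdist ge_max => /andP[/cl[a1 e1] /cl[a2 e2]].
      have xi : cell (a1, a2) x by rewrite /cell /grid_cell /= /grid_index e1 e2.
      exists (a1, a2) => //; apply/asboolP => x' xi'.
      have : grid_index g (coords x') = grid_index g (coords x) by rewrite xi'.
      move=> /(grid_index_near g0)[d1 d2]; rewrite /box /=.
      apply: le_trans (supdist_triangle _ (coords x) _) _.
      have : supdist (coords x') (coords x) <= g by rewrite ge_max d1 d2.
      lra.
  rewrite /M -(@big_sub _ _ _ _ A (fun i => rm (cell i))).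
  rewrite big_mkcond [leRHS]big_mkcond; apply: ler_sum => i _.
  rewrite inE; case: asboolP => //= _; case: asboolP => // h.
  rewrite /rm /rmeas; have : mu (cell i) = 0%E.
    by apply/eqP; rewrite eq_le measure_ge0 andbT leNgt; apply/negP.
  by move=> ->.
have M_gt0 : 0 < M by exact: lt_le_trans M0.
exists Y, (fun j => rm (cell (val j)) / M), y; split.
- by move=> j; split => //; have [] := yP j.
- split; first by move=> j; rewrite divr_gt0.
  by rewrite -mulr_suml divff// gt_eqF.
- move=> j rho /andP[lrho rho1].
  have rho0 : 0 < rho by exact: lt_le_trans lrho.
  have grho : g <= rho by exact: le_trans lrho.
  have s4 : 0 < (4 : R) `^ s by rewrite powR_gt0.
  have rs : 0 < rho `^ s by rewrite powR_gt0.
  have Cm : 0 < C / m0 by rewrite divr_gt0.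
  rewrite -mulr_suml ler_pdivrMr//.
  (* Regularity says nothing beyond radius 1, but there [(4 * rho) ^ s >= 1] and total mass 1
     suffices: this is the 1 in [1 + C / m0]. *)
  have [rho4|rho4] := leP (4 * rho) 1; last first.
    apply: (@le_trans _ _ (1 * M)).
      by rewrite mul1r /M; apply: ler_sum_subset => // i _ _; exact: ltW.
    rewrite ler_wpM2r ?(ltW M_gt0)//; apply: (@le_trans _ _ ((4 * rho) `^ s)).
      have e1 : (1 : R) `^ s = 1 by rewrite powR1.
      by rewrite -[leLHS]e1 ge0_ler_powR ?nnegrE ?(ltW s0) ?(ltW rho4) ?mulr_ge0 ?(ltW rho0).
    rewrite powRM ?(ltW rho0)// ler_wpM2r ?(ltW rs)// ler_peMr ?(ltW s4)//; lra.
  apply: (@le_trans _ _ (C * (4 * rho) `^ s)).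
    have [yj _ Sj] := yP j.
    have r401 : 0 < 4 * rho <= 1 by rewrite rho4 mulr_gt0.
    apply: le_trans (rm_ball_le Sj r401).
    apply: (@sum_rmeas_le _ R bplane mu (eucl_closed_ball (y j) (4 * rho))) => //.
    + exact: measurable_closed_ball.
    + by have /andP[_ h] := reg Sj r401; apply: le_lt_trans h _; rewrite ltry.
    + exact: measurable_closed_ball.
    + move=> i k x _ _; rewrite /cell /grid_cell /= => -> /z_inj e; exact: val_inj.
    + move=> i hi x xi; rewrite /eucl_closed_ball /= eucl_distE.
      apply: le_trans (edist_le_supdist _ _) _.
      have [yi _ _] := yP i.
      have : grid_index g (coords (y i)) = grid_index g (coords x) by rewrite yi xi.
      move=> /(grid_index_near g0)[d1 d2].
      have h1 : supdist (coords (y i)) (coords x) <= g by rewrite ge_max d1 d2.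
      have := supdist_triangle (coords (y j)) (coords (y i)) (coords x).
      move: hi => /= hi; lra.
  rewrite powRM ?(ltW rho0)// mulrA [4 `^ s * _ * _]mulrAC -!mulrA [C * _]mulrC -!mulrA.
  rewrite ler_pM2l// ler_pM2l// [leRHS]mulrC.
  apply: (@le_trans _ _ (C / m0 * m0)); first by rewrite divfK// gt_eqF.
  apply: (@le_trans _ _ (C / m0 * M)); first by rewrite ler_wpM2l// ltW.
  by rewrite mulrDr mulr1 mulrC lerDr ltW.
- move=> h h01; apply: grid_count_le => // j; first by have [] := yP j.
Qed.

End Discretise.

(** * Hausdorff null sets *)

Section HausdorffNull.
Variables (R : realType) (dim : nat) (t : R).
Hypothesis t0 : 0 < t.
Local Notation space := 'rV[R]_dim.
Implicit Types (E F : set space).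

(** Vanishing Hausdorff content: without a bound on diameters, countable unions and finite covers
    are easier to handle. *)
Definition hausdorff_null E : Prop := forall e : R, 0 < e ->
  exists U : nat -> set space, E `<=` \bigcup_i U i /\
    (\sum_(0 <= i <oo) diam_pow t (U i) <= e%:E)%E.

Lemma diam_ge0 E : (0 <= diam E)%E.
Proof. by apply: ereal_sup_ubound; left. Qed.

Lemma diam_pow_ge0 E : (0 <= diam_pow t E)%E.
Proof. by rewrite /diam_pow; case: asboolP => // _; exact: poweR_ge0. Qed.

Lemma diam_pow_set0 : diam_pow t (set0 : set space) = 0%E.
Proof. by rewrite /diam_pow; case: asboolP. Qed.

Lemma diam_le E (a : R) : 0 <= a -> (forall x y, E x -> E y -> eucl_dist x y <= a) -> (diam E <= a%:E)%E.
Proof.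
move=> a0 Ea; apply/ereal_supP => _ [->|[x Ex [y Ey <-]]]; first by rewrite lee_fin.
by rewrite lee_fin; exact: Ea.
Qed.

Lemma diam_pow_le E (a : R) : 0 <= a -> (forall x y, E x -> E y -> eucl_dist x y <= a) ->
  (diam_pow t E <= (a `^ t)%:E)%E.
Proof.
move=> a0 Ea; rewrite /diam_pow; case: asboolP => _; first by rewrite lee_fin powR_ge0.
rewrite -poweR_EFin; apply: gt0_ler_poweR; rewrite ?(ltW t0)//.
- by rewrite in_itv/= diam_ge0 leey.
- by rewrite in_itv/= lee_fin a0 leey.
exact: diam_le.
Qed.

Lemma diam_le_of_pow E (a : R) : 0 < a -> (diam_pow t E <= (a `^ t)%:E)%E -> (diam E <= a%:E)%E.
Proof.
move=> a0; rewrite /diam_pow; case: asboolP => [-> _|_].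
  by apply: diam_le; [exact: ltW|].
have := diam_ge0 E; case: (diam E) => [r| |]//=.
  rewrite !lee_fin => r0; apply: contraTT; rewrite -!ltNge => ar.
  by rewrite gt0_ltr_powR// nnegrE ltW.
by rewrite (gt_eqF t0).
Qed.

(** A cover whose [t]-sum is at most [de ^ t] has all its diameters at most [de], so the size
    restriction is automatic. *)
Lemma hausdorff_null_measure E : hausdorff_null E -> hausdorff_measure t E = 0%E.
Proof.
move=> nE; apply/eqP; rewrite eq_le; apply/andP; split; last first.
  apply: ereal_sup_ge; exists (hausdorff_premeasure t 1 E); first by exists 1 => //=.
  by apply/ereal_infP => _ [U _ <-]; apply: nneseries_ge0 => n _ _; exact: diam_pow_ge0.
apply/ereal_supP => _ [de /= de0 <-].
apply/lee_addgt0Pr => e e0; rewrite add0e.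
have de_t : 0 < de `^ t by rewrite powR_gt0.
have [|U [EU Ue]] := nE (Num.min e (de `^ t)); first by rewrite lt_min e0.
apply: (@le_trans _ _ (\sum_(0 <= i <oo) diam_pow t (U i))%E).
  apply: ereal_inf_lbound; exists U => //; split => // i.
  apply: diam_le_of_pow => //; apply: (@le_trans _ _ (\sum_(0 <= i <oo) diam_pow t (U i))%E).
    apply: le_trans (nneseries_lim_ge i.+1 _); last by move=> n _ _; exact: diam_pow_ge0.
    rewrite big_nat_recr//=; apply: leeDr; apply: sume_ge0 => n _; exact: diam_pow_ge0.
  by apply: le_trans Ue _; rewrite lee_fin ge_min lexx orbT.
by apply: le_trans Ue _; rewrite lee_fin ge_min lexx.
Qed.

Lemma hausdorff_null_sub E F : E `<=` F -> hausdorff_null F -> hausdorff_null E.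
Proof. by move=> EF nF e /nF[U [FU Ue]]; exists U; split=> //; exact: subset_trans FU. Qed.

Lemma hausdorff_null_bigcup (E : nat -> set space) :
  (forall n, hausdorff_null (E n)) -> hausdorff_null (\bigcup_n E n).
Proof.
move=> nE e e0.
have [U UP] : exists U : nat -> nat -> set space, forall n, E n `<=` \bigcup_i U n i /\
    (\sum_(0 <= i <oo) diam_pow t (U n i) <= (e / (2 ^ n.+1)%:R)%:E)%E.
  suff /choice[U UP] : forall n, exists V : nat -> set space, E n `<=` \bigcup_i V i /\
    (\sum_(0 <= i <oo) diam_pow t (V i) <= (e / (2 ^ n.+1)%:R)%:E)%E by exists U.
  by move=> n; apply: nE; rewrite divr_gt0// ltr0n expn_gt0.
have : ([set: nat] #= [set: nat * nat])%card by rewrite card_eq_sym; exact: card_nat2.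
move=> /pcard_eqP/bijPex[f bf].
exists (fun k => U (f k).1 (f k).2); split.
  move=> x [n _ Enx]; have [i _ Uix] := (UP n).1 x Enx.
  have [k _ fk] : (f @` [set: nat]) (n, i) by have [_ _] := bf; exact.
  by exists k => //; rewrite fk.
rewrite nneseries_esum; last by move=> n _; exact: diam_pow_ge0.
have -> : [set x : nat | true] = [set: nat] by apply/seteqP; split.
rewrite -(reindex_esum setT setT f (fun p => diam_pow t (U p.1 p.2)))//.
rewrite -(_ : setT `*`` (fun=> setT) = [set: nat * nat]); last by apply/seteqP; split.
rewrite -(@esum_esum _ _ _ setT (fun=> setT) (fun n i => diam_pow t (U n i))); last first.
  by move=> *; exact: diam_pow_ge0.
apply: (@le_trans _ _ (\sum_(0 <= n <oo) (0 + (e / (2 ^ n.+1)%:R)%:E))%E); last first.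
  apply: le_trans (@epsilon_trick R (fun=> 0%E) e xpredT _ _) _ => //; first exact: ltW.
  by rewrite eseries0// add0e.
rewrite nneseries_esum; last first.
  by move=> n _; rewrite add0e lee_fin divr_ge0// ltW.
have -> : [set x : nat | true] = [set: nat] by apply/seteqP; split.
apply: le_esum => n _; rewrite add0e.
have := (UP n).2; rewrite nneseries_esum; last by move=> i _; exact: diam_pow_ge0.
by have -> : [set x : nat | true] = [set: nat] by apply/seteqP; split.
Qed.

Lemma hausdorff_null_set0 : hausdorff_null set0.
Proof.
move=> e e0; exists (fun=> set0); split => //.
by rewrite eseries0 ?lee_fin ?ltW// => i _ _; exact: diam_pow_set0.
Qed.

Lemma hausdorff_null_countable (T : countType) (E : T -> set space) :
  (forall i, hausdorff_null (E i)) -> hausdorff_null [set x | exists i, E i x].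
Proof.
move=> nE; pose F n := if unpickle n is Some i then E i else set0.
apply: (@hausdorff_null_sub _ (\bigcup_n F n)).
  by move=> x [i Ei]; exists (pickle i) => //; rewrite /F pickleK.
apply: hausdorff_null_bigcup => n; rewrite /F; case: unpickle => [i|]; first exact: nE.
exact: hausdorff_null_set0.
Qed.

(** The family is padded with empty sets, which cost 0 by the convention of [diam_pow]. *)
Lemma finite_cover_sum (I : finType) (V : I -> set space) :
  exists U : nat -> set space, \bigcup_i U i = [set x | exists i, V i x] /\
    (\sum_(0 <= i <oo) diam_pow t (U i) = \sum_i diam_pow t (V i))%E.
Proof.
pose U n := if insub n is Some k then V (enum_val (k : 'I_#|I|)) else set0.
exists U; split.
  apply/seteqP; split => [x [n _]|x [i Vix]].
    by rewrite /U; case: insubP => // k _ _ Vk; exists (enum_val k).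
  exists (enum_rank i) => //; rewrite /U; case: insubP => [k _ ki|]; last by rewrite ltn_ord.
  by rewrite (_ : k = enum_rank i) ?enum_rankK//; exact: val_inj.
rewrite (nneseries_split 0 #|I|); last by move=> k _; exact: diam_pow_ge0.
rewrite eseries0 ?adde0; last first.
  move=> n; rewrite add0n => nI _; rewrite /U; case: insubP => [k|_]; last exact: diam_pow_set0.
  by rewrite ltnNge nI.
rewrite add0n big_mkord (reindex (@enum_rank I)) /=; last exact/onW_bij/enum_rank_bij.
apply: eq_bigr => i _; congr (diam_pow _ _); rewrite /U.
case: insubP => [k _ ki|]; last by rewrite ltn_ord.
by rewrite (_ : k = enum_rank i) ?enum_rankK//; exact: val_inj.
Qed.

Lemma hausdorff_null_set1 (x : space) : hausdorff_null [set x].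
Proof.
move=> e e0; have [U [UE Us]] := @finite_cover_sum unit (fun=> [set x]).
exists U; split; first by rewrite UE => y ->; exists tt.
rewrite Us big_const_seq; apply: (@le_trans _ _ 0%E); last by rewrite lee_fin ltW.
elim: (count _ _) => [|n IH]//=; apply: adde_le0 => //.
apply: le_trans (@diam_pow_le _ 0 _ _) _ => //.
  by move=> y z -> ->; rewrite /eucl_dist big1 ?sqrtr0// => i _; rewrite subrr expr0n.
by rewrite powR0 ?lee_fin// gt_eqF.
Qed.

End HausdorffNull.

(** * The exceptional set *)

Section BoxCounting.
Variable R : realType.
Local Notation plane := 'rV[R]_2.

Lemma uniq_size_le_counting (T : choiceType) (l : seq T) (S : set T) :
  uniq l -> (forall x, x \in l -> S x) -> ((size l)%:R%:E <= counting S :> \bar R)%E.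
Proof.
move=> ul lS; rewrite /counting; case: asboolP => [fS|_]; last exact: leey.
rewrite lee_fin ler_nat uniq_leq_size// => x xl.
by have h := in_fset_set fS x; rewrite (mem_set (lS _ xl)) in h; exact: h.
Qed.

Lemma image_count_le_grid_count (x : plane) (B : set plane) (Y : finType) (y : Y -> plane) (de : R) :
  0 < de -> (forall j, B (y j)) ->
  ((image_count (fun j => Num.floor (edist (coords x) (coords (y j)) / de)))%:R%:E
     <= grid_count (dist_set x B) de)%E.
Proof.
move=> de0 By; rewrite /image_count; set f := fun j => _; set ss := undup _.
rewrite -(size_map (fun k : int => const_mx k : 'rV[int]_1)).
apply: uniq_size_le_counting.
  rewrite map_inj_uniq ?undup_uniq// => u v /matrixP/(_ ord0 ord0).
  by rewrite !mxE.
move=> k /mapP[u]; rewrite mem_undup => /mapP[j _ ->] ->.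
exists (const_mx (eucl_dist x (y j))); split; first by exists (y j).
move=> i; rewrite !mxE eucl_distE /f -ler_pdivlMr// floor_le/=.
by rewrite -ltr_pdivrMr//; have := floorD1_gt (edist (coords x) (coords (y j)) / de); rewrite intrD.
Qed.

Lemma ln_image_count_le (x : plane) (B : set plane) (Y : finType) (y : Y -> plane) (de v : R) (j0 : Y) :
  0 < de < 1 -> (forall j, B (y j)) ->
  (lne (grid_count (dist_set x B) de) * ((- ln de)^-1)%:E <= v%:E)%E ->
  ln (image_count (fun j => Num.floor (edist (coords x) (coords (y j)) / de)))%:R <= v * - ln de.
Proof.
move=> /andP[de0 de1] By.
have L0 : 0 < - ln de by rewrite oppr_gt0 ln_lt0// de0 de1.
have := @image_count_le_grid_count x B Y y de de0 By.
set N := image_count _.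
have N0 : (0 < N)%N.
  rewrite /N /image_count; set f := fun j => _; set s := undup _.
  have : f j0 \in s by rewrite mem_undup map_f// mem_enum.
  by case: s.
case: (grid_count _ _) => [g| |]; last by rewrite leeNy_eq.
  rewrite lee_fin => Ng; have g0 : 0 < g by apply: lt_le_trans Ng; rewrite ltr0n.
  rewrite lne_EFin// -EFinM lee_fin ler_pdivrMr// => h.
  by apply: le_trans h; rewrite ler_ln ?posrE// ltr0n.
(* An infinite count is excluded: its logarithm times a positive number would be infinite. *)
by move=> _; rewrite /= gt0_mulye ?lte_fin ?invr_gt0// leye_eq.
Qed.

(** Gap and threshold are inverses of integers, so that the exceptional set splits into countably
    many parts with uniform constants. *)
Lemma upper_box_dim_lt1 (F : set 'rV[R]_1) : (upper_box_dim F < 1)%E ->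
  exists nm : nat * nat, forall de : R, 0 < de < nm.2.+1%:R^-1 ->
    (lne (grid_count F de) * ((- ln de)^-1)%:E <= (1 - nm.1.+1%:R^-1)%:E)%E.
Proof.
rewrite /upper_box_dim /limf_esup => /ereal_inf_ltP[_ [V V0 <-]] V1.
have [n nV] : exists n : nat, forall de, V de ->
    (lne (grid_count F de) * ((- ln de)^-1)%:E <= (1 - n.+1%:R^-1)%:E)%E.
  set S := ereal_sup _ in V1.
  have up de : V de -> (lne (grid_count F de) * ((- ln de)^-1)%:E <= S)%E.
    by move=> Vd; apply: ereal_sup_ubound; exists de.
  suff [n Sn] : exists n : nat, (S <= (1 - n.+1%:R^-1)%:E)%E.
    by exists n => de /up /le_trans; apply.
  move: S V1 {up} => [r| |]//; last by exists 0%N; rewrite leNye.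
  rewrite lte_fin => r1; exists (Num.truncn (1 - r)^-1); rewrite lee_fin.
  have : (Num.truncn (1 - r)^-1).+1%:R^-1 <= 1 - r.
    rewrite -[leRHS]invrK lef_pV2 ?posrE ?invr_gt0 ?subr_gt0 ?ltr0n//.
    by rewrite ltW// truncnS_gt.
  by rewrite !lerBrDr addrC.
move: V0; rewrite /at_right /= => -[e /= e0 eV].
exists (n, Num.truncn e^-1) => de /andP[de0 dee] /=; apply: nV; apply: eV => //.
rewrite /ball_ /= sub0r normrN gtr0_norm//; apply: lt_le_trans dee _.
rewrite -[leRHS]invrK lef_pV2 ?posrE ?invr_gt0 ?ltr0n//.
by rewrite ltW// truncnS_gt.
Qed.

End BoxCounting.

(** * One small piece of the exceptional set *)

Section Pieces.
Variable R : realType.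
Local Notation plane := 'rV[R]_2.
Implicit Types p q : R * R.

(** Exchanging coordinates when needed makes the direction from the piece to [y1] have slope at most
    1. *)
Definition swap_if (b : bool) (T : Type) (p : T * T) : T * T := if b then (p.2, p.1) else p.

Lemma swap_ifK b (T : Type) : involutive (@swap_if b T).
Proof. by case: b => [] []. Qed.

Lemma supdist_swap_if b p q : supdist (swap_if b p) (swap_if b q) = supdist p q.
Proof. by case: b => //=; rewrite /supdist /= maxC. Qed.

Lemma edist_swap_if b p q : edist (swap_if b p) (swap_if b q) = edist p q.
Proof. by case: b => //=; rewrite /edist /= addrC. Qed.

Lemma grid_index_swap_if b (g : R) p : grid_index g (swap_if b p) = swap_if b (grid_index g p).
Proof. by case: b. Qed.

Lemma image_count_comp (Y : finType) (T T' : eqType) (f : Y -> T) (h : T -> T') :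
  (image_count (fun j => h (f j)) <= image_count f)%N.
Proof.
rewrite /image_count -(size_map h (undup _)); apply: uniq_leq_size; first exact: undup_uniq.
move=> z; rewrite mem_undup => /mapP[j _ ->].
by apply: map_f; rewrite mem_undup map_f// mem_enum.
Qed.

Lemma frostman_swap_if b (I : finType) (w : I -> R) (p : I -> R * R) (C s r : R) :
  frostman w p C s r -> frostman w (fun i => swap_if b (p i)) C s r.
Proof.
by move=> fr i rho h; under eq_bigl do rewrite supdist_swap_if; exact: fr.
Qed.

Lemma frostman_le (I : finType) (w : I -> R) (p : I -> R * R) (C C' s r : R) :
  C <= C' -> frostman w p C s r -> frostman w p C' s r.
Proof.
by move=> CC fr i rho h; apply: le_trans (fr i rho h) _; rewrite ler_wpM2r// powR_ge0.
Qed.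

(** The content bound, tested on finite families of dyadic cells; a cell has diameter at most twice
    its side, which costs [2 ^ t]. *)
Lemma not_null_cover (t : R) (E : set plane) : 0 < t -> ~ hausdorff_null t E ->
  exists2 e : R, 0 < e & forall (I : finType) (P : pred I) (k : I -> nat) (z : I -> int * int),
     (forall x, E x -> exists2 i, P i & dyadic (k i) (coords x) = z i) ->
     e <= \sum_(i | P i) (2^-1 ^+ k i) `^ t.
Proof.
move=> t0 nE.
have [e e0 he] : exists2 e : R, 0 < e & forall U : nat -> set plane, E `<=` \bigcup_i U i ->
    ~ (\sum_(0 <= i <oo) diam_pow t (U i) <= e%:E)%E.
  apply: contrapT => h; apply: nE => e e0; apply: contrapT => h'; apply: h.
  by exists e => // U EU Ue; apply: h'; exists U.
have p2 : 0 < (2 : R) `^ t by rewrite powR_gt0.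
exists (e / 2 `^ t); first by rewrite divr_gt0.
move=> I P k z cov; rewrite ler_pdivrMr// leNgt; apply/negP => small.
pose V i : set plane := if P i then grid_cell (2^-1 ^+ k i) (z i) else set0.
have [U [UE Us]] := finite_cover_sum t V.
apply: (he U); first by rewrite UE => x /cov[i Pi ei]; exists i; rewrite /V Pi.
rewrite Us; apply: (@le_trans _ _ (\sum_i (if P i then (2^-1 ^+ k i) `^ t * 2 `^ t else 0)%:E)%E).
  apply: lee_sum => i _; rewrite /V; case: ifP => _; last by rewrite diam_pow_set0.
  have h0 : 0 < 2^-1 ^+ k i :> R by rewrite exprn_gt0// invr_gt0.
  rewrite -powRM ?(ltW h0)//; apply: diam_pow_le => //.
  move=> x y xz yz; rewrite eucl_distE; apply: le_trans (edist_le_supdist _ _) _.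
  rewrite mulrC ler_wpM2r// ge_max.
  by have [] := grid_index_near h0 (etrans xz (esym yz)) => -> ->.
rewrite sumEFin lee_fin -big_mkcond /= -mulr_suml; exact: ltW.
Qed.

Lemma coords_le p q (a : R) : supdist p q <= 1 -> `|q.1| + `|q.2| + 1 <= a ->
  `|p.1| <= a /\ `|p.2| <= a.
Proof.
rewrite ge_max => /andP[h1 h2] qa.
have e1 : p.1 = q.1 + (p.1 - q.1) by ring.
have e2 : p.2 = q.2 + (p.2 - q.2) by ring.
have := ler_normD q.1 (p.1 - q.1); have := ler_normD q.2 (p.2 - q.2).
have := normr_ge0 q.1; have := normr_ge0 q.2.
by rewrite -e1 -e2; split; lra.
Qed.

Lemma sector_bounds (c : R) p p0 q q0 : 0 < c -> supdist p p0 <= c -> supdist q q0 <= c ->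
  16 * c <= `|p0.1 - q0.1| -> `|p0.2 - q0.2| <= `|p0.1 - q0.1| ->
  8 * c <= `|p.1 - q.1| /\ `|slope p q| <= 2.
Proof.
rewrite !ge_max => c0 /andP[h1 h2] /andP[h3 h4] f1 f2.
have low : `|p0.1 - q0.1| - 2 * c <= `|p.1 - q.1|.
  have -> : p0.1 - q0.1 = (p.1 - q.1) - (p.1 - p0.1) + (q.1 - q0.1) by ring.
  have := ler_normD ((p.1 - q.1) - (p.1 - p0.1)) (q.1 - q0.1).
  have := ler_normB (p.1 - q.1) (p.1 - p0.1).
  lra.
have upp : `|p.2 - q.2| <= `|p0.2 - q0.2| + 2 * c.
  have -> : p.2 - q.2 = (p.2 - p0.2) - (q.2 - q0.2) + (p0.2 - q0.2) by ring.
  have := ler_normD ((p.2 - p0.2) - (q.2 - q0.2)) (p0.2 - q0.2).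
  have := ler_normB (p.2 - p0.2) (q.2 - q0.2).
  lra.
by split; first lra; rewrite /slope normrM normfV ler_pdivrMr; lra.
Qed.

Section OnePiece.
Variables (mu : borel_measure R 2) (B : set plane) (s C t : R) (y1 : plane).
Hypotheses (bB : borel_set B) (muB : mu (~` B) = 0%E).
Hypothesis reg : forall (x : plane) (r : R), msupport mu x -> 0 < r <= 1 ->
  ((C^-1 * r `^ s)%:E <= mu (eucl_closed_ball x r) <= (C * r `^ s)%:E)%E.
Hypotheses (s1 : 1 < s) (t1 : 1 < t) (C1 : 1 < C) (y1S : msupport mu y1).

Lemma piece_null (E : set plane) (x0 : plane) (ka : R) (n m : nat) :
  E x0 -> 0 < ka <= 1 -> (forall x, E x -> supdist (coords x) (coords x0) <= ka / 16) ->
  ka <= supdist (coords x0) (coords y1) ->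
  (forall x, E x -> forall de : R, 0 < de < m.+1%:R^-1 ->
    (lne (grid_count (dist_set x B) de) * ((- ln de)^-1)%:E <= (1 - n.+1%:R^-1)%:E)%E) ->
  hausdorff_null t E.
Proof.
move=> Ex0 /andP[ka0 ka1] Eka far Ebox; apply: contrapT => nE.
set gap : R := n.+1%:R^-1 in Ebox.
have gap0 : 0 < gap by rewrite invr_gt0 ltr0n.
have gap1 : gap <= 1 by rewrite invf_le1 ?ltr0n// ler1n.
have gapN : 2 <= gap * (2 * n.+1 + m)%:R.
  by rewrite ler_pdivlMl ?ltr0n// -natrM ler_nat mulnC leq_addr.
clearbody gap.
have eighth (z : R) : z <= 1 / 4 -> z / 4 <= 1 / 8 by move=> ?; lra.
have quarter_lt1 (z : R) : z <= 1 / 4 -> z < 1 by move=> ?; lra.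
have gap_contra (g k : R) : 0 < g -> 2 <= g * k -> ~ (1 - g / 2) * k <= (1 - g) * (k + 1).
  by move=> *; lra.
have t0 : 0 < t by exact: lt_trans t1.
have s0 : 0 < s by exact: lt_trans s1.
have C0 : 0 < C by exact: lt_trans C1.
have [e0 e00 cov] := not_null_cover t0 nE.
pose c := ka / 16.
have c01 : 0 < c <= 1 / 8 by rewrite /c; apply/andP; split; lra.
have /andP[c0 c8] := c01.
pose b := `|(coords x0).1 - (coords y1).1| < `|(coords x0).2 - (coords y1).2|.
pose px (x : plane) := swap_if b (coords x).
have bfar : ka <= `|(px x0).1 - (px y1).1| /\ `|(px x0).2 - (px y1).2| <= `|(px x0).1 - (px y1).1|.
  move: far; rewrite /px /b /supdist le_max; case: ltP => h /=; last first.
    by move=> /orP[h1|h1]; split => //; exact: le_trans h.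
  by move=> /orP[h1|h1]; split => //; [exact: le_trans (ltW h) | exact: ltW | exact: ltW].
have supE (x y : plane) : supdist (px x) (px y) = supdist (coords x) (coords y) by exact: supdist_swap_if.
have [D D0 [Dx Dy]] : exists2 D, (0 < D)%N & `|(px x0).1| + `|(px x0).2| + 1 <= D%:R /\
    `|(px y1).1| + `|(px y1).2| + 1 <= D%:R :> R.
  exists (Num.truncn (`|(px x0).1| + `|(px x0).2| + 1 + (`|(px y1).1| + `|(px y1).2| + 1))).+1 => //.
  by split; apply: le_trans (ltW (truncnS_gt _)); rewrite ?lerDl ?lerDr !addr_ge0.
have c1 : c <= 1 by apply: le_trans c8 _; rewrite ler_pdivrMr// mul1r ler1n.
pose m0 : R := C^-1 * (c / 2) `^ s.
have m00 : 0 < m0 by rewrite mulr_gt0 ?invr_gt0// powR_gt0// divr_gt0.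
pose Cmu := 4 `^ s * (1 + C / m0).
pose Cnu := 25 * 2 `^ t / e0.
have Cmu0 : 0 < Cmu by rewrite mulr_gt0 ?powR_gt0// addr_gt0// divr_gt0.
have Cnu0 : 0 < Cnu by rewrite divr_gt0// mulr_gt0// powR_gt0.
pose C2 := 25 * C ^+ 2 * 4 `^ s.
have C20 : 0 < C2 by rewrite mulr_gt0 ?powR_gt0// mulr_gt0// exprn_gt0.
have e01 : 0 < gap / 2 < 1.
  by rewrite divr_gt0//= ltr_pdivrMr// mul1r (le_lt_trans gap1)// ltr1n.
have Cs0 : 0 < Cmu + Cnu by rewrite addr_gt0.
have c80 : 0 < 8 * c by rewrite mulr_gt0.
have [r /andP[r0 r4] core] := @pinned_distance_count R D (Cmu + Cnu) C2 (8 * c) s t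
  (gap / 2) D0 Cs0 C20 c80 s1 t1 e01.
have [n0 n0r] : exists n0 : nat, 2^-1 ^+ n0 <= r.
  exists (Num.truncn r^-1).+1.
  rewrite exprVn -[leRHS]invrK lef_pV2 ?posrE ?invr_gt0 ?exprn_gt0//.
  apply: le_trans (ltW (truncnS_gt r^-1)) _.
  by rewrite -natrX ler_nat ltnW// ltn_expl.
have Ebound x : E x -> `|(px x).1| <= D%:R /\ `|(px x).2| <= D%:R.
  by move=> Ex; apply: coords_le Dx; rewrite supE; exact: le_trans (Eka x Ex) c1.
have [X [nu [pX [EX nu0 nu1 frX]]]] : exists (X : finType) (nu : X -> R) (pX : X -> R * R),
    [/\ forall i, exists2 x, E x & pX i = px x, forall i, 0 <= nu i, \sum_i nu i = 1 &
        frostman nu pX Cnu t (2^-1 ^+ n0)].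
  apply: (@frostman_exists R (fun p => exists2 x, E x & p = px x) D n0 e0 t) => //.
  - exact: ltW.
  - by exists (px x0), x0.
  - by move=> p [x Ex ->]; exact: Ebound.
  - move=> I P k z h; apply: (cov I P k (fun i => swap_if b (z i))) => x Ex.
    have [i Pi e] := h (px x) (ex_intro2 _ _ x Ex erefl).
    by exists i => //; rewrite -e /dyadic /px grid_index_swap_if swap_ifK.
(* [2 * n.+1] gives [gap * K >= 2], so that the gain [gap / 2] in the exponent outweighs the passage
   from [K] to [K.+1]; [m] brings [r ^+ K.+1] below the threshold [1 / m.+1]. *)
pose K := (2 * n.+1 + m)%N.
have rK : 0 < r ^+ K.+1 by rewrite exprn_gt0.
have [Y [w [y [By [w0 w1] frY cnt]]]] := @ahlfors_discretise R mu B s C c y1 bB muB reg s0 C1 y1S c01 (r ^+ K.+1) rK.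
have Xbound i : `|(pX i).1| <= D%:R /\ `|(pX i).2| <= D%:R.
  by have [x Ex ->] := EX i; exact: Ebound.
have Ybound j : `|(px (y j)).1| <= D%:R /\ `|(px (y j)).2| <= D%:R.
  by apply: coords_le Dy; rewrite supE; apply: le_trans c1; have [] := By j.
have geo i j : 8 * c <= `|(pX i).1 - (px (y j)).1| /\ `|slope (pX i) (px (y j))| <= 2.
  have [x Ex ->] := EX i; have [f1 f2] := bfar.
  apply: (@sector_bounds c _ (px x0) _ (px y1)); rewrite ?supE//; first exact: Eka.
    by have [] := By j.
  by rewrite /c mulrC divfK.
have [i hi] : exists i, (1 - gap / 2) * K%:R * - ln r <=
    ln (image_count (fun j => Num.floor (edist (pX i) (px (y j)) / r ^+ K.+1)))%:R.
  apply: (core X nu pX K Y w) => // [i|i|j|j|i j|i j|||];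
    rewrite ?(Xbound i).1 ?(Xbound i).2 ?(Ybound j).1 ?(Ybound j).2 ?(geo i j).1 ?(geo i j).2//.
  - by apply: frostman_le (frostman_weaken n0r frX); rewrite lerDr ltW.
  - by apply: frostman_le (frostman_swap_if b frY); rewrite lerDl ltW.
  move=> k kK.
  have rk : 0 < r ^+ k.+1 by rewrite exprn_gt0.
  have rk4 : 0 < r ^+ k.+1 / 4 <= 1 / 8.
    have rk1 : r ^+ k <= 1 by apply: exprn_ile1; [exact: ltW|exact/ltW/quarter_lt1].
    rewrite divr_gt0//=; apply: eighth; rewrite exprS; apply: le_trans r4.
    by rewrite ler_piMr// ltW.
  apply: (@le_trans _ _ (image_count (fun j => grid_index (r ^+ k.+1 / 4) (coords (y j))))%:R).
    rewrite ler_nat; under [X in image_count X]eq_fun do rewrite grid_index_swap_if.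
    exact: image_count_comp.
  have e : (r ^+ k.+1 / 4) `^ (- s) = 4 `^ s * (r ^+ k.+1) `^ (- s).
    by rewrite powRM ?(ltW rk)// mulrC -powR_inv1// -powRrM mulN1r opprK.
  by apply: le_trans (cnt _ rk4) _; rewrite e /C2 !mulrA.
have [x Ex exi] := EX i.
have [j0 _] : exists2 j : Y, true & true.
  case: (pickP (@predT Y)) => [j _|p0]; first by exists j.
  by move: w1; rewrite (eq_bigl pred0)// big_pred0// => /eqP; rewrite eq_sym oner_eq0.
have r1 : r < 1 by exact: quarter_lt1.
have L0 : 0 < - ln r by rewrite oppr_gt0 ln_lt0// r0 r1.
have rKm : r ^+ K.+1 < m.+1%:R^-1.
  apply: (@le_lt_trans _ _ ((1 / 4) ^+ K.+1)).
    by rewrite lerXn2r ?nnegrE// ltW.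
  rewrite div1r exprVn ltf_pV2 ?posrE ?exprn_gt0 ?ltr0n// -natrX ltr_nat.
  apply: (@leq_ltn_trans K.+1); first by rewrite ltnS /K leq_addl.
  by rewrite ltn_expl.
have rK1 : r ^+ K.+1 < 1.
  by apply: lt_le_trans rKm _; rewrite invf_le1 ?ltr0n// ler1n.
have hb := Ebox x Ex (r ^+ K.+1); rewrite rK rKm in hb; have {}hb := hb isT.
have rKK : 0 < r ^+ K.+1 < 1 by rewrite rK rK1.
have := ln_image_count_le j0 rKK (fun j => (By j).1) hb.
rewrite lnXn// -mulNrn -[(- ln r) *+ _]mulr_natr => h2.
have h1 : (1 - gap / 2) * K%:R * - ln r <=
    (1 - gap) * (- ln r * K.+1%:R).
  apply: le_trans h2; rewrite exi in hi.
  by move: hi; rewrite /px; under [X in image_count X]eq_fun do rewrite edist_swap_if.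
have h3 : (1 - gap / 2) * K%:R <= (1 - gap) * K.+1%:R :> R.
  by rewrite -(ler_pM2r L0) [leRHS]mulrAC -mulrA.
have h4 : (1 - gap / 2) * K%:R <= (1 - gap) * (K%:R + 1) by rewrite natr1.
by case: (gap_contra _ _ gap0 gapN h4).
Qed.

End OnePiece.

End Pieces.

(** * Countable decomposition and the dimension bound *)

Section Exceptional.
Variable R : realType.
Local Notation plane := 'rV[R]_2.

Lemma coords_inj : injective (@coords R).
Proof.
move=> x y [e1 e2]; apply/matrixP => i j; rewrite (ord1 i).
by move: j; apply: ord2P.
Qed.

Lemma supdist_eq0 (p q : R * R) : supdist p q <= 0 -> p = q.
Proof.
rewrite ge_max !normr_le0 !subr_eq0 => /andP[/eqP e1 /eqP e2].
by rewrite (surjective_pairing p) e1 e2 -surjective_pairing.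
Qed.

(** Countably many pieces: by gap and threshold [(n, m)], by a lower bound [1 / k.+1] on the
    distance to a fixed support point [y1], and by grid cells of a sixteenth of that bound. The
    remaining point [y1] is null by itself. *)
Lemma exceptional_null (B : set plane) (s C t : R) :
  borel_set B -> 1 < s -> 1 < C -> 1 < t -> ahlfors_regular s C B ->
  hausdorff_null t [set x | (upper_box_dim (dist_set x B) < 1)%E].
Proof.
move=> bB s1 C1 t1 [mu [muT muB reg]].
have t0 : 0 < t by exact: lt_trans t1.
have [y1 [_ _ y1S]] : exists x, [/\ [set: plane] x, B x & msupport mu x].
  by apply: support_point => //; rewrite lt0e muT measure_ge0.
pose Ebox (nm : nat * nat) : set plane := [set x | forall de : R, 0 < de < nm.2.+1%:R^-1 ->
    (lne (grid_count (dist_set x B) de) * ((- ln de)^-1)%:E <= (1 - nm.1.+1%:R^-1)%:E)%E].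
apply: (@hausdorff_null_sub R 2 t _ [set x | exists nm, Ebox nm x]).
  by move=> x /upper_box_dim_lt1.
apply: hausdorff_null_countable => -[n m].
pose piece (o : option (nat * (int * int))) : set plane := if o is Some (k, z) then
  [set x | [/\ Ebox (n, m) x, k.+1%:R^-1 <= supdist (coords x) (coords y1) &
     grid_index (k.+1%:R^-1 / 16) (coords x) = z]] else [set y1].
apply: (@hausdorff_null_sub R 2 t _ [set x | exists o, piece o x]).
  move=> x Ex; have [xy|xy] := leP (supdist (coords x) (coords y1)) 0.
    by exists None; exact/coords_inj/supdist_eq0.
  pose k := Num.truncn (supdist (coords x) (coords y1))^-1.
  exists (Some (k, grid_index (k.+1%:R^-1 / 16) (coords x))); split => //.
  rewrite -[leRHS]invrK lef_pV2 ?posrE ?invr_gt0 ?ltr0n//.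
  by rewrite ltW// truncnS_gt.
apply: hausdorff_null_countable => -[[k z]|]; last exact: hausdorff_null_set1.
have [[x0 Px0]|nP] := pselect (exists x, piece (Some (k, z)) x); last first.
  apply: (@hausdorff_null_sub R 2 t _ set0); last exact: hausdorff_null_set0.
  by move=> x Px; apply: nP; exists x.
have k0 : 0 < k.+1%:R^-1 :> R by rewrite invr_gt0.
apply: (@piece_null R mu B s C t y1 bB muB reg s1 t1 C1 y1S _ x0 k.+1%:R^-1 n m) => //.
- by rewrite k0 invf_le1 ?ltr0n// ler1n.
- move=> x [_ _ xz]; have [_ _ x0z] := Px0.
  have g0 : 0 < k.+1%:R^-1 / 16 :> R by rewrite divr_gt0.
  by have [h1 h2] := grid_index_near g0 (etrans xz (esym x0z)); rewrite ge_max h1 h2.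
- by have [] := Px0.
- by move=> x [].
Qed.

Lemma hausdorff_dim_le1 (E : set plane) :
  (forall t : R, 1 < t -> hausdorff_null t E) -> (hausdorff_dim E <= 1)%E.
Proof.
move=> nE; apply/lee_addgt0Pr => e e0; apply: ereal_inf_lbound.
have t1 : 1 < 1 + e by rewrite ltrDl.
exists (1 + e); last by rewrite EFinD.
split; first by rewrite addr_ge0// ltW.
by apply: hausdorff_null_measure (nE _ t1); exact: lt_trans t1.
Qed.

End Exceptional.

Local Open Scope ereal_scope.

Theorem corollary1p5 (R : realType) :
  (forall (A B : set 'rV[R]_2) (s C : R),
     borel_set A -> borel_set B ->
     1 < hausdorff_dim A ->
     (1 < s)%R -> (1 < C)%R -> ahlfors_regular s C B ->
     hausdorff_dim [set x | A x /\ upper_box_dim (dist_set x B) < 1] <= 1)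
  /\
  (forall (B : set 'rV[R]_2) (s C : R),
     borel_set B ->
     (1 < s)%R -> (1 < C)%R -> ahlfors_regular s C B ->
     hausdorff_dim [set x | B x /\ upper_box_dim (dist_set x B) < 1] <= 1).
Proof.
have main (A B : set 'rV[R]_2) (s C : R) : borel_set B ->
    (1 < s)%R -> (1 < C)%R -> ahlfors_regular s C B ->
    hausdorff_dim [set x | A x /\ upper_box_dim (dist_set x B) < 1] <= 1.
  move=> bB s1 C1 rB; apply: hausdorff_dim_le1 => t t1.
  apply: (hausdorff_null_sub _ (exceptional_null bB s1 C1 t1 rB)).
  by move=> x [].
by split => [A B s C _ bB _|B s C bB]; exact: main.
Qed.
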